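(* Fix $i\in\mathbb S$. Let $\Phi,\Psi\in\mathcal W(\mathbb R,\mathbb H)$. Then $T_\Phi T_\Psi$ is a Wiener-Hopf operator (i.e. $T_\Phi T_\Psi=T_G$ for some $G\in\mathcal W(\mathbb R,\mathbb H)$) if and only if $\Phi\in\mathcal W_-(i\mathbb R,\mathbb H)$ or $\Psi\in\mathcal W_+(i\mathbb R,\mathbb H)$. In this case, $T_\Phi T_\Psi=T_{\Phi\star\Psi}$.
   Context: $\mathbb H$ is the real algebra of quaternions, $\mathbb S=\{q\in\mathbb H:q^2=-1\}$. For $i\in\mathbb S$ choose $j\in\mathbb S$ orthogonal to $i$ (i.e. $ij+ji=0$); every quaternion is uniquely $z+wj$ with $z,w\in\mathbb C_i=\{x+iy:x,y\in\mathbb R\}\cong\mathbb C$. $\mathcal W(\mathbb R,\mathbb H)$ is the set of functions $F(p)=c+\int_{\mathbb R}e^{pu}f(u)\,du$, $p\in\{it:t\in\mathbb R,\ i\in\mathbb S\}$, with $c\in\mathbb H$ and $f\in L_1(\mathbb R,\mathbb H)$. For $F_k(p)=c_k+\int_{\mathbb R}e^{pu}f_k(u)\,du$, $k=1,2$, $$(F_1\star F_2)(p)=c_1c_2+\int_{\mathbb R}e^{pu}\big(c_1f_2(u)+f_1(u)c_2+(f_1\circ f_2)(u)\big)\,du,\quad (f_1\circ f_2)(u)=\int_{\mathbb R}f_1(u-v)f_2(v)\,dv.$$ $\mathcal W_+(i\mathbb R,\mathbb H)$ (resp. $\mathcal W_-(i\mathbb R,\mathbb H)$) is the set of elements $F(iy)=c+\int_{\mathbb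 R}e^{iyu}f(u)\,du$ with $F\in\mathcal W(\mathbb R,\mathbb H)$ and $f(u)=0$ for (almost every) $u<0$ (resp. $u>0$). $L_2(i\mathbb R,\mathbb H)$ is the space of functions $g(iy)=g_1(iy)+g_2(iy)j$ with $g_1,g_2$ square-integrable $\mathbb C_i$-valued functions on $i\mathbb R$, with norm $\|g\|^2=\|g_1\|^2_{L_2(i\mathbb R)}+\|g_2\|^2_{L_2(i\mathbb R)}$. The Hardy space $H_2(\Pi_{+,i})$ is identified, via boundary values, with the closed subspace of $L_2(i\mathbb R,\mathbb H)$ consisting of the functions $F(iy)=\int_0^\infty e^{iyu}f(u)\,du$ (a.e., in the $L_2$-Fourier (Plancherel) sense) with $f\in L_2([0,\infty),\mathbb H)$, and $P_i$ denotes the orthogonal projection of $L_2(i\mathbb R,\mathbb H)$ onto $H_2(\Pi_{+,i})$. For $\Phi(iy)=c+\int_{\mathbb R}e^{iyu}\phi(u)\,du\in\mathcal W(\mathbb R,\mathbb H)$ and $F(iy)=\int_0^\infty e^{iyu}f(u)\,du\in H_2(\Pi_{+,i})$, with $f$ extended by $0$ to $u<0$, put $$(M_\Phi F)(iy)=(\Phi\star F)(iy)=\int_{0}^\infty e^{iyu}c f(u)\,du+\int_{\mathbb R}e^{iyu}(\phi\circ f)(u)\,du ,\qquad (\phi\circ f)(u)=\int_{\mathbb R}\phi(u-v)f(v)\,dv,$$ which lies in $L_2(i\mathbb R,\mathbb H)$. The Wiener-Hopf operator based on $\Phi$ is $T_\Phi:H_2(\Pi_{+,i})\to H_2(\Pi_{+,i})$,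 $T_\Phi F=P_iM_\Phi F$. *)

(* Defs.v *)
From HB Require Import structures.
From mathcomp Require Import all_boot all_order all_algebra.
From mathcomp Require Import ring lra.
From mathcomp Require Import all_classical all_reals all_analysis.
Set Implicit Arguments.
Unset Strict Implicit.
Unset Printing Implicit Defensive.
Import Order.TTheory GRing.Theory Num.Theory.
Import numFieldNormedType.Exports.
Local Open Scope classical_set_scope.
Local Open Scope ring_scope.

(* Real quaternions a + b e1 + c e2 + d e3, with e1 e2 = e3 = - e2 e1. *)
Record quat (R : Type) := Quat { qre : R; qim1 : R; qim2 : R; qim3 : R }.

Section QuaternionAlgebra.
Variable R : realType.
Implicit Types (x y z : quat R) (a b : R).

Let enc x := (qre x, qim1 x, qim2 x, qim3 x).
Let dec (t : R * R * R * R) := Quat t.1.1.1 t.1.1.2 t.1.2 t.2.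
Let encK : cancel enc dec. Proof. by case. Qed.

HB.instance Definition _ := Choice.copy (quat R) (can_type encK).

Lemma quatP x y : qre x = qre y -> qim1 x = qim1 y -> qim2 x = qim2 y ->
  qim3 x = qim3 y -> x = y.
Proof. by case: x y => [? ? ? ?] [? ? ? ?] /= -> -> -> ->. Qed.

Definition addq x y := Quat (qre x + qre y) (qim1 x + qim1 y)
  (qim2 x + qim2 y) (qim3 x + qim3 y).
Definition oppq x := Quat (- qre x) (- qim1 x) (- qim2 x) (- qim3 x).
Definition mulq x y := Quat
  (qre x * qre y - qim1 x * qim1 y - qim2 x * qim2 y - qim3 x * qim3 y)
  (qre x * qim1 y + qim1 x * qre y + qim2 x * qim3 y - qim3 x * qim2 y)
  (qre x * qim2 y - qim1 x * qim3 y + qim2 x * qre y + qim3 x * qim1 y)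
  (qre x * qim3 y + qim1 x * qim2 y - qim2 x * qim1 y + qim3 x * qre y).
Definition scaleq a x := Quat (a * qre x) (a * qim1 x) (a * qim2 x) (a * qim3 x).

Let addqA : associative addq.
Proof. by move=> x y z; apply: quatP; rewrite /= addrA. Qed.
Let addqC : commutative addq.
Proof. by move=> x y; apply: quatP; rewrite /= addrC. Qed.
Let add0q : left_id (Quat 0 0 0 0) addq.
Proof. by move=> x; apply: quatP; rewrite /= add0r. Qed.
Let addNq : left_inverse (Quat 0 0 0 0) oppq addq.
Proof. by move=> x; apply: quatP; rewrite /= addNr. Qed.

HB.instance Definition _ :=
  GRing.isZmodule.Build (quat R) addqA addqC add0q addNq.

Let mulqA : associative mulq.
Proof. by move=> x y z; apply: quatP => /=; ring. Qed.
Let mul1q : left_id (Quat 1 0 0 0) mulq.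
Proof. by move=> x; apply: quatP => /=; ring. Qed.
Let mulq1 : right_id (Quat 1 0 0 0) mulq.
Proof. by move=> x; apply: quatP => /=; ring. Qed.
Let mulqDl : left_distributive mulq addq.
Proof. by move=> x y z; apply: quatP => /=; ring. Qed.
Let mulqDr : right_distributive mulq addq.
Proof. by move=> x y z; apply: quatP => /=; ring. Qed.
Let oneq_neq0 : Quat 1 0 0 0 != 0 :> quat R.
Proof. by apply/eqP => -[] /eqP; rewrite oner_eq0. Qed.

HB.instance Definition _ := GRing.Zmodule_isNzRing.Build (quat R)
  mulqA mul1q mulq1 mulqDl mulqDr oneq_neq0.

Let scaleqA a b x : scaleq a (scaleq b x) = scaleq (a * b) x.
Proof. by apply: quatP; rewrite /= mulrA. Qed.
Let scale1q : left_id 1 scaleq.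
Proof. by move=> x; apply: quatP; rewrite /= mul1r. Qed.
Let scaleqDr : right_distributive scaleq +%R.
Proof. by move=> a x y; apply: quatP; rewrite /= mulrDr. Qed.
Let scaleqDl x : {morph scaleq^~ x : a b / a + b}.
Proof. by move=> a b; apply: quatP; rewrite /= mulrDl. Qed.

HB.instance Definition _ := GRing.Zmodule_isLmodule.Build R (quat R)
  scaleqA scale1q scaleqDr scaleqDl.

Let scaleqAl a x y : a *: (x * y) = (a *: x) * y.
Proof. by apply: quatP => /=; ring. Qed.
HB.instance Definition _ := GRing.Lmodule_isLalgebra.Build R (quat R) scaleqAl.

Let scaleqAr a x y : a *: (x * y) = x * (a *: y).
Proof. by apply: quatP => /=; ring. Qed.
HB.instance Definition _ := GRing.Lalgebra_isAlgebra.Build R (quat R) scaleqAr.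

HB.instance Definition _ := isPointed.Build (quat R) 0.

Definition qconj x := Quat (qre x) (- qim1 x) (- qim2 x) (- qim3 x).
Definition qnorm x : R :=
  Num.sqrt (qre x ^+ 2 + qim1 x ^+ 2 + qim2 x ^+ 2 + qim3 x ^+ 2).
Definition qim x := Quat 0 (qim1 x) (qim2 x) (qim3 x).

Definition qsphere : set (quat R) := [set q | q ^+ 2 = -1].

(* e^(a + v) = e^a (cos |v| + sin |v| v/|v|) for a real and v purely imaginary
   (when v = 0 the last term is 0). *)
Definition qexp x : quat R := expR (qre x) *:
  ((cos (qnorm (qim x)))%:A + (sin (qnorm (qim x)) / qnorm (qim x)) *: qim x).

Lemma qsphereP (i : quat R) : qsphere i ->
  qre i = 0 /\ qim1 i ^+ 2 + qim2 i ^+ 2 + qim3 i ^+ 2 = 1.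
Proof.
case: i => a b c d; rewrite /qsphere /= expr2 => -[] h0 h1 h2 h3.
rewrite oppr0 in h1 h2 h3.
have a0 : a = 0.
  apply/eqP/negPn/negP => a0.
  have z (x : R) : a * x + x * a = 0 -> x = 0.
    move=> h; apply: (mulfI a0); rewrite mulr0; lra.
  have b0 : b = 0 by apply: z; rewrite -[RHS]h1; ring.
  have c0 : c = 0 by apply: z; rewrite -[RHS]h2; ring.
  have d0 : d = 0 by apply: z; rewrite -[RHS]h3; ring.
  have : 0 <= a * a by rewrite -expr2 sqr_ge0.
  move: h0; rewrite b0 c0 d0; lra.
split=> //; move: h0; rewrite a0 !expr2; lra.
Qed.

(* |z + w j|^2 = |z|^2 + |w|^2 for z, w in C_i and j in S orthogonal to i *)
Lemma qnorm_decomp (i j : quat R) (x y s t : R) :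
  qsphere i -> qsphere j -> i * j + j * i = 0 ->
  qnorm (x%:A + y *: i + (s%:A + t *: i) * j) ^+ 2 =
  qnorm (x%:A + y *: i) ^+ 2 + qnorm (s%:A + t *: i) ^+ 2.
Proof.
move=> /qsphereP[i0 i1] /qsphereP[j0 j1] [oij _ _ _].
rewrite /qnorm !sqr_sqrtr ?addr_ge0 ?sqr_ge0 //.
case: i i0 i1 oij => [a b c d] /= -> i1.
case: j j0 j1 => [a' b' c' d'] /= -> j1 oij.
have oo : b * b' + c * c' + d * d' = 0 by lra.
rewrite -[RHS]addr0; apply/eqP; rewrite -subr_eq0; apply/eqP.
transitivity ((s ^+ 2 + t ^+ 2 * (b ^+ 2 + c ^+ 2 + d ^+ 2)) *
   (b' ^+ 2 + c' ^+ 2 + d' ^+ 2 - 1) + (y * s - x * t) * (b * b' + c * c' + d * d') *+ 2).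
  ring.
by rewrite j1 oo; ring.
Qed.

Lemma qexp_cis (i : quat R) (u y : R) : qsphere i ->
  qexp (u *: (y *: i)) = (cos (y * u))%:A + sin (y * u) *: i.
Proof.
move=> /qsphereP[i0 i1].
have n : qnorm (qim (u *: (y *: i))) = `|y * u|.
  rewrite /qnorm /= -sqrtr_sqr -[in RHS](mulr1 ((y * u) ^+ 2)) -i1.
  by apply: f_equal; ring.
rewrite /qexp n /= i0 !mulr0 expR0 scale1r.
have -> : cos `|y * u| = cos (y * u) by case: (ger0P (y * u)) => _; rewrite ?cosN.
congr (_ + _).
have -> : qim (u *: (y *: i)) = (y * u) *: i.
  by apply: quatP; rewrite /= ?i0 ?mulr0 //; ring.
rewrite scalerA; congr (_ *: _).
have [->|n0] := eqVneq (y * u) 0; first by rewrite mulr0 sin0.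
by case: (ger0P (y * u)) => _; rewrite ?sinN ?invrN ?mulrNN divfK.
Qed.

End QuaternionAlgebra.

Section WienerHopf.
Variable R : realType.
Notation H := (quat R).
Let mu := @lebesgue_measure R.
Implicit Types (i : H) (f g F G : R -> H) (Phi Psi : H -> H).

Definition qmeasurable f := [/\ measurable_fun setT (@qre R \o f),
  measurable_fun setT (@qim1 R \o f), measurable_fun setT (@qim2 R \o f) &
  measurable_fun setT (@qim3 R \o f)].

Definition qLnorm (p : \bar R) f : \bar R :=
  Lnorm mu p (fun x => (qnorm (f x))%:E).

(* The space L_p(R, H), as a set of Borel measurable representatives.  By
   [qnorm_decomp], [qLp 2] is also L_2(iR, H), with its norm, where a function
   on iR is seen as a function of y through p = iy. *)
Definition qLp (p : \bar R) : set (R -> H) :=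
  [set f | qmeasurable f /\ (qLnorm p f < +oo)%E].

Definition qint (D : set R) f : H := Quat
  (\int[mu]_(u in D) qre (f u)) (\int[mu]_(u in D) qim1 (f u))
  (\int[mu]_(u in D) qim2 (f u)) (\int[mu]_(u in D) qim3 (f u)).

Definition qconv f g (u : R) : H := qint setT (fun v => f (u - v) * g v).

(* c + int e^(pu) f(u) du *)
Definition wfun (c : H) f (p : H) : H :=
  c + qint setT (fun u => qexp (u *: p) * f u).

(* Functions on the imaginary quaternions { y i : y in R, i in S } are total
   functions on H of which only the values at those points matter. *)
Definition wiener_rep (c : H) f Phi := qLp 1%:E f /\
  forall i y, qsphere i -> Phi (y *: i) = wfun c f (y *: i).

Definition wiener : set (H -> H) :=
  [set Phi | exists c f, wiener_rep c f Phi].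

(* the pair (c, f), unique up to modification of f on a null set *)
Definition wiener_coef Phi : H * (R -> H) :=
  get [set cf | wiener_rep cf.1 cf.2 Phi].

Definition wstar Phi Psi : H -> H :=
  let: (c1, f1) := wiener_coef Phi in
  let: (c2, f2) := wiener_coef Psi in
  wfun (c1 * c2) (fun u => c1 * f2 u + f1 u * c2 + qconv f1 f2 u).

(* W_+(iR, H) and W_-(iR, H): only the restriction to iR is constrained. *)
Definition wiener_plus i : set (H -> H) := [set Phi | exists c f, [/\ qLp 1%:E f,
  \forall u \ae mu, u < 0 -> f u = 0 &
  forall y, Phi (y *: i) = wfun c f (y *: i)]].

Definition wiener_minus i : set (H -> H) := [set Phi | exists c f, [/\ qLp 1%:E f,
  \forall u \ae mu, 0 < u -> f u = 0 &
  forall y, Phi (y *: i) = wfun c f (y *: i)]].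

(* F(iy) = int e^(iyu) f(u) du in the Plancherel sense: F is the L_2-limit of
   the truncated integrals. *)
Definition is_fourier2 i f F := qLp 2%:E F /\
  (fun n : nat => qLnorm 2%:E (fun y => F y -
     qint `[- n%:R, n%:R] (fun u => qexp (u *: (y *: i)) * f u))) @ \oo --> 0%E.

Definition fourier2 i f : R -> H := get [set F | is_fourier2 i f F].

(* f in L_2([0, oo), H), extended by 0, with Fourier transform F *)
Definition hardy_rep i f F :=
  [/\ qLp 2%:E f, forall u, u < 0 -> f u = 0 & is_fourier2 i f F].

Definition hardy i : set (R -> H) := [set F | exists f, hardy_rep i f F].

Definition hardy_coef i F : R -> H := get [set f | hardy_rep i f F].

Definition wmul i Phi F : R -> H :=
  let: (c, phi) := wiener_coef Phi in
  let f := hardy_coef i F in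
  fun y => fourier2 i (fun u => c * f u) y + fourier2 i (qconv phi f) y.

(* The right H-linear inner product; orthogonality to the right H-submodule
   [hardy i] is the same as for the real inner product. *)
Definition qinner F G : H := qint setT (fun y => qconj (G y) * F y).

Definition hardy_proj i F : R -> H := get [set G | hardy i G /\
  forall h, hardy i h -> qinner (fun y => F y - G y) h = 0].

Definition wiener_hopf i Phi F : R -> H := hardy_proj i (wmul i Phi F).

(* equality of operators H_2 -> H_2, elements of H_2 being classes of
   functions modulo equality almost everywhere *)
Definition hardy_op_eq i (A B : (R -> H) -> (R -> H)) :=
  forall F, hardy i F -> \forall y \ae mu, A F y = B F y.

End WienerHopf.

(* Main.v *)
(** By Plancherel, T_Phi sends the transform of f, supported in u >= 0, to the
    transform of the restriction to u >= 0 of c f + phi o f.  Hence T_Phi T_Psi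
    differs from T_(Phi * Psi) by phi o h on u >= 0, where h is the part of
    psi o f on u < 0; this vanishes when phi lives on u <= 0 or psi on u >= 0.

    Conversely, suppose T_Phi T_Psi = T_G.  Then phi o h is, on u >= 0, the image
    of f under a translation invariant operator, so comparing f = 1_[a,b] with
    its translates by t > 0 gives phi o (1_[-t,0) g) = 0 on u >= 0, with
    g = psi o f.  Integrating over u in [p,q], the product of g and
    w |-> int_p^q phi(u - w) du is zero for w < 0, and by continuity at w = 0:
    (int_p^q phi) (int_[-b,-a] psi) = 0 for all 0 < p < q and 0 <= a < b.  Since
    H has no zero divisors, phi = 0 on u > 0 or psi = 0 on u < 0.

    The isometry of the quaternionic Fourier transform reduces to that of the
    real cosine and sine transforms, which follows from damping by e^(-|y|/n),
    whose cosine transform is the Poisson approximate identity. *)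

Require Import Defs.
From HB Require Import structures.
From mathcomp Require Import all_boot all_order all_algebra.
From mathcomp Require Import ring lra.
From mathcomp Require Import all_classical all_reals all_analysis.
From mathcomp Require Import measurable_realfun.
Set Implicit Arguments.
Unset Strict Implicit.
Unset Printing Implicit Defensive.
Import Order.TTheory GRing.Theory Num.Theory.
Import numFieldNormedType.Exports.
Local Open Scope classical_set_scope.
Local Open Scope ring_scope.

(** * Fourier analysis on the real line *)

(** The operators are assembled from choices: [wiener_coef], [fourier2], [hardy_coef] and
    [hardy_proj] are values of [get]. Nothing follows about them until the chosen property is shown
    to be satisfiable and to determine the value up to a null set. L_2 transforms exist by the
    isometry and completeness of L_2; [(c, f)] is unique by injectivity of the transform on
    constants plus L_1; the projection rests on orthogonality of transforms of functions with
    disjoint supports.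

    Since H is not commutative, the kernel e^(iyu) commutes in general with right multiplication
    only: the transform is right linear and a left factor c stays inside it.

    In the converse the symbol of G is never identified: its difference from that of Phi star Psi
    enters only through translation invariance, and only right translates are available because f
    must vanish on u < 0. The identities hold outside a null set depending on f; integrating over u
    in [p,q] replaces them by identities between integrals whose factors are continuous at w = 0,
    where their values can be read off. *)

Section AffineSubstitution.
Variable R : realType.
Notation mu := (@lebesgue_measure R).
Local Open Scope ereal_scope.

Lemma measurable_affine (a b : R) :
  measurable_fun setT (fun x : R => a * x + b)%R.
Proof. by apply: measurable_funD => //; exact: measurable_funM. Qed.

(** The right-hand side is a measure that agrees with Lebesgue measure on half-open intervals, which
    determine it; for a < 0 the preimage of such an interval is closed on the other side, with the
    same length. *)
Lemma lebesgue_measure_affine (a b : R) (X : set R) : a != 0%R -> measurable X ->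
  mu X = `|a|%:E * pushforward mu (fun x : R => a * x + b : measurableTypeR R)%R X.
Proof.
move=> a0 mX.
have n0 : (0 <= `|a|)%R by [].
pose phi := (fun x : measurableTypeR R => a * x + b : measurableTypeR R)%R.
have mphi : measurable_fun setT phi by exact: measurable_affine.
pose pm : {measure set (measurableTypeR R) -> \bar R} :=
  measure_function_pushforward__canonical__measure_function_Measure mu mphi.
pose nu : {measure set (measurableTypeR R) -> \bar R} := mscale (NngNum n0) pm.
rewrite (@lebesgue_measure_unique R nu _ X mX) // => _ [[p q]] _ <-.
rewrite -[nu _]/(`|a|%:E * mu (phi @^-1` [set` `]p, q]%R])).
have [a1|a1|a1] := ltgtP 0%R a; last by rewrite -a1 eqxx in a0.
- rewrite (_ : _ @^-1` _ = [set` `](p - b) / a, (q - b) / a]%R]); last first.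
    apply/seteqP; split => x /=; rewrite !in_itv/= ltr_pdivrMr// ler_pdivlMr// mulrC;
    by rewrite ltrBlDr lerBrDr.
  rewrite !lebesgue_measure_itv/= !lte_fin ltr_pM2r ?invr_gt0// ltrD2r.
  case: ifP => _; rewrite ?mule0// -!EFinD -EFinM; congr EFin.
  by rewrite gtr0_norm//; field.
- rewrite (_ : _ @^-1` _ = [set` `[(q - b) / a, (p - b) / a[%R]); last first.
    apply/seteqP; split => x /=; rewrite !in_itv/= ler_ndivrMr// ltr_ndivlMr// [(x * a)%R]mulrC;
    by rewrite lerBrDr ltrBlDr andbC.
  rewrite !lebesgue_measure_itv/= !lte_fin ltr_nM2r ?invr_lt0// ltrD2r.
  case: ifP => _; rewrite ?mule0// -!EFinD -EFinM; congr EFin.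
  by rewrite ltr0_norm//; field; rewrite lt_eqF.
Qed.

Lemma ge0_integral_affine (a b : R) (f : R -> \bar R) : a != 0%R ->
  measurable_fun setT f -> (forall x, 0 <= f x) ->
  \int[mu]_x f (a * x + b)%R = `|a^-1|%:E * \int[mu]_x f x.
Proof.
move=> a0 mf f0.
have n0 : (0 <= `|a|)%R by [].
pose phi := (fun x : measurableTypeR R => a * x + b : measurableTypeR R)%R.
have mphi : measurable_fun setT phi by exact: measurable_affine.
pose pm : {measure set (measurableTypeR R) -> \bar R} :=
  measure_function_pushforward__canonical__measure_function_Measure mu mphi.
pose nu : {measure set (measurableTypeR R) -> \bar R} := mscale (NngNum n0) pm.
have -> : \int[mu]_x f x = \int[nu]_x f x.
  by apply: eq_measure_integral => A mA _; exact: lebesgue_measure_affine.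
rewrite ge0_integral_mscale//= muleA -EFinM normfV mulVf ?normr_eq0// mul1e.
by rewrite ge0_integral_pushforward.
Qed.

(** No integrability is assumed: the positive and negative parts may both be infinite, and
    multiplying by a positive real is compatible with the value given to their difference in every
    case. *)
Lemma integral_affine (a b : R) (f : R -> \bar R) : a != 0%R ->
  measurable_fun setT f ->
  \int[mu]_x f (a * x + b)%R = `|a^-1|%:E * \int[mu]_x f x.
Proof.
move=> a0 mf; rewrite integralE [in RHS]integralE.
have p0 := funepos_ge0 f; have q0 := funeneg_ge0 f.
have mp := measurable_funepos mf; have mq := measurable_funeneg mf.
transitivity (\int[mu]_x f^\+ (a * x + b)%R - \int[mu]_x f^\- (a * x + b)%R).
  by congr (_ - _); apply: eq_integral => x _; rewrite ?funeposE ?funenegE.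
rewrite (ge0_integral_affine b a0 mp)// (ge0_integral_affine b a0 mq)//.
have c0 : (0 < `|a^-1|)%R by rewrite normr_gt0 invr_eq0.
set x := \int[mu]_x _; set y := \int[mu]_x _.
have x0 : 0 <= x by exact: integral_ge0.
have y0 : 0 <= y by exact: integral_ge0.
case: x x0 => [x||]// x0; case: y y0 => [y||]// y0.
- exact: (congr1 EFin (esym (mulrBr _ _ _))).
- by rewrite gt0_muley ?lte_fin// /= gt0_muleNy ?lte_fin.
- by rewrite gt0_muley ?lte_fin.
- by rewrite gt0_muley ?lte_fin//= gt0_muleNy ?lte_fin.
Qed.

Lemma integral_shift (b : R) (f : R -> \bar R) : measurable_fun setT f ->
  \int[mu]_x f (x + b)%R = \int[mu]_x f x.
Proof.
move=> mf; rewrite -[RHS]mul1e -[1]/(1%R%:E) -[in RHS](normr1 R) -[in RHS]invr1.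
by rewrite -(integral_affine b)//; under [RHS]eq_integral do rewrite mul1r.
Qed.

Lemma integral_reflect (b : R) (f : R -> \bar R) : measurable_fun setT f ->
  \int[mu]_x f (b - x)%R = \int[mu]_x f x.
Proof.
move=> mf; rewrite -[RHS]mul1e -[1]/(1%R%:E) -[in RHS](normrN1 R) -[in RHS]invrN1.
by rewrite -(integral_affine b)//; under [RHS]eq_integral do rewrite mulN1r addrC.
Qed.

End AffineSubstitution.

(** * Integrability of real functions, in pointwise form *)

Section RealIntegrable.
Context d (T : measurableType d) (R : realType) (m : {measure set T -> \bar R}).
Notation intR f := (m.-integrable setT (EFin \o f)).

Lemma intRZl (r : R) (f : T -> R) : intR f -> intR (fun x => r * f x).
Proof. exact: integrableZl. Qed.

Lemma intRZr (r : R) (f : T -> R) : intR f -> intR (fun x => f x * r).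
Proof.
by move=> /(intRZl r); congr (integrable _ _ _); apply/funext => x; rewrite /= mulrC.
Qed.

Lemma intRD (f g : T -> R) : intR f -> intR g -> intR (fun x => f x + g x).
Proof. exact: integrableD. Qed.

Lemma intRN (f : T -> R) : intR f -> intR (fun x => - f x).
Proof. exact: integrableN. Qed.

Lemma intRB (f g : T -> R) : intR f -> intR g -> intR (fun x => f x - g x).
Proof. by move=> hf hg; exact: (intRD hf (intRN hg)). Qed.

Lemma intR_mulC (a b : T -> R) : intR (a \* b) -> intR (b \* a).
Proof. by rewrite (_ : b \* a = a \* b)//; apply/funext => x; rewrite /= mulrC. Qed.

End RealIntegrable.

(** * Almost-everywhere reasoning and exchange of integrals *)

Section FubiniReal.
Variable R : realType.
Notation mu := (@lebesgue_measure R).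
Notation intR f := (mu.-integrable setT (EFin \o f)).

Lemma ae_imp (P Q : R -> Prop) : (forall x, P x -> Q x) ->
  {ae mu, forall x, P x} -> {ae mu, forall x, Q x}.
Proof.
have F := ae_filter_ringOfSetsType mu.
by move=> PQ; apply: (@filterS _ _ F) => x; exact: PQ.
Qed.

Lemma ae_imp2 (P Q S : R -> Prop) : (forall x, P x -> Q x -> S x) ->
  {ae mu, forall x, P x} -> {ae mu, forall x, Q x} -> {ae mu, forall x, S x}.
Proof.
have F := ae_filter_ringOfSetsType mu.
by move=> PQ; apply: (@filterS2 _ _ F) => x; exact: PQ.
Qed.

Lemma ae_and (P Q : R -> Prop) :
  {ae mu, forall x, P x} -> {ae mu, forall x, Q x} -> {ae mu, forall x, P x /\ Q x}.
Proof. by apply: ae_imp2 => x. Qed.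

Lemma ae_all (P : R -> Prop) : (forall x, P x) -> {ae mu, forall x, P x}.
Proof.
have F := ae_filter_ringOfSetsType mu.
by move=> PT; apply: (@nearW _ _ _ F) => x; exact: PT.
Qed.

Lemma measurable_integral2 (k : R * R -> \bar R) : measurable_fun setT k ->
  measurable_fun setT (fun x => \int[mu]_y k (x, y))%E.
Proof.
move=> mk; rewrite (_ : (fun _ => _) = (fun x =>
    \int[mu]_y k^\+ (x, y) - \int[mu]_y k^\- (x, y)))%E.
  apply: emeasurable_funB.
    by apply: (measurable_fun_fubini_tonelli_F (m2 := mu) k^\+)%E => //;
      exact: measurable_funepos.
  by apply: (measurable_fun_fubini_tonelli_F (m2 := mu) k^\-)%E => //;
    exact: measurable_funeneg.
apply/funext => x; rewrite integralE.
by congr (_ - _)%E; apply: eq_integral => y _; rewrite ?funeposE ?funenegE.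
Qed.

Lemma measurable_Rintegral2 (k : R * R -> R) : measurable_fun setT k ->
  measurable_fun setT (fun x => \int[mu]_y k (x, y)).
Proof.
move=> mk; rewrite /Rintegral.
apply: (measurableT_comp (fine_measurable measurableT)).
exact: (measurable_integral2 (k := EFin \o k)) (measurableT_comp _ mk).
Qed.

Lemma intR_measurable (f : R -> R) : intR f -> measurable_fun setT f.
Proof. by move=> /measurable_int/measurable_EFinP. Qed.

Lemma intR_bounded (h a : R -> R) M : measurable_fun setT h ->
  (forall x, `|h x| <= M) -> intR a -> intR (h \* a).
Proof.
move=> mh hM ia; have ma := intR_measurable ia.
apply: (@le_integrable _ _ _ mu setT measurableT _ (fun x => (M * a x)%:E)).
- by apply/measurable_EFinP; exact: measurable_funM.
- move=> x _ /=; rewrite lee_fin !normrM ler_pM//.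
  exact: le_trans (hM x) (ler_norm M).
- by under eq_fun do rewrite EFinM; exact: integrableZl.
Qed.

Lemma Rintegral_bounded (h a : R -> R) M : measurable_fun setT h ->
  (forall x, `|h x| <= M) -> intR a ->
  `|\int[mu]_x (h x * a x)| <= M * \int[mu]_x `|a x|.
Proof.
move=> mh hM ia; have ma := intR_measurable ia.
have iha := intR_bounded mh hM ia.
apply: (le_trans (le_normr_Rintegral _ iha)) => //.
have ina : intR (fun x => `|a x|) by exact: (integrable_norm ia).
rewrite -RintegralZl//; apply: le_Rintegral => //.
- exact: (integrable_norm iha).
- by rewrite /comp; under eq_fun do rewrite EFinM; exact: integrableZl.
- by move=> x _; rewrite normrM ler_wpM2r.
Qed.

Lemma measurable_pairl (k : R * R -> R) x : measurable_fun setT k ->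
  measurable_fun setT (fun y => k (x, y)).
Proof. by move=> mk; exact: measurableT_comp. Qed.

Lemma measurable_swap_fun (k : R * R -> R) : measurable_fun setT k ->
  measurable_fun setT (fun p : R * R => k (p.2, p.1)).
Proof.
move=> mk; apply: (measurableT_comp mk).
by apply/measurable_fun_pair; [exact: measurable_snd|exact: measurable_fst].
Qed.

(** The integrand is dominated by M |a(x)| |b(y)|, so Tonelli gives joint integrability. The
    trigonometric kernels below satisfy the bound with [M = 1]. *)
Lemma Rfubini_bounded (k : R * R -> R) (a b : R -> R) M :
  measurable_fun setT k -> (forall p, `|k p| <= M) -> intR a -> intR b ->
  \int[mu]_x (a x * \int[mu]_y (k (x, y) * b y)) =
  \int[mu]_y (b y * \int[mu]_x (k (x, y) * a x)).
Proof.
move=> mk kM ia ib; have ma := intR_measurable ia; have mb := intR_measurable ib.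
pose g (p : R * R) := (k p * (a p.1 * b p.2))%:E.
have mg : measurable_fun setT g.
  apply/measurable_EFinP; apply: measurable_funM => //.
  apply: measurable_funM; first exact: measurableT_comp.
  exact: measurableT_comp.
have ig : (mu \x mu)%E.-integrable setT g.
  apply/integrable12ltyP => //.
  pose A := (\int[mu]_x `|(a x)%:E|)%E; pose B := (\int[mu]_x `|(b x)%:E|)%E.
  have Ay : (A < +oo)%E by move/integrableP : ia => [].
  have By : (B < +oo)%E by move/integrableP : ib => [].
  have mbe : measurable_fun setT (fun y => `|(b y)%:E|%E).
    by apply: measurableT_comp => //; exact/measurable_EFinP.
  have mae : measurable_fun setT (fun y => `|(a y)%:E|%E).
    by apply: measurableT_comp => //; exact/measurable_EFinP.
  have M0 : 0 <= M by rewrite (le_trans _ (kM (0, 0))).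
  apply: (@le_lt_trans _ _ (\int[mu]_x (`|(a x)%:E| * (M%:E * B)))%E).
    apply: ge0_le_integral => //.
    - by move=> x _; exact: integral_ge0.
    - apply: (measurable_integral2 (k := abse \o g)).
      exact: measurableT_comp.
    - exact: emeasurable_funM.
    - move=> x _; rewrite muleA -ge0_integralZl// ?mule_ge0//.
      apply: ge0_le_integral => //.
      + apply: measurableT_comp => //; exact: measurableT_comp.
      + exact: emeasurable_funM.
      + move=> y _; rewrite /g /= -!EFinM lee_fin !normrM mulrA ler_wpM2r//.
        by rewrite mulrC ler_wpM2l// kM.
  rewrite ge0_integralZr// ?mule_ge0 ?integral_ge0//.
  by rewrite lte_mul_pinfty ?integral_ge0 ?ge0_fin_numE ?integral_ge0//
    lte_mul_pinfty.
have := Fubini ig; rewrite /Rintegral => F; congr fine.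
transitivity (\int[mu]_x \int[mu]_y g (x, y))%E.
  apply: eq_integral => x _.
  have ikb := intR_bounded (measurable_pairl x mk) (fun y => kM (x, y)) ib.
  rewrite EFinM fineK; last exact: integrable_fin_num.
  rewrite -integralZl//; apply: eq_integral => y _.
  by rewrite /g/= -EFinM; congr EFin; ring.
rewrite F; apply: eq_integral => y _.
have ika := intR_bounded (measurable_pairl y (measurable_swap_fun mk)) (fun x => kM (x, y)) ia.
rewrite EFinM fineK; last exact: integrable_fin_num.
rewrite -integralZl//; apply: eq_integral => x _.
by rewrite /g/= -EFinM; congr EFin; ring.
Qed.

End FubiniReal.

(** * The Poisson kernel as the cosine transform of e^(-|y|) *)

Section PoissonKernel.
Variable R : realType.
Notation mu := (@lebesgue_measure R).
Notation intR f := (mu.-integrable setT (EFin \o f)).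

Definition laplace (y : R) : R := expR (- `|y|).
Definition poisson (r : R) : R := 2 / (1 + r ^+ 2).

Lemma continuous_laplace : continuous laplace.
Proof.
move=> x; apply: continuous_comp; last exact: continuous_expR.
by apply: continuousN; exact: norm_continuous.
Qed.

Lemma laplace_ge0 y : 0 <= laplace y. Proof. exact: expR_ge0. Qed.

(** The summand 1 makes the integrand nonnegative, so that its half-line integral comes from an
    antiderivative without prior integrability. The case r = 0 then gives the mass of [laplace], to
    be subtracted. *)
Let g r y := laplace y * (1 + cos (r * y)).

Let g_ge0 r y : 0 <= g r y.
Proof. by rewrite mulr_ge0 ?laplace_ge0// -lerBlDl sub0r cos_geN1. Qed.

Lemma continuous_cosM (r : R) : continuous (fun y => cos (r * y)).
Proof. by move=> x; apply: continuous_comp; [exact: mulrl_continuous|exact: continuous_cos]. Qed.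

Lemma continuous_sinM (r : R) : continuous (fun y => sin (r * y)).
Proof. by move=> x; apply: continuous_comp; [exact: mulrl_continuous|exact: continuous_sin]. Qed.

Let continuous_g r : continuous (g r).
Proof.
move=> x; apply: continuousM; first exact: continuous_laplace.
by apply: continuousD; [exact: cst_continuous|exact: continuous_cosM].
Qed.

Let h r (x : R) : R := expR (- x) * (1 + cos (r * x)).

Let continuous_h r : continuous (h r).
Proof.
move=> x; apply: (@continuousM _ _ (expR \o -%R) (fun x => 1 + cos (r * x)) x).
  by apply: continuous_comp; [exact: opp_continuous|exact: continuous_expR].
by apply: continuousD; [exact: cst_continuous|exact: continuous_cosM].
Qed.

(** The antiderivative of [h r] that tends to 0 at infinity, as obtained by integrating e^(-x)
    cos(rx) by parts twice. *)
Let G r (x : R) := expR (- x) * ((r * sin (r * x) - cos (r * x)) / (1 + r ^+ 2) - 1).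

Let dG (r x : R) : is_derive x 1 (G r) (expR (- x) * (1 + cos (r * x))).
Proof.
have r1 : 1 + r ^+ 2 != 0 by rewrite gt_eqF// ltr_wpDr// sqr_ge0.
have h1 : is_derive x 1 (fun x => r * x) r.
  by apply: is_derive_eq; rewrite /GRing.scale /= mulr1.
have d1 : is_derive x 1 (expR \o -%R) (- expR (- x)).
  by apply: is_derive_eq; rewrite /GRing.scale/=; ring.
have d2 : is_derive x 1 (sin \o (fun x => r * x)) (r * cos (r * x)).
  by apply: is_derive_eq; rewrite /GRing.scale/=; ring.
have d3 : is_derive x 1 (cos \o (fun x => r * x)) (r * - sin (r * x)).
  by apply: is_derive_eq; rewrite /GRing.scale/=; ring.
rewrite (_ : G r = (expR \o -%R) *
    (((r \*: (sin \o (fun x => r * x)) - (cos \o (fun x => r * x))) *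
      cst ((1 + r ^+ 2)^-1)) - cst 1)); last first.
  by apply/funext => y.
apply: is_derive_eq; rewrite /GRing.scale/= !fctE /= /GRing.scale/=.
by field.
Qed.

Let cvgG r : G r x @[x --> +oo] --> 0.
Proof.
have r0 : 0 < 1 + r ^+ 2 by rewrite ltr_pwDl// sqr_ge0.
(* Bounds the bracket in [G], since |r sin - cos| <= |r| + 1; the factor e^(-x) then gives the
   limit. *)
pose C := (`|r| + 1) / (1 + r ^+ 2) + 1.
apply/norm_cvg0P.
apply: (@squeeze_cvgr _ _ _ _ (cst 0) (fun x => expR (- x) * C)).
- apply: nearW => x; rewrite normr_ge0/= normrM ger0_norm ?expR_ge0//.
  rewrite ler_wpM2l ?expR_ge0// (le_trans (ler_normB _ _))// /C normr1 lerD2r.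
  rewrite normrM normfV (gtr0_norm r0) ler_wpM2r ?invr_ge0 ?(ltW r0)//.
  rewrite (le_trans (ler_normB _ _))// lerD ?cos_max// normrM.
  by rewrite ler_piMr ?sin_max.
- exact: cvg_cst.
- by rewrite -[X in _ --> X](mul0r C); apply: cvgM; [exact: cvgr_expR|exact: cvg_cst].
Qed.

Let integral_g r : (\int[mu]_y (g r y)%:E = (2 + poisson r)%:E)%E.
Proof.
have r0 : 1 + r ^+ 2 != 0 by rewrite gt_eqF// ltr_wpDr// sqr_ge0.
rewrite ge0_symfun_integralT//; last first.
  by move=> x; rewrite /g/= /laplace normrN mulrN cosN.
rewrite -set_itvcy (_ : (\int[_]_(_ in _) _ = (1 + (1 + r ^+ 2)^-1)%:E)%E); last first.
  transitivity (\int[mu]_(x in `[0%R, +oo[) (expR (- x) * (1 + cos (r * x)))%:E)%E.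
    by apply: eq_integral => x; rewrite inE/= in_itv/= andbT /g /laplace => /ger0_norm ->.
  have cG : continuous (G r).
    by move=> x; apply/differentiable_continuous/derivable1_diffP/ex_derive.
  have ge0 (x : R) : 0 <= x -> 0 <= expR (- x) * (1 + cos (r * x)).
    by rewrite mulr_ge0 ?expR_ge0// -lerBlDl sub0r cos_geN1.
  have cf : {within `[0, +oo[, continuous (h r)}.
    exact/continuous_subspaceT/continuous_h.
  have dG' (x : R) : 0 < x -> derivable (G r) x 1 by move=> _; exact: ex_derive.
  have cG0 : G r x @[x --> 0^'+] --> G r 0 by apply: cvg_at_right_filter; exact: cG.
  have G' : {in `]0, +oo[, derive1 (G r) =1 h r}.
    by move=> x _; rewrite derive1E; exact: derive_val.
  rewrite (ge0_continuous_FTC2y ge0 cf (cvgG r) dG' cG0 G').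
  by rewrite -EFinB /G oppr0 mulr0 sin0 cos0 expR0; congr EFin; field.
by rewrite -EFinM; congr EFin; rewrite /poisson; field.
Qed.

Lemma measurable_laplace : measurable_fun setT laplace.
Proof. by apply: continuous_measurable_fun; exact: continuous_laplace. Qed.

Let integral_laplace : (\int[mu]_y (laplace y)%:E = 2%:E)%E.
Proof.
have := integral_g 0; rewrite /g.
under eq_integral do rewrite mul0r cos0 mulrC EFinM.
rewrite ge0_integralZl//; last 2 first.
- by apply/measurable_EFinP; exact: measurable_laplace.
- by move=> x _; rewrite lee_fin laplace_ge0.
rewrite (_ : 2 + poisson 0 = 2 * 2); last by rewrite /poisson; field.
rewrite EFinM (_ : 1 + 1 = 2)//.
case: (\int[mu]_y _)%E => [r| |].
- by rewrite -!EFinM => -[] /mulfI ->.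
- by rewrite gt0_muley// lte_fin.
- by rewrite gt0_muleNy// lte_fin.
Qed.

Lemma integrable_laplace : intR laplace.
Proof.
apply/integrableP; split; first by apply/measurable_EFinP; exact: measurable_laplace.
under eq_integral do rewrite /= ger0_norm ?laplace_ge0//.
by rewrite integral_laplace ltry.
Qed.

Lemma measurable_cosM (r : R) : measurable_fun setT (fun y => cos (r * y)).
Proof. by apply: continuous_measurable_fun; exact: continuous_cosM. Qed.

Lemma measurable_sinM (r : R) : measurable_fun setT (fun y => sin (r * y)).
Proof. by apply: continuous_measurable_fun; exact: continuous_sinM. Qed.

Lemma laplace_cos (r : R) : \int[mu]_y (laplace y * cos (r * y)) = poisson r.
Proof.
have iW := integrable_laplace.
have i2 : intR (fun y => laplace y * cos (r * y)).
  under eq_fun do rewrite mulrC.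
  apply: (intR_bounded (h := fun y => cos (r * y)) (M := 1)) => //.
    exact: measurable_cosM.
  by move=> x; exact: cos_max.
have := congr1 fine (integral_g r); rewrite -[LHS]/(\int[mu]_y (g r y)) /=.
under eq_Rintegral do rewrite /g mulrDr mulr1.
rewrite RintegralD// {1}/Rintegral integral_laplace/=.
by move/addrI.
Qed.

Lemma poisson_ge0 r : 0 <= poisson r.
Proof. by rewrite divr_ge0// addr_ge0// sqr_ge0. Qed.

Lemma poisson_le2 r : poisson r <= 2.
Proof.
by rewrite ler_pdivrMr ?ltr_pwDl ?sqr_ge0// ler_peMr// lerDl sqr_ge0.
Qed.

Lemma poissonN r : poisson (- r) = poisson r.
Proof. by rewrite /poisson sqrrN. Qed.

Lemma continuous_poisson : continuous poisson.
Proof.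
rewrite (_ : poisson = cst 2 \* (fun r => (1 + r ^+ 2)^-1)) // => x.
apply: continuousM.
  exact: cst_continuous.
exact: continuous_oneDsqrV.
Qed.

Lemma measurable_poisson : measurable_fun setT poisson.
Proof. by apply: continuous_measurable_fun; exact: continuous_poisson. Qed.

Lemma integral_poisson : (\int[mu]_y (poisson y)%:E = (2 * pi)%:E)%E.
Proof.
rewrite ge0_symfun_integralT//; last 3 first.
- exact: poisson_ge0.
- exact: continuous_poisson.
- by move=> x /=; rewrite poissonN.
have mO : measurable_fun `[(0:R), +oo[ (fun x : R => ((1 + x ^+ 2)^-1)%:E).
  apply/measurable_EFinP/measurable_funTS.
  by apply: continuous_measurable_fun; exact: continuous_oneDsqrV.
have O0 (x : R) : `[(0:R), +oo[%classic x -> (0 <= ((1 + x ^+ 2)^-1)%:E)%E.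
  by move=> _; rewrite lee_fin invr_ge0 addr_ge0// sqr_ge0.
have Z : (\int[mu]_(x in `[0%R, +oo[) (poisson x)%:E =
    2%:E * \int[mu]_(x in `[0%R, +oo[) ((1 + x ^+ 2)^-1)%:E)%E.
  by rewrite -ge0_integralZl//; exact: eq_integral.
rewrite -set_itvcy Z.
by rewrite integral0y_oneDsqr -!EFinM; congr EFin; field.
Qed.

Lemma integrable_poisson : intR poisson.
Proof.
apply/integrableP; split; first by apply/measurable_EFinP; exact: measurable_poisson.
under eq_integral do rewrite /= ger0_norm ?poisson_ge0//.
by rewrite integral_poisson ltry.
Qed.

End PoissonKernel.

(** * Rescaled kernels and the approximate identity *)

Section DampedTransforms.
Variable R : realType.
Notation mu := (@lebesgue_measure R).
Notation intR f := (mu.-integrable setT (EFin \o f)).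

Lemma intR_affine (a b : R) (f : R -> R) : a != 0 -> intR f ->
  intR (fun x => f (a * x + b)).
Proof.
move=> a0 iff; have mf := intR_measurable iff.
have mfa : measurable_fun setT (fun x => f (a * x + b)).
  by apply: (measurableT_comp mf); exact: measurable_affine.
apply/integrableP; split; first exact/measurable_EFinP.
have mn : measurable_fun setT (fun x => `|(f x)%:E|%E).
  by apply: measurableT_comp => //; exact/measurable_EFinP.
have := integral_affine b a0 mn; rewrite /= => ->.
move/integrableP : iff => [_ foo].
by rewrite lte_mul_pinfty// ge0_fin_numE ?integral_ge0.
Qed.

Lemma Rintegral_affine (a b : R) (f : R -> R) : a != 0 -> measurable_fun setT f ->
  \int[mu]_x f (a * x + b) = `|a^-1| * \int[mu]_x f x.
Proof.
move=> a0 mf; rewrite /Rintegral.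
have := integral_affine b a0 (f := EFin \o f); rewrite /= => ->; last exact/measurable_EFinP.
set X := (\int[mu]_x _)%E.
case: X => [x| |] //=.
- by rewrite mulr0 gt0_muley// lte_fin normr_gt0 invr_eq0.
- by rewrite mulr0 gt0_muleNy// lte_fin normr_gt0 invr_eq0.
Qed.

Lemma intR_reflect (b : R) (f : R -> R) : intR f -> intR (fun x => f (b - x)).
Proof.
move=> iff; have := intR_affine b (a := -1) _ iff.
rewrite oppr_eq0 oner_eq0 => /(_ isT); congr (integrable _ _ _).
by apply/funext => x; rewrite /= mulN1r addrC.
Qed.

Lemma intR_shift (b : R) (f : R -> R) : intR f -> intR (fun x => f (x + b)).
Proof.
move=> iff; have := intR_affine b (a := 1) _ iff.
rewrite oner_eq0 => /(_ isT); congr (integrable _ _ _).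
by apply/funext => x; rewrite /= mul1r.
Qed.

Lemma Rdominated_cvg (f_ : nat -> R -> R) (f g : R -> R) :
  (forall n, measurable_fun setT (f_ n)) -> measurable_fun setT f ->
  {ae mu, forall x, f_ n x @[n --> \oo] --> f x} -> intR g ->
  (forall n x, `|f_ n x| <= g x) ->
  intR f /\ \int[mu]_x f_ n x @[n --> \oo] --> \int[mu]_x f x.
Proof.
move=> mf_ mf cf ig fg.
have [] := @dominated_convergence _ _ _ mu setT measurableT (fun n x => (f_ n x)%:E)
  (EFin \o f) (EFin \o g).
- by move=> n; apply/measurable_EFinP; exact: mf_.
- exact/measurable_EFinP.
- move: cf; apply: ae_imp => x cx _; apply: cvg_EFin; [exact: nearW|exact: cx].
- exact: ig.
- by apply: ae_all => x n _ /=; rewrite lee_fin.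
move=> iff _ cv; split => //.
by apply: fine_cvg; rewrite fineK//; exact: integrable_fin_num.
Qed.

(** A damping factor increasing to 1 and its cosine transform, a Poisson kernel of mass 2 pi; n + 1
    keeps the scale nonzero. *)
Definition damp (n : nat) (y : R) : R := laplace (y / n.+1%:R).
Definition pois (n : nat) (s : R) : R := n.+1%:R * poisson (n.+1%:R * s).

Lemma damp_ge0 n y : 0 <= damp n y. Proof. exact: laplace_ge0. Qed.

Lemma pois_ge0 n s : 0 <= pois n s. Proof. by rewrite mulr_ge0 ?poisson_ge0. Qed.

Lemma pois_bounded n s : `|pois n s| <= n.+1%:R * 2.
Proof. by rewrite ger0_norm ?pois_ge0// ler_wpM2l// poisson_le2. Qed.

Lemma measurable_pois n : measurable_fun setT (pois n).
Proof.
apply: measurable_funM => //; apply: (measurableT_comp (@measurable_poisson R)).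
exact: measurable_funM.
Qed.

Lemma intR_damp n : intR (damp n).
Proof.
have k0 : n.+1%:R^-1 != 0 :> R by rewrite invr_eq0 pnatr_eq0.
have := intR_affine 0 k0 (@integrable_laplace R); congr (integrable _ _ _).
by apply/funext => x; rewrite /= addr0 mulrC.
Qed.

Lemma measurable_damp n : measurable_fun setT (damp n).
Proof. by apply: intR_measurable; exact: intR_damp. Qed.

Lemma intR_pois n : intR (pois n).
Proof.
have k0 : n.+1%:R != 0 :> R by rewrite pnatr_eq0.
have := integrableZl measurableT n.+1%:R (intR_affine 0 k0 (@integrable_poisson R)).
congr (integrable _ _ _).
by apply/funext => x; rewrite /= addr0 EFinM.
Qed.

Lemma integral_pois n : \int[mu]_s pois n s = 2 * pi.
Proof.
have k0 : n.+1%:R != 0 :> R by rewrite pnatr_eq0.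
have ip := intR_affine 0 k0 (@integrable_poisson R).
rewrite (_ : \int[mu]_s pois n s =
  \int[mu]_s (n.+1%:R * poisson (n.+1%:R * s + 0))); last first.
  by apply: eq_Rintegral => s _; rewrite addr0.
rewrite RintegralZl// Rintegral_affine//; last exact: measurable_poisson.
by rewrite {1}/Rintegral integral_poisson ger0_norm ?invr_ge0// mulVKf.
Qed.

Lemma damp_cos n (s : R) : \int[mu]_y (cos (s * y) * damp n y) = pois n s.
Proof.
have k0 : n.+1%:R^-1 != 0 :> R by rewrite invr_eq0 pnatr_eq0.
pose g t := laplace t * cos (n.+1%:R * s * t).
have mg : measurable_fun setT g.
  by apply: measurable_funM; [exact: measurable_laplace|exact: measurable_cosM].
transitivity (\int[mu]_y g (n.+1%:R^-1 * y + 0)).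
  apply: eq_Rintegral => y _; rewrite /g /damp addr0 [in RHS]mulrC (mulrC y).
  by rewrite mulrACA mulfV ?pnatr_eq0// mul1r mulrC.
by rewrite Rintegral_affine// invrK laplace_cos ger0_norm.
Qed.

(** The substitution r = (n+1)(u - v) fixes the kernel and moves n into the argument of g. Dominated
    convergence then applies with the majorant [M * poisson r], continuity of g at u giving the
    pointwise limit. *)
Lemma cvg_pois (g : R -> R) (M u : R) : measurable_fun setT g ->
  (forall x, `|g x| <= M) -> {for u, continuous g} ->
  \int[mu]_v (pois n (u - v) * g v) @[n --> \oo] --> 2 * pi * g u.
Proof.
move=> mg gM cg.
rewrite (_ : (fun _ => _) = (fun n : nat => \int[mu]_(r in [set: R]) (poisson r * g (u - r / n.+1%:R)))).
  have m_ (n : nat) : measurable_fun setT (fun r : R => g (u - r / n.+1%:R)).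
    apply: (measurableT_comp mg); apply: measurable_funB => //.
    exact: measurable_funM.
  have -> : 2 * pi * g u = \int[mu]_r (poisson r * g u).
    by rewrite RintegralZr ?integrable_poisson// {1}/Rintegral integral_poisson.
  have [] // := @Rdominated_cvg (fun (n : nat) (r : R) => poisson r * g (u - r / n.+1%:R))
    (fun r : R => poisson r * g u) (fun r : R => M * poisson r).
  - by move=> n; apply: measurable_funM => //; exact: measurable_poisson.
  - by apply: measurable_funM => //; exact: measurable_poisson.
  - apply: ae_all => r; apply: cvgM; first exact: cvg_cst.
    have cu : u - r / n.+1%:R @[n --> \oo] --> u; last exact: (cvg_comp _ _ cu cg).
    rewrite -[X in _ --> X]subr0; apply: cvgB; first exact: cvg_cst.
    rewrite -[X in _ --> X](mulr0 r); apply: cvgM; first exact: cvg_cst.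
    exact: cvg_harmonic.
  - by rewrite /comp; under eq_fun do rewrite EFinM; apply: integrableZl => //; exact: integrable_poisson.
  - move=> n r; rewrite normrM (ger0_norm (poisson_ge0 _)) mulrC.
    by rewrite ler_wpM2r ?poisson_ge0.
apply/funext => n.
have k0 : - n.+1%:R != 0 :> R by rewrite oppr_eq0 pnatr_eq0.
pose F (r : R) := poisson r * g (u - r / n.+1%:R).
have mF : measurable_fun setT F.
  apply: measurable_funM; first exact: measurable_poisson.
  apply: (measurableT_comp mg); apply: measurable_funB => //.
  exact: measurable_funM.
rewrite -[RHS]/(\int[mu]_r F r).
have := Rintegral_affine (n.+1%:R * u) k0 mF.
move=> /(congr1 (fun x => n.+1%:R * x)).
rewrite mulrA invrN normrN ger0_norm ?invr_ge0// mulfV ?pnatr_eq0// mul1r => <-.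
have i1 : intR (fun v => F (- n.+1%:R * v + n.+1%:R * u)).
  apply: intR_affine => //; rewrite /F.
  under eq_fun do rewrite mulrC.
  apply: (intR_bounded (M := M)) => //; last exact: integrable_poisson.
  apply: (measurableT_comp mg); apply: measurable_funB => //.
  exact: measurable_funM.
rewrite -RintegralZl//; apply: eq_Rintegral => v _.
rewrite /F /pois -mulrA; congr (_ * (poisson _ * g _)); first by ring.
have : n.+1%:R != 0 :> R by rewrite pnatr_eq0.
by move: n.+1%:R => k k1; field.
Qed.

End DampedTransforms.

(** * Real cosine and sine transforms and the damped Parseval identity *)

Section CosineSineTransforms.
Variable R : realType.
Notation mu := (@lebesgue_measure R).
Notation intR f := (mu.-integrable setT (EFin \o f)).

Definition fcos (f : R -> R) (y : R) : R := \int[mu]_u (cos (y * u) * f u).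
Definition fsin (f : R -> R) (y : R) : R := \int[mu]_u (sin (y * u) * f u).

Lemma measurable_mulp : measurable_fun setT (fun p : R * R => p.1 * p.2).
Proof. by apply: measurable_funM. Qed.

Lemma measurable_cosp : measurable_fun setT (fun p : R * R => cos (p.1 * p.2)).
Proof.
apply: (measurableT_comp (f := @cos R)) measurable_mulp.
by apply: continuous_measurable_fun; exact: continuous_cos.
Qed.

Lemma measurable_sinp : measurable_fun setT (fun p : R * R => sin (p.1 * p.2)).
Proof.
apply: (measurableT_comp (f := @sin R)) measurable_mulp.
by apply: continuous_measurable_fun; exact: continuous_sin.
Qed.

Lemma intR_cosM f y : intR f -> intR (fun u => cos (y * u) * f u).
Proof. exact: (intR_bounded (measurable_cosM y) (fun x => cos_max _)). Qed.

Lemma intR_sinM f y : intR f -> intR (fun u => sin (y * u) * f u).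
Proof. exact: (intR_bounded (measurable_sinM y) (fun x => sin_max _)). Qed.

Lemma measurable_fcos f : intR f -> measurable_fun setT (fcos f).
Proof.
move=> iff; apply: (measurable_Rintegral2 (k := fun p => cos (p.1 * p.2) * f p.2)).
apply: measurable_funM; first exact: measurable_cosp.
exact: (measurableT_comp (intR_measurable iff)).
Qed.

Lemma measurable_fsin f : intR f -> measurable_fun setT (fsin f).
Proof.
move=> iff; apply: (measurable_Rintegral2 (k := fun p => sin (p.1 * p.2) * f p.2)).
apply: measurable_funM; first exact: measurable_sinp.
exact: (measurableT_comp (intR_measurable iff)).
Qed.

Lemma fcos_bounded f y : intR f -> `|fcos f y| <= 1 * \int[mu]_u `|f u|.
Proof.
by apply: Rintegral_bounded => [|x]; [exact: measurable_cosM|exact: cos_max].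
Qed.

Lemma fsin_bounded f y : intR f -> `|fsin f y| <= 1 * \int[mu]_u `|f u|.
Proof.
by apply: Rintegral_bounded => [|x]; [exact: measurable_sinM|exact: sin_max].
Qed.

Lemma fcosD f g y : intR f -> intR g ->
  fcos (fun u => f u + g u) y = fcos f y + fcos g y.
Proof.
move=> iff ig; rewrite /fcos -RintegralD//; [|exact: intR_cosM|exact: intR_cosM].
by apply: eq_Rintegral => u _; rewrite mulrDr.
Qed.

Lemma fsinD f g y : intR f -> intR g ->
  fsin (fun u => f u + g u) y = fsin f y + fsin g y.
Proof.
move=> iff ig; rewrite /fsin -RintegralD//; [|exact: intR_sinM|exact: intR_sinM].
by apply: eq_Rintegral => u _; rewrite mulrDr.
Qed.

Lemma fcosN f y : intR f -> fcos (fun u => - f u) y = - fcos f y.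
Proof.
move=> iff; rewrite -mulN1r /fcos -RintegralZl//; last exact: intR_cosM.
by apply: eq_Rintegral => u _; rewrite mulN1r mulrN.
Qed.

Lemma fsinN f y : intR f -> fsin (fun u => - f u) y = - fsin f y.
Proof.
move=> iff; rewrite -mulN1r /fsin -RintegralZl//; last exact: intR_sinM.
by apply: eq_Rintegral => u _; rewrite mulN1r mulrN.
Qed.

(** Convolution with the Poisson kernel, not normalised by 2 pi: hence the factors 2 pi in the
    limits below. *)
Definition smooth n (g : R -> R) (u : R) : R := \int[mu]_v (pois n (u - v) * g v).

Lemma measurable_pois_sub n : measurable_fun setT (fun p : R * R => pois n (p.1 - p.2)).
Proof.
apply: (measurableT_comp (@measurable_pois R n)).
exact: measurable_funB.
Qed.

Lemma measurable_pois_subl n (u : R) : measurable_fun setT (fun v : R => pois n (u - v)).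
Proof. exact: (measurable_pairl u (measurable_pois_sub n)). Qed.

Lemma measurable_smooth n g : measurable_fun setT g -> measurable_fun setT (smooth n g).
Proof.
move=> mg; apply: (measurable_Rintegral2 (k := fun p => pois n (p.1 - p.2) * g p.2)).
apply: measurable_funM; first exact: measurable_pois_sub.
exact: measurableT_comp.
Qed.

Lemma intR_pois_sub n (u : R) g : intR g -> intR (fun v : R => pois n (u - v) * g v).
Proof.
exact: (intR_bounded (measurable_pois_subl n u) (fun v => pois_bounded _ _)).
Qed.

Lemma smooth_bounded n g u : intR g ->
  `|smooth n g u| <= n.+1%:R * 2 * \int[mu]_v `|g v|.
Proof.
exact: (Rintegral_bounded (measurable_pois_subl n u) (fun v => pois_bounded _ _)).
Qed.

Lemma intR_damp_bounded n (h : R -> R) M : measurable_fun setT h ->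
  (forall y, `|h y| <= M) -> intR (fun y => damp n y * h y).
Proof.
by move=> mh hM; exact: (intR_mulC (intR_bounded mh hM (intR_damp _ n))).
Qed.

(** Damped Fourier inversion: the addition formula for cos(y(u - v)) merges the two products, and
    exchanging the integrals leaves the cosine transform of [damp n]. *)
Lemma smooth_damp n g u : intR g ->
  \int[mu]_y (cos (y * u) * (damp n y * fcos g y)) +
  \int[mu]_y (sin (y * u) * (damp n y * fsin g y)) = smooth n g u.
Proof.
move=> ig.
have ic := intR_damp_bounded n (measurable_fcos ig) (fun y => fcos_bounded y ig).
have is_ := intR_damp_bounded n (measurable_fsin ig) (fun y => fsin_bounded y ig).
have E y : cos (y * u) * (damp n y * fcos g y) + sin (y * u) * (damp n y * fsin g y)
   = damp n y * \int[mu]_v (cos (y * (u - v)) * g v).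
  transitivity (damp n y * (cos (y * u) * fcos g y + sin (y * u) * fsin g y)).
    by ring.
  congr (_ * _); rewrite /fcos /fsin.
  rewrite -RintegralZl//; last exact: intR_cosM.
  rewrite -RintegralZl//; last exact: intR_sinM.
  rewrite -RintegralD//; last 2 first.
  - exact: (intR_bounded (h := cst (cos (y * u))) (measurable_cst _)
      (fun _ => cos_max _) (intR_cosM _ ig)).
  - exact: (intR_bounded (h := cst (sin (y * u))) (measurable_cst _)
      (fun _ => sin_max _) (intR_sinM _ ig)).
  by apply: eq_Rintegral => v _; rewrite mulrBr cosB; ring.
rewrite -RintegralD//; last 2 first.
- exact: (intR_bounded (measurable_pairl u (measurable_swap_fun measurable_cosp))
    (fun y => cos_max _) ic).
- exact: (intR_bounded (measurable_pairl u (measurable_swap_fun measurable_sinp))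
    (fun y => sin_max _) is_).
under eq_Rintegral do rewrite E.
rewrite (Rfubini_bounded (k := fun p => cos (p.1 * (u - p.2))) (M := 1))//.
- apply: eq_Rintegral => v _ /=; rewrite mulrC -damp_cos; congr (_ * _).
  by apply: eq_Rintegral => y _; rewrite (mulrC y).
- apply: (measurableT_comp (f := @cos R)).
    by apply: continuous_measurable_fun; exact: continuous_cos.
  by apply: measurable_funM => //; exact: measurable_funB.
- by move=> p; exact: cos_max.
- exact: intR_damp.
Qed.

(** Transforms of L_1 functions are bounded but in general not integrable; after damping, each
    exchange of integrals involves a bounded kernel and two L_1 functions. *)
Lemma parseval_damp n f g : intR f -> intR g ->
  \int[mu]_y (damp n y * (fcos f y * fcos g y + fsin f y * fsin g y)) =
  \int[mu]_u (f u * smooth n g u).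
Proof.
move=> iff ig.
have mc := measurable_fcos ig; have ms := measurable_fsin ig.
have ic := intR_damp_bounded n mc (fun y => fcos_bounded y ig).
have is_ := intR_damp_bounded n ms (fun y => fsin_bounded y ig).
have /= C := Rfubini_bounded measurable_cosp (fun p => cos_max _) ic iff.
have /= S := Rfubini_bounded measurable_sinp (fun p => sin_max _) is_ iff.
have mC : measurable_fun setT
    (fun u => \int[mu]_x (cos (x * u) * (damp n x * fcos g x))).
  apply: (measurable_Rintegral2 (k := fun p => cos (p.2 * p.1) * (damp n p.2 * fcos g p.2))).
  apply: measurable_funM; first exact: measurable_swap_fun measurable_cosp.
  exact: (measurableT_comp (intR_measurable ic) measurable_snd).
have bC u : `|\int[mu]_x (cos (x * u) * (damp n x * fcos g x))| <=
    1 * \int[mu]_x `|damp n x * fcos g x|.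
  exact: (Rintegral_bounded (measurable_pairl u (measurable_swap_fun measurable_cosp))
    (fun y => cos_max _) ic).
have mS : measurable_fun setT
    (fun u => \int[mu]_x (sin (x * u) * (damp n x * fsin g x))).
  apply: (measurable_Rintegral2 (k := fun p => sin (p.2 * p.1) * (damp n p.2 * fsin g p.2))).
  apply: measurable_funM; first exact: measurable_swap_fun measurable_sinp.
  exact: (measurableT_comp (intR_measurable is_) measurable_snd).
have bS u : `|\int[mu]_x (sin (x * u) * (damp n x * fsin g x))| <=
    1 * \int[mu]_x `|damp n x * fsin g x|.
  exact: (Rintegral_bounded (measurable_pairl u (measurable_swap_fun measurable_sinp))
    (fun y => sin_max _) is_).
transitivity (\int[mu]_y (damp n y * fcos g y * fcos f y + damp n y * fsin g y * fsin f y)).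
  by apply: eq_Rintegral => y _; ring.
have iC := intR_mulC (intR_bounded (measurable_fcos iff) (fun y => fcos_bounded y iff) ic).
have iS := intR_mulC (intR_bounded (measurable_fsin iff) (fun y => fsin_bounded y iff) is_).
transitivity (\int[mu]_y (damp n y * fcos g y * fcos f y) +
  \int[mu]_y (damp n y * fsin g y * fsin f y)).
  exact: (RintegralD measurableT iC iS).
have jC := intR_mulC (intR_bounded mC bC iff).
have jS := intR_mulC (intR_bounded mS bS iff).
transitivity (\int[mu]_u (f u * \int[mu]_y (cos (y * u) * (damp n y * fcos g y))) +
  \int[mu]_u (f u * \int[mu]_y (sin (y * u) * (damp n y * fsin g y)))).
  exact: (f_equal2 _ C S).
transitivity (\int[mu]_u (f u * \int[mu]_y (cos (y * u) * (damp n y * fcos g y)) +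
  f u * \int[mu]_y (sin (y * u) * (damp n y * fsin g y)))).
  exact/esym/(RintegralD measurableT jC jS).
apply: eq_Rintegral => u _ /=; rewrite -mulrDr; congr (_ * _).
exact: smooth_damp.
Qed.

End CosineSineTransforms.

(** * The real Plancherel inequality, with equality for nice functions *)

Section RealPlancherel.
Variable R : realType.
Notation mu := (@lebesgue_measure R).
Notation intR f := (mu.-integrable setT (EFin \o f)).

Lemma measurable_subp (a : R -> \bar R) : measurable_fun setT a ->
  measurable_fun setT (fun p : R * R => a (p.1 - p.2)).
Proof. by move=> ma; apply: (measurableT_comp ma); exact: measurable_funB. Qed.

Lemma tonelli_conv (a b : R -> \bar R) :
  measurable_fun setT a -> measurable_fun setT b ->
  (forall x, 0 <= a x)%E -> (forall x, 0 <= b x)%E ->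
  (\int[mu]_u \int[mu]_v (a (u - v)%R * b v) = \int[mu]_u a u * \int[mu]_v b v)%E.
Proof.
move=> ma mb a0 b0.
have := fubini_tonelli (m1 := mu) (m2 := mu) (fun p : R * R => a (p.1 - p.2)%R * b p.2)%E.
rewrite /= => ->; last 2 first.
- apply: emeasurable_funM; first exact: measurable_subp.
  exact: measurableT_comp.
- by move=> p; rewrite mule_ge0.
rewrite -ge0_integralZl//; last exact: integral_ge0.
apply: eq_integral => v _.
have mav : measurable_fun setT (fun u : R => a (u - v)%R).
  by apply: (measurableT_comp ma); exact: measurable_funB.
rewrite ge0_integralZr//; congr (_ * _)%E.
exact: (integral_shift (- v) ma).
Qed.

(** Extended-real valued, because finiteness is part of what has to be proved. *)
Definition energy (f : R -> R) : \bar R :=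
  (\int[mu]_y (fcos f y ^+ 2 + fsin f y ^+ 2)%:E)%E.

Let dens_ge0 f (y : R) : 0 <= fcos f y ^+ 2 + fsin f y ^+ 2.
Proof. by rewrite addr_ge0 ?sqr_ge0. Qed.

Let measurable_dens f : intR f ->
  measurable_fun setT (fun y => fcos f y ^+ 2 + fsin f y ^+ 2).
Proof.
move=> iff; apply: measurable_funD; apply: measurable_funX.
  exact: measurable_fcos.
exact: measurable_fsin.
Qed.

Lemma cvg_damp (y : R) : damp n y @[n --> \oo] --> (1 : R).
Proof.
have cy : y / n.+1%:R @[n --> \oo] --> y * 0.
  by apply: cvgM; [exact: cvg_cst|exact: cvg_harmonic].
have := cvg_comp _ _ (cvgN (cvg_norm cy)) (@continuous_expR R _).
by rewrite mulr0 normr0 oppr0 expR0; apply.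
Qed.

Lemma damp_nondecreasing (y : R) : nondecreasing_seq (fun n => damp n y).
Proof.
move=> m n mn; rewrite /damp /laplace ler_expR lerN2 !normrM ler_wpM2l//.
by rewrite !ger0_norm ?invr_ge0// lef_pV2 ?posrE// ler_nat.
Qed.

(** The damping factors increase to 1, so monotone convergence applies on the transform side, where
    each term is given by the damped Parseval identity. *)
Lemma energy_cvg f : intR f ->
  (\int[mu]_u (f u * smooth n f u))%:E @[n --> \oo] --> energy f.
Proof.
move=> iff; pose g n y := (damp n y * (fcos f y ^+ 2 + fsin f y ^+ 2))%:E.
have md := measurable_dens iff.
have E n : (\int[mu]_u (f u * smooth n f u))%:E = (\int[mu]_y g n y)%E.
  rewrite -(parseval_damp n iff iff) /Rintegral fineK//.
  have b y : `|fcos f y ^+ 2 + fsin f y ^+ 2| <=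
      (1 * \int[mu]_u `|f u|) ^+ 2 + (1 * \int[mu]_u `|f u|) ^+ 2.
    rewrite ger0_norm// -(real_normK (num_real (fcos f y))) -(real_normK (num_real (fsin f y))).
    have c := fcos_bounded y iff; have s := fsin_bounded y iff.
    by rewrite lerD// lerXn2r// ?nnegrE ?(le_trans _ c).
  apply: integrable_fin_num => //.
  exact: (intR_damp_bounded n md b).
under eq_fun do rewrite E.
have -> : energy f = (\int[mu]_y limn (fun n => g n y))%E.
  apply: eq_integral => y _; apply/esym/cvg_lim => //.
  apply: cvg_EFin; first exact: nearW.
  rewrite -[X in _ --> X]mul1r; apply: cvgM; last exact: cvg_cst.
  exact: cvg_damp.
apply: cvg_monotone_convergence => //.
- by move=> n; apply/measurable_EFinP/measurable_funM => //; exact: measurable_damp.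
- by move=> n y _; rewrite lee_fin mulr_ge0 ?damp_ge0.
- by move=> y _ m n mn; rewrite lee_fin ler_wpM2r//; exact: damp_nondecreasing.
Qed.

Let intR_sq_smooth n f : intR (fun u => f u ^+ 2) ->
  intR (smooth n (fun u => f u ^+ 2)) /\
  \int[mu]_u smooth n (fun u => f u ^+ 2) u = 2 * pi * \int[mu]_u f u ^+ 2.
Proof.
move=> if2; have m2 := intR_measurable if2.
have E u : (smooth n (fun u => f u ^+ 2) u)%:E =
    (\int[mu]_v ((pois n (u - v))%:E * (f v ^+ 2)%:E))%E.
  rewrite /smooth /Rintegral fineK//; apply: integrable_fin_num => //.
  exact: intR_pois_sub.
have ge0 u : 0 <= smooth n (fun u => f u ^+ 2) u.
  by apply: Rintegral_ge0 => v _; rewrite mulr_ge0 ?pois_ge0 ?sqr_ge0.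
have T : (\int[mu]_u (smooth n (fun u => f u ^+ 2) u)%:E = (2 * pi * \int[mu]_u f u ^+ 2)%:E)%E.
  under eq_integral do rewrite E.
  rewrite (tonelli_conv (a := EFin \o pois n) (b := fun v => (f v ^+ 2)%:E)).
  - rewrite EFinM -(integral_pois _ n) {1 2}/Rintegral !fineK//.
      exact: integrable_fin_num.
    by apply: integrable_fin_num => //; exact: intR_pois.
  - by apply/measurable_EFinP; exact: measurable_pois.
  - exact/measurable_EFinP.
  - by move=> x; rewrite lee_fin pois_ge0.
  - by move=> x; rewrite lee_fin sqr_ge0.
split; last by rewrite {1}/Rintegral T.
apply/integrableP; split.
  by apply/measurable_EFinP; exact: measurable_smooth.
under eq_integral do rewrite /= ger0_norm//.
by rewrite T ltry.
Qed.

(** A Schur test: f(u) f(v) <= (f(u)^2 + f(v)^2)/2 under the even kernel pois n (u - v), whose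
    integral in either variable is 2 pi. *)
Lemma energy_le f : intR f -> intR (fun u => f u ^+ 2) ->
  (energy f <= (2 * pi * \int[mu]_u f u ^+ 2)%:E)%E.
Proof.
move=> iff if2; apply: (cvge_le _ (energy_cvg iff)).
apply: nearW => n; rewrite lee_fin.
have [is_ Es] := intR_sq_smooth n if2.
have msf := measurable_smooth n (intR_measurable iff).
have ifs : intR (fun u => f u * smooth n f u).
  exact: (intR_mulC (intR_bounded msf (fun u => smooth_bounded n u iff) iff)).
(* Each square receives half of the kernel; the mass 2 pi in v turns the first half into
   [pi * f u ^+ 2]. *)
have ih : intR (fun u => pi * f u ^+ 2 + 2^-1 * smooth n (fun u => f u ^+ 2) u).
  have i1 := integrableZl measurableT pi if2.
  have i2 := integrableZl measurableT 2^-1 is_.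
  exact: (integrableD measurableT i1 i2).
apply: (@le_trans _ _ (\int[mu]_u (pi * f u ^+ 2 + 2^-1 * smooth n (fun u => f u ^+ 2) u))).
  apply: le_Rintegral => // u _.
  have ip : intR (fun v => pois n (u - v)) by exact: (intR_reflect u (intR_pois R n)).
  have -> : pi = 2^-1 * \int[mu]_v pois n (u - v).
    have := Rintegral_affine u (a := -1) _ (@measurable_pois R n).
    rewrite oppr_eq0 oner_eq0 integral_pois invrN invr1 normrN1 mul1r => /(_ isT) H.
    rewrite (_ : Rintegral _ _ _ = 2 * pi); first by field.
    by rewrite -H; apply: eq_Rintegral => v _; rewrite mulN1r addrC.
  rewrite -mulrA -mulrDr /smooth -RintegralZr//.
  have i1 : intR (fun v => f u * (pois n (u - v) * f v)).
    by apply: intRZl; exact: intR_pois_sub.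
  have i2 : intR (fun v => pois n (u - v) * f v ^+ 2) by exact: intR_pois_sub.
  have i3 : intR (fun v => pois n (u - v) * f u ^+ 2) by exact: intRZr.
  rewrite -RintegralZl//; last exact: intR_pois_sub.
  rewrite -RintegralD// -RintegralZl//; last exact: (integrableD measurableT i3 i2).
  apply: le_Rintegral => //.
    by apply: intRZl; exact: (integrableD measurableT i3 i2).
  move=> v _; rewrite -mulrDr mulrCA [leRHS]mulrCA ler_wpM2l ?pois_ge0//.
  rewrite -subr_ge0 (_ : _ - _ = 2^-1 * (f u - f v) ^+ 2); last by field.
  by rewrite mulr_ge0 ?sqr_ge0.
rewrite RintegralD//; [|exact: intRZl|exact: intRZl].
by rewrite !RintegralZl// Es le_eqVlt; apply/orP; left; apply/eqP; field.
Qed.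

(** The kernel mass bounds [smooth n g] by 2 pi M uniformly in n, so that a multiple of |f| is a
    majorant. *)
Lemma cvg_smooth f g M : intR f -> intR g -> (forall x, `|g x| <= M) ->
  {ae mu, forall u, {for u, continuous g}} ->
  \int[mu]_u (f u * smooth n g u) @[n --> \oo] --> 2 * pi * \int[mu]_u (f u * g u).
Proof.
move=> iff ig gM cg; have mf := intR_measurable iff; have mg := intR_measurable ig.
have M0 : 0 <= M by exact: le_trans (gM 0).
have bs n u : `|smooth n g u| <= 2 * pi * M.
  have ip : intR (fun v => pois n (u - v)) by exact: (intR_reflect u (intR_pois R n)).
  have -> : 2 * pi = \int[mu]_v pois n (u - v).
    have := Rintegral_affine u (a := -1) _ (@measurable_pois R n).
    rewrite oppr_eq0 oner_eq0 integral_pois invrN invr1 normrN1 mul1r => /(_ isT) <-.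
    by apply: eq_Rintegral => v _; rewrite mulN1r addrC.
  have i1 : intR (fun v => pois n (u - v) * g v) by exact: intR_pois_sub.
  apply: (le_trans (le_normr_Rintegral _ i1)) => //; rewrite -RintegralZr//.
  apply: le_Rintegral => //; first exact: (integrable_norm i1).
    exact: intRZr.
  by move=> v _; rewrite normrM (ger0_norm (pois_ge0 _ _)) ler_wpM2l ?pois_ge0.
rewrite -RintegralZl//; last exact: (intR_mulC (intR_bounded mg gM iff)).
have [] // := @Rdominated_cvg _ (fun n u => f u * smooth n g u)
  (fun u => 2 * pi * (f u * g u)) (fun u => 2 * pi * M * `|f u|).
- by move=> n; apply: measurable_funM => //; exact: measurable_smooth.
- by apply: measurable_funM => //; exact: measurable_funM.
- move: cg; apply: ae_imp => u cu; rewrite mulrCA; apply: cvgM; first exact: cvg_cst.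
  exact: (cvg_pois mg gM cu).
- by apply: intRZl; exact: (integrable_norm iff).
- by move=> n u; rewrite normrM mulrC ler_wpM2r.
Qed.

Lemma energy_nice g M : intR g -> (forall x, `|g x| <= M) ->
  {ae mu, forall u, {for u, continuous g}} ->
  (energy g = (2 * pi * \int[mu]_u g u ^+ 2)%:E)%E.
Proof.
move=> ig gM cg; apply: (cvg_unique _ (energy_cvg ig)) => //.
apply: cvg_EFin; first exact: nearW.
exact: (cvg_smooth ig ig gM cg).
Qed.

End RealPlancherel.

(** * Density in L_2 and the real Plancherel identity *)

Section PlancherelDensity.
Variable R : realType.
Notation mu := (@lebesgue_measure R).
Notation intR f := (mu.-integrable setT (EFin \o f)).

Lemma ae_neq (p : R) : {ae mu, forall u, u <> p}.
Proof.
exists [set p]; split => //; first exact: lebesgue_measure_set1.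
by move=> u /= /contrapT.
Qed.

(** Makes indicators of intervals continuous almost everywhere, the regularity that [cvg_smooth]
    asks of g. *)
Lemma continuous_indic_itv (p q u : R) : u <> p -> u <> q ->
  {for u, continuous (\1_(`[p, q]) : R -> R)}.
Proof.
move=> /eqP up /eqP uq; pose I : R -> R := \1_(`[p, q]).
suff : I x @[x --> u] --> I u by [].
have [uin|uout] := boolP (p < u < q).
  have -> : I u = 1.
    by move: uin => /andP[a b]; rewrite /I indicE mem_set//= in_itv/= !ltW.
  apply: cvg_near_cst; near=> x.
  have : x \in `]p, q[ by near: x; apply: near_in_itvoo; rewrite in_itv/=.
  by rewrite in_itv/= => /andP[a b]; rewrite /I indicE mem_set//= in_itv/= !ltW.
have -> : I u = 0.
  rewrite /I indicE memNset//= in_itv/= => /andP[a b]; move/negP: uout; apply.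
  by rewrite !lt_neqAle a b (eq_sym p) up uq.
apply: cvg_near_cst; have [uq'|uq'] := ltP q u.
  near=> x; have : q < x by near: x; exact: lt_nbhsr.
  by move=> qx; rewrite /I indicE memNset//= in_itv/= => /andP[_]; rewrite leNgt qx.
have uq2 : u < q by rewrite lt_neqAle uq.
have pu : u < p.
  by rewrite ltNge; apply/negP => pu; move/negP: uout; apply; rewrite uq2 lt_neqAle eq_sym up pu.
near=> x; have : x < p by near: x; exact: lt_nbhsl.
by move=> qx; rewrite /I indicE memNset//= in_itv/= => /andP[+ _]; rewrite leNgt qx.
Unshelve. all: by end_near. Qed.

(** Cuts off in the domain and in the values at once, so that the result is bounded with bounded
    support. *)
Let trunc (f : R -> R) (k : nat) (u : R) : R :=
  if (`|u| <= k%:R) && (`|f u| <= k%:R) then f u else 0.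

Let measurable_trunc f k : measurable_fun setT f -> measurable_fun setT (trunc f k).
Proof.
move=> mf; apply: measurable_fun_if => //.
- apply: measurable_and.
    apply: measurable_fun_ler => //; exact: measurableT_comp.
  apply: measurable_fun_ler => //; exact: measurableT_comp.
- exact: measurable_funTS.
Qed.

Let cvg_trunc f (u : R) : trunc f k u @[k --> \oo] --> f u.
Proof.
apply: cvg_near_cst; near=> k; rewrite /trunc.
have -> // : (`|u| <= k%:R) && (`|f u| <= k%:R).
by apply/andP; split; near: k; exact: nbhs_infty_ger.
Unshelve. all: by end_near. Qed.

Let trunc_density (f : R -> R) (e : R) : intR f -> intR (fun u => f u ^+ 2) -> 0 < e ->
  exists k, \int[mu]_u (f u - trunc f k u) ^+ 2 < e.
Proof.
move=> iff if2 e0; have mf := intR_measurable iff.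
have [] // := @Rdominated_cvg R (fun k u => (f u - trunc f k u) ^+ 2)
  (fun u => 0) (fun u => f u ^+ 2).
- by move=> k; apply: measurable_funX; apply: measurable_funB => //; exact: measurable_trunc.
- apply: ae_all => u; have c : f u - trunc f k u @[k --> \oo] --> f u - f u.
    by apply: cvgB; [exact: cvg_cst|exact: cvg_trunc].
  by have := cvgM c c; rewrite subrr mulr0; apply.
- move=> k u; rewrite /trunc ger0_norm ?sqr_ge0//; case: ifP => _; last by rewrite subr0.
  by rewrite subrr expr0n/= sqr_ge0.
move=> _; rewrite Rintegral_cst// mul0r => /cvgr_lt /(_ _ e0) [N _ H].
by exists N; exact: H N (leqnn N).
Qed.

Lemma intR_sqr_le (f g : R -> R) : measurable_fun setT f ->
  (forall x, f x ^+ 2 <= g x) -> intR g -> intR (fun x => f x ^+ 2).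
Proof.
move=> mf fg ig; apply: (le_integrable _ _ _ ig) => //.
  by apply/measurable_EFinP; exact: measurable_funX.
move=> x _; rewrite /= lee_fin ger0_norm ?sqr_ge0// (le_trans (fg x))//.
exact: ler_norm.
Qed.

Lemma intR_sqrB (f g : R -> R) : measurable_fun setT f -> measurable_fun setT g ->
  intR (fun u => f u ^+ 2) -> intR (fun u => g u ^+ 2) ->
  intR (fun u => (f u - g u) ^+ 2).
Proof.
move=> mf mg f2 g2.
apply: (intR_sqr_le _ _ (intRD (intRZl 2 f2) (intRZl 2 g2))).
  exact: measurable_funB.
move=> x; rewrite -subr_ge0 (_ : _ - _ = (f x + g x) ^+ 2) ?sqr_ge0//; ring.
Qed.

Lemma intR_bounded_itv (h : R -> R) (p q M : R) : measurable_fun setT h ->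
  (forall x, `|h x| <= M) -> intR (fun u => h u * \1_(`[p, q]) u).
Proof. by move=> mh hM; exact: (intR_bounded mh hM (integrable_indic_itv p q true false)). Qed.

Let clip (k x : R) : R := Num.max (- k) (Num.min k x).

Let continuous_clip k : continuous (clip k).
Proof.
move=> x; apply: (@continuous_max _ _ (cst (- k)) (fun x => Num.min k x)).
  exact: cst_continuous.
by apply: (@continuous_min _ _ (cst k) id); [exact: cst_continuous|exact: cvg_id].
Qed.

Let clip_bounded k x : 0 <= k -> `|clip k x| <= k.
Proof.
move=> k0; rewrite /clip ler_norml le_max lexx/= ge_max ge_min lexx/= andbT.
by rewrite ge0_cp.
Qed.

(** Projecting onto [-k, k] does not increase the distance to a point of that interval, so clipping
    preserves an approximation of a function bounded by k. *)
Let clip_dist k x y : `|x| <= k -> `|x - clip k y| <= `|x - y|.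
Proof.
move=> xk; have k0 : 0 <= k by exact: le_trans xk.
move: xk; rewrite ler_norml => /andP[xk1 xk2]; rewrite /clip.
have [ky|ky] := leP k y.
  rewrite (max_idPr _); last by lra.
  by rewrite !ler0_norm ?subr_le0 ?(le_trans xk2)//; lra.
have [y1|y1] := leP (- k) y; first by [].
by rewrite !ger0_norm ?subr_ge0//; lra.
Qed.

(** Continuous functions approximate f in L_1 on a bounded interval. After clipping, |f - g|^2 <= 2k
    |f - g| makes this an L_2 approximation; multiplying by the indicator of [-k, k] can destroy
    continuity at the two endpoints, hence the almost-everywhere clause. *)
Let bounded_density (f : R -> R) (k : nat) (e : R) : measurable_fun setT f ->
  (forall u, `|f u| <= k%:R) -> (forall u, k%:R < `|u| -> f u = 0) -> 0 < e ->
  exists g : R -> R, [/\ measurable_fun setT g, (forall x, `|g x| <= k%:R),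
    intR g, {ae mu, forall u, {for u, continuous g}} &
    \int[mu]_u (f u - g u) ^+ 2 < e].
Proof.
move=> mf fk f0 e0; pose E := `[(- k%:R : R), k%:R]%classic.
have mE : measurable E by exact: measurable_itv.
have fE u : f u = f u * \1_E u.
  rewrite indicE; have [_|uE] := boolP (u \in E); first by rewrite mulr1.
  rewrite mulr0 f0// ltNge; apply/negP; rewrite ler_norml => uk.
  by move/negP: uE; apply; rewrite mem_set.
have iff : intR f.
  by have := intR_bounded_itv (- k%:R) k%:R mf fk; congr (integrable _ _ _); apply/funext => u;
    rewrite /= -fE.
have muE : (mu E < +oo)%E by rewrite /E lebesgue_measure_itv/=; case: ifP => // _; rewrite ltry.
have iE : mu.-integrable E (EFin \o f) by apply: integrableS iff.
have [g_ [cg ig]] := approximation_continuous_integrable mE muE iE.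
move=> /fine_cvgP[_ /cvgr_lt].
(* [2 * k%:R + 1] rather than [2 * k%:R], since k may be 0. *)
have d0 : 0 < e / (2 * k%:R + 1) by rewrite divr_gt0// ltr_wpDl// mulr_ge0.
move=> /(_ _ d0) [N _ /(_ N (leqnn N)) /= HN].
pose h u := clip k%:R (g_ N u).
have ch : continuous h.
  by move=> u; apply: (@continuous_comp _ _ _ (g_ N) (clip k%:R)); [exact: cg|exact: continuous_clip].
have hk u : `|h u| <= k%:R by exact: clip_bounded.
have mh : measurable_fun setT h by exact: continuous_measurable_fun.
have mI : measurable_fun setT (\1_E : R -> R) by exact: measurable_indic.
have mg : measurable_fun setT (fun u => h u * \1_E u) by exact: measurable_funM.
have gk u : `|h u * \1_E u| <= k%:R.
  by rewrite indicE; case: (u \in E); rewrite ?mulr1// mulr0 normr0.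
have igg := intR_bounded_itv (- k%:R) k%:R mh hk.
exists (fun u => h u * \1_E u); split => //.
  apply: ae_imp2 (ae_neq (- k%:R)) (ae_neq k%:R) => u u1 u2.
  by apply: continuousM; [exact: ch|exact: continuous_indic_itv].
have ifg : mu.-integrable E (EFin \o (fun u => `|f u - g_ N u|)).
  have i1 : mu.-integrable E (EFin \o (fun u => f u - g_ N u)).
    exact: (integrableB _ iE (ig N)).
  exact: (integrable_norm i1).
apply: (@le_lt_trans _ _ (2 * k%:R * \int[mu]_(u in E) `|f u - g_ N u|)).
  rewrite -RintegralZl// [leRHS]Rintegral_mkcond; apply: le_Rintegral => //.
  - have i1 : intR (fun u => f u - h u * \1_E u) by exact: intRB.
    have m1 := intR_measurable i1.
    have b1 u : `|f u - h u * \1_E u| <= k%:R + k%:R.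
      by rewrite (le_trans (ler_normB _ _))// lerD.
    exact: (intR_bounded m1 b1 i1).
  - have := iffLR (integrable_mkcond (mu := mu) _ mE) (@integrableZl _ _ _ mu E mE (2 * k%:R) _ ifg).
    by congr (integrable _ _ _); apply/funext => u; rewrite /= !patchE; case: ifP.
  - move=> u _; rewrite patchE {1}fE -mulrBl indicE; case: ifPn => uE; last by rewrite mulr0 expr0n.
    rewrite mulr1 -real_normK ?num_real// expr2 ler_pM//.
      rewrite (le_trans (ler_normB _ _))// mulr_natl mulr2n lerD//.
    exact: clip_dist.
move: HN; rewrite ltr_pdivlMr ?ltr_wpDl ?mulr_ge0//.
apply: le_lt_trans.
rewrite mulrC ler_pM ?mulr_ge0 ?Rintegral_ge0// ?lerDl//.
Qed.

Lemma L2_density (f : R -> R) (e : R) : intR f -> intR (fun u => f u ^+ 2) -> 0 < e ->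
  exists (g : R -> R) M, [/\ (forall x, `|g x| <= M), intR g, intR (fun u => g u ^+ 2),
    {ae mu, forall u, {for u, continuous g}} & \int[mu]_u (f u - g u) ^+ 2 < e].
Proof.
move=> iff if2 e0; have mf := intR_measurable iff.
(* Both errors enter with the factor 2 of (x + y)^2 <= 2 x^2 + 2 y^2. *)
have e4 : 0 < e / 4 by rewrite divr_gt0.
have [k Hk] := trunc_density iff if2 e4.
have mt := measurable_trunc k mf.
have [|||g [mg gk ig cg Hg]] := bounded_density (f := trunc f k) (k := k) (e := e / 4) mt.
- by move=> u; rewrite /trunc; case: ifP => [/andP[]//|_]; rewrite normr0.
- by move=> u ku; rewrite /trunc leNgt ku.
- exact: e4.
have t2 : intR (fun u => trunc f k u ^+ 2).
  apply: (intR_sqr_le mt _ if2) => u; rewrite /trunc; case: ifP => // _.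
  by rewrite expr0n sqr_ge0.
have g2 : intR (fun u => g u ^+ 2) by exact: (intR_bounded mg gk ig).
exists g, k%:R; split => //.
have i1 := intR_sqrB mf mt if2 t2; have i2 := intR_sqrB mt mg t2 g2.
apply: (@le_lt_trans _ _ (2 * \int[mu]_u (f u - trunc f k u) ^+ 2 +
   2 * \int[mu]_u (trunc f k u - g u) ^+ 2)); last by lra.
rewrite -!RintegralZl// -RintegralD//; [|exact: intRZl|exact: intRZl].
apply: le_Rintegral => //; first exact: intR_sqrB.
  by apply: intRD; exact: intRZl.
move=> u _; rewrite -subr_ge0.
rewrite (_ : _ - _ = ((f u - trunc f k u) - (trunc f k u - g u)) ^+ 2) ?sqr_ge0//; ring.
Qed.

Lemma energy_parallelogram (f g : R -> R) : intR f -> intR g ->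
  (energy (fun u => f u + g u)%R + energy (fun u => f u - g u)%R =
   2%:E * energy f + 2%:E * energy g)%E.
Proof.
move=> iff ig.
have m h : intR h -> measurable_fun setT (fun y => (fcos h y ^+ 2 + fsin h y ^+ 2)%:E).
  move=> ih; apply/measurable_EFinP; apply: measurable_funD; apply: measurable_funX.
    exact: measurable_fcos.
  exact: measurable_fsin.
have p h y : (0 <= (fcos h y ^+ 2 + fsin h y ^+ 2)%:E)%E.
  by rewrite lee_fin addr_ge0 ?sqr_ge0.
have mf := m _ iff; have mg := m _ ig.
rewrite /energy -!ge0_integralZl//.
rewrite -!ge0_integralD//; last 6 first.
- by move=> y _; rewrite mule_ge0.
- exact: measurable_funeM.
- by move=> y _; rewrite mule_ge0.
- exact: measurable_funeM.
- exact: m _ (intRD iff ig).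
- exact: m _ (intRB iff ig).
apply: eq_integral => y _; have ign := intRN ig.
rewrite !fcosD// !fsinD// fcosN// fsinN// -!EFinM -!EFinD; congr EFin; ring.
Qed.

(** For f = g + r: [Ef], [Eg], [Er] are the energies of f, g - r, r; [F], [G], [S / 2] are 2 pi
    times their squared norms; [Q] is the common value for g. Fed into the two parallelogram laws,
    the upper bound [Eg <= G] becomes a lower bound for [Ef]. *)
Let arith (Ef Eg Er F G Q S e : R) : Ef + Eg = 2 * Q + 2 * Er -> Eg <= G ->
  0 <= Er -> F + G = 2 * Q + S -> S < e -> F <= Ef + e.
Proof. lra. Qed.

(* The defect [2 pi int f^2 - energy f] is a nonnegative quadratic form that
   vanishes on the functions of [L2_density]. *)
Theorem real_plancherel (f : R -> R) : intR f -> intR (fun u => f u ^+ 2) ->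
  energy f = (2 * pi * \int[mu]_u f u ^+ 2)%:E.
Proof.
move=> iff if2; apply/eqP; rewrite eq_le energy_le//=.
have mf := intR_measurable iff.
pose q (h : R -> R) := 2 * pi * \int[mu]_u h u ^+ 2.
have pi0 : 0 < pi :> R := pi_gt0 R.
apply/lee_addgt0Pr => e e0.
have d0 : 0 < e / (4 * pi) by rewrite divr_gt0// mulr_gt0.
have [g [M [gM ig ig2 cg Hg]]] := L2_density iff if2 d0.
have mg := intR_measurable ig.
pose r u := f u - g u.
have ir : intR r by exact: intRB.
have ir2 : intR (fun u => r u ^+ 2) by exact: intR_sqrB.
have mr := intR_measurable ir.
have igr2 : intR (fun u => (g u - r u) ^+ 2) by exact: intR_sqrB.
have Er := energy_le ir ir2.
have Egr := energy_le (intRB ig ir) igr2.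
have := energy_parallelogram ig ir.
have fE : energy (fun u => g u + r u) = energy f.
  by congr energy; apply/funext => u; rewrite /r addrC subrK.
rewrite fE (energy_nice ig gM cg).
have fin (h : R -> R) : (0 <= energy h)%E.
  by apply: integral_ge0 => y _; rewrite lee_fin addr_ge0 ?sqr_ge0.
have finE (h : R -> R) : (energy h <= (q h)%:E)%E -> (energy h \is a fin_num).
  by move=> hq; rewrite (ge0_fin_numE (fin h)); exact: le_lt_trans hq (ltry _).
have Ef := energy_le iff if2.
rewrite -(fineK (finE _ Ef)) -(fineK (finE _ Er)) -(fineK (finE _ Egr)).
rewrite -!EFinM -!EFinD => -[] H.
have r0 : 0 <= fine (energy r) by exact: fine_ge0.
have Hgr : fine (energy (fun u => g u - r u)) <= 2 * pi * \int[mu]_u (g u - r u) ^+ 2.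
  by rewrite -lee_fin fineK// finE.
have Q : \int[mu]_u f u ^+ 2 + \int[mu]_u (g u - r u) ^+ 2 =
   2 * \int[mu]_u g u ^+ 2 + 2 * \int[mu]_u r u ^+ 2.
  rewrite -(RintegralZl 2 measurableT ig2) -(RintegralZl 2 measurableT ir2).
  rewrite -(RintegralD measurableT if2 igr2).
  rewrite -(RintegralD measurableT (intRZl 2 ig2) (intRZl 2 ir2)).
  by apply: eq_Rintegral => u _; rewrite /r; ring.
rewrite lee_fin.
have Hr : 4 * pi * \int[mu]_u r u ^+ 2 < e.
  by move: Hg; rewrite ltr_pdivlMr ?mulr_gt0// mulrC.
by apply: (arith H Hgr r0 _ Hr); rewrite -mulrDr Q; ring.
Qed.

End PlancherelDensity.

(** * Fourier analysis of quaternion-valued functions *)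

Section QuaternionIntegrals.
Variable R : realType.
Notation H := (quat R).
Notation mu := (@lebesgue_measure R).

(** Every index from 3 on gives the last coordinate, so that statements can quantify over all
    natural numbers. *)
Definition qco (k : nat) (x : H) : R :=
  match k with 0 => qre x | 1 => qim1 x | 2 => qim2 x | _ => qim3 x end.

Lemma qcoP (x y : H) : (forall k, qco k x = qco k y) -> x = y.
Proof.
by move=> h; apply: quatP; [exact: (h 0)|exact: (h 1)|exact: (h 2)|exact: (h 3)].
Qed.

Lemma qcoD k (x y : H) : qco k (x + y) = qco k x + qco k y.
Proof. by case: k => [|[|[|k]]]. Qed.

Lemma qcoN k (x : H) : qco k (- x) = - qco k x.
Proof. by case: k => [|[|[|k]]]. Qed.

Lemma qcoB k (x y : H) : qco k (x - y) = qco k x - qco k y.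
Proof. by rewrite qcoD qcoN. Qed.

Lemma qcoZ k (a : R) (x : H) : qco k (a *: x) = a * qco k x.
Proof. by case: k => [|[|[|k]]]. Qed.

Lemma qco0 k : qco k 0 = 0.
Proof. by case: k => [|[|[|k]]]. Qed.

Definition qn2 (x : H) : R := qre x ^+ 2 + qim1 x ^+ 2 + qim2 x ^+ 2 + qim3 x ^+ 2.

Lemma qn2_ge0 x : 0 <= qn2 x.
Proof. by rewrite /qn2 !addr_ge0 ?sqr_ge0. Qed.

Lemma qnorm_ge0 (x : H) : 0 <= qnorm x. Proof. exact: sqrtr_ge0. Qed.

Lemma qnorm_sqr (x : H) : qnorm x ^+ 2 = qn2 x.
Proof. by rewrite sqr_sqrtr// qn2_ge0. Qed.

(** Euler's four-square identity; together with [qn2_eq0] it excludes zero divisors. *)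
Lemma qn2M x y : qn2 (x * y) = qn2 x * qn2 y.
Proof. by case: x y => [a b c d] [a' b' c' d']; rewrite /qn2 /=; ring. Qed.

Lemma qnormM (x y : H) : qnorm (x * y) = qnorm x * qnorm y.
Proof. by rewrite /qnorm -/(qn2 _) qn2M sqrtrM ?qn2_ge0. Qed.

Lemma qn2N x : qn2 (- x) = qn2 x.
Proof. by rewrite /qn2 /= !sqrrN. Qed.

Lemma qn2_eq0 x : qn2 x = 0 -> x = 0.
Proof.
move=> /eqP; rewrite /qn2 !paddr_eq0 ?addr_ge0 ?sqr_ge0// !sqrf_eq0.
by move=> /andP[/andP[/andP[/eqP a /eqP b] /eqP c] /eqP d]; apply: quatP.
Qed.

Lemma qn20 : qn2 0 = 0. Proof. by rewrite /qn2 /= !expr0n !addr0. Qed.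

Lemma qco_sqr_le k x : qco k x ^+ 2 <= qn2 x.
Proof.
have s (a : R) := sqr_ge0 a.
by rewrite /qn2; have := (s (qre x), s (qim1 x), s (qim2 x), s (qim3 x));
  case: k => [|[|[|k]]] /= [[[]]]; lra.
Qed.

Lemma qco_le k (x : H) : `|qco k x| <= qnorm x.
Proof.
rewrite -(@ler_pXn2r _ 2) ?nnegrE ?qnorm_ge0// qnorm_sqr real_normK ?num_real//.
exact: qco_sqr_le.
Qed.

Lemma qnorm_le (x : H) :
  qnorm x <= `|qco 0 x| + `|qco 1 x| + `|qco 2 x| + `|qco 3 x|.
Proof.
rewrite -(@ler_pXn2r _ 2) ?nnegrE ?qnorm_ge0 ?addr_ge0// qnorm_sqr /qn2 /=.
rewrite -(real_normK (num_real (qre x))) -(real_normK (num_real (qim1 x))).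
rewrite -(real_normK (num_real (qim2 x))) -(real_normK (num_real (qim3 x))).
have := (normr_ge0 (qre x), normr_ge0 (qim1 x), normr_ge0 (qim2 x), normr_ge0 (qim3 x)).
move=> [[[]]]; nra.
Qed.

Lemma qn2D_le x y : qn2 (x + y) <= 2 * qn2 x + 2 * qn2 y.
Proof.
rewrite -subr_ge0 (_ : _ - _ = qn2 (x - y)) ?qn2_ge0//.
by case: x y => [a b c d] [a' b' c' d']; rewrite /qn2 /=; ring.
Qed.

Lemma qn2_parallelogram x y : qn2 (x + y) + qn2 (x - y) = 2 * qn2 x + 2 * qn2 y.
Proof. by case: x y => [a b c d] [a' b' c' d']; rewrite /qn2 /=; ring. Qed.

(** Over an arbitrary domain, since convolution kernels are functions on the plane. *)
Definition qmeas d (T : measurableType d) (f : T -> H) :=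
  forall k, measurable_fun setT (fun x => qco k (f x)).

Lemma qmeasurableP (f : R -> H) : qmeasurable f <-> qmeas f.
Proof.
split; first by case=> [a b c e] [|[|[|k]]].
by move=> h; split; [exact: (h 0)|exact: (h 1)|exact: (h 2)|exact: (h 3)].
Qed.

Section Measurability.
Context d (T : measurableType d).
Implicit Types f g : T -> H.

Lemma qmeasD f g : qmeas f -> qmeas g -> qmeas (fun x => f x + g x).
Proof. by move=> hf hg k; under eq_fun do rewrite qcoD; exact: measurable_funD. Qed.

Lemma qmeasN f : qmeas f -> qmeas (fun x => - f x).
Proof. by move=> hf k; under eq_fun do rewrite qcoN; exact: measurableT_comp. Qed.

Lemma qmeasB f g : qmeas f -> qmeas g -> qmeas (fun x => f x - g x).
Proof. by move=> hf hg; exact: (qmeasD hf (qmeasN hg)). Qed.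

Lemma qmeas_cst (c : H) : qmeas (fun _ : T => c).
Proof. by move=> k; exact: measurable_cst. Qed.

Lemma qmeasZ (a : T -> R) f : measurable_fun setT a -> qmeas f ->
  qmeas (fun x => a x *: f x).
Proof. by move=> ma hf k; under eq_fun do rewrite qcoZ; exact: measurable_funM. Qed.

Lemma qmeasM f g : qmeas f -> qmeas g -> qmeas (fun x => f x * g x).
Proof.
move=> hf hg; have h k l := measurable_funM (hf k) (hg l).
by case=> [|[|[|k]]] /=; repeat first [apply: measurable_funB|apply: measurable_funD];
  (exact: (h 0 0) || exact: (h 0 1) || exact: (h 0 2) || exact: (h 0 3) ||
   exact: (h 1 0) || exact: (h 1 1) || exact: (h 1 2) || exact: (h 1 3) ||
   exact: (h 2 0) || exact: (h 2 1) || exact: (h 2 2) || exact: (h 2 3) ||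
   exact: (h 3 0) || exact: (h 3 1) || exact: (h 3 2) || exact: (h 3 3)).
Qed.

Lemma measurable_qn2 f : qmeas f -> measurable_fun setT (fun x => qn2 (f x)).
Proof.
move=> hf; have h k := measurable_funX 2 (hf k).
apply: measurable_funD; last exact: (h 3).
apply: measurable_funD; last exact: (h 2).
by apply: measurable_funD; [exact: (h 0)|exact: (h 1)].
Qed.

Lemma measurable_qnorm f : qmeas f -> measurable_fun setT (fun x => qnorm (f x)).
Proof.
move=> hf; apply: (measurableT_comp (f := @Num.sqrt R)) (measurable_qn2 hf).
by apply: continuous_measurable_fun; exact: sqrt_continuous.
Qed.

Lemma qmeas_comp d' (T' : measurableType d') f (h : T' -> T) :
  measurable_fun setT h -> qmeas f -> qmeas (f \o h).
Proof. by move=> mh hf k; exact: (measurableT_comp (hf k)). Qed.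

Lemma qmeas_conj f : qmeas f -> qmeas (fun x => qconj (f x)).
Proof.
move=> hf; case=> [|[|[|k]]] /=; first exact: (hf 0).
- exact: measurable_funN (hf 1).
- exact: measurable_funN (hf 2).
- exact: measurable_funN (hf 3).
Qed.

Variable m : {measure set T -> \bar R}.

Definition qintg f := forall k, m.-integrable setT (EFin \o (fun x => qco k (f x))).

Definition qintm f : H := Quat
  (\int[m]_u qre (f u)) (\int[m]_u qim1 (f u))
  (\int[m]_u qim2 (f u)) (\int[m]_u qim3 (f u)).

Lemma qco_qint k f : qco k (qintm f) = \int[m]_u qco k (f u).
Proof. by case: k => [|[|[|k]]]. Qed.

Lemma qintg_meas f : qintg f -> qmeas f.
Proof. by move=> h k; move: (h k) => /measurable_int/measurable_EFinP. Qed.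

Lemma qintgP f : qmeas f -> (\int[m]_x (qnorm (f x))%:E < +oo)%E -> qintg f.
Proof.
move=> mf fo k; apply/integrableP; split; first exact/measurable_EFinP.
apply: le_lt_trans fo; apply: ge0_le_integral => //.
- by apply: measurableT_comp => //; exact/measurable_EFinP.
- by apply/measurable_EFinP; exact: measurable_qnorm.
- by move=> x _; rewrite /= lee_fin qco_le.
Qed.

Lemma qintg_norm f : qintg f -> m.-integrable setT (EFin \o (fun x => qnorm (f x))).
Proof.
move=> h; have mf := qintg_meas h.
have n k : m.-integrable setT (EFin \o (fun x => `|qco k (f x)|)) by exact: (integrable_norm (h k)).
have s := integrableD measurableT (integrableD measurableT (integrableD measurableT (n 0) (n 1)) (n 2)) (n 3).
apply: (le_integrable _ _ _ s) => //.
  by apply/measurable_EFinP; exact: measurable_qnorm.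
by move=> x _; rewrite /= lee_fin (ger0_norm (qnorm_ge0 _)) (le_trans (qnorm_le _))// ler_norm.
Qed.

Lemma qintgD f g : qintg f -> qintg g -> qintg (fun x => f x + g x).
Proof.
move=> hf hg k; have := integrableD measurableT (hf k) (hg k).
by congr (integrable _ _ _); apply/funext => x; rewrite /= qcoD.
Qed.

Lemma qintgN f : qintg f -> qintg (fun x => - f x).
Proof.
move=> hf k; have := integrableN (hf k).
by congr (integrable _ _ _); apply/funext => x; rewrite /= qcoN.
Qed.

Lemma qintgM_bounded f g M : qmeas f -> (forall x, qnorm (f x) <= M) -> qintg g ->
  qintg (fun x => f x * g x).
Proof.
move=> mf fM ig; have mg := qintg_meas ig.
apply: qintgP; first exact: qmeasM.
have i := integrableZl measurableT M (qintg_norm ig).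
move/integrableP : (i) => [mi]; apply: le_lt_trans; apply: ge0_le_integral => //.
- by move=> x _; rewrite lee_fin qnorm_ge0.
- by apply/measurable_EFinP; apply: measurable_qnorm; exact: qmeasM.
- exact: measurableT_comp.
- move=> x _; rewrite /= lee_fin qnormM (le_trans _ (ler_norm _))// ler_wpM2r ?qnorm_ge0//.
Qed.

Lemma qintgMl (c : H) f : qintg f -> qintg (fun x => c * f x).
Proof. exact: (qintgM_bounded (qmeas_cst c) (fun _ => lexx _)). Qed.

Lemma qintgMr (c : H) f : qintg f -> qintg (fun x => f x * c).
Proof.
move=> hf; apply: qintgP; first by apply: qmeasM; [exact: qintg_meas|exact: qmeas_cst].
under eq_integral do rewrite qnormM mulrC.
have /integrableP[_] := integrableZl measurableT (qnorm c) (qintg_norm hf).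
apply: le_lt_trans; apply: ge0_le_integral => //.
- by move=> x _; rewrite lee_fin mulr_ge0 ?qnorm_ge0.
- apply/measurable_EFinP; apply: measurable_funM => //.
  exact: measurable_qnorm (qintg_meas hf).
- apply: measurableT_comp => //; apply/measurable_EFinP; apply: measurable_funM => //.
  exact: measurable_qnorm (qintg_meas hf).
- by move=> x _; rewrite /= lee_fin ler_norm.
Qed.

Lemma qintD f g : qintg f -> qintg g ->
  qintm (fun x => f x + g x) = qintm f + qintm g.
Proof.
move=> hf hg; apply: qcoP => k; rewrite qcoD !qco_qint -RintegralD//.
by apply: eq_Rintegral => x _; rewrite qcoD.
Qed.

Lemma qintN f : qintg f -> qintm (fun x => - f x) = - qintm f.
Proof.
move=> hf; apply: qcoP => k; rewrite qcoN !qco_qint -mulN1r -RintegralZl//.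
by apply: eq_Rintegral => x _; rewrite qcoN mulN1r.
Qed.

Lemma qintB f g : qintg f -> qintg g ->
  qintm (fun x => f x - g x) = qintm f - qintm g.
Proof. by move=> hf hg; rewrite qintD ?qintN//; exact: qintgN. Qed.

Let RintegralM2 (a b : T -> R) (x y : R) : m.-integrable setT (EFin \o a) ->
  m.-integrable setT (EFin \o b) ->
  \int[m]_u (x * a u + y * b u) = x * \int[m]_u a u + y * \int[m]_u b u.
Proof.
move=> ia ib; by rewrite RintegralD ?RintegralZl//; exact: intRZl.
Qed.

Let RintegralM4 (a b c e : T -> R) (x y z t : R) : m.-integrable setT (EFin \o a) ->
  m.-integrable setT (EFin \o b) -> m.-integrable setT (EFin \o c) ->
  m.-integrable setT (EFin \o e) ->
  \int[m]_u (x * a u + y * b u + z * c u + t * e u) =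
  x * \int[m]_u a u + y * \int[m]_u b u + z * \int[m]_u c u + t * \int[m]_u e u.
Proof.
move=> ia ib ic ie; rewrite -addrA -!RintegralM2// -RintegralD.
- by apply: eq_Rintegral => u _; rewrite addrA.
- by [].
- by apply: intRD; exact: intRZl.
- by apply: intRD; exact: intRZl.
Qed.

(** Left and right factors are treated separately because H is not commutative; each coordinate of
    the product is a combination of the four coordinate integrals. *)
Lemma qintMl (c : H) f : qintg f -> qintm (fun x => c * f x) = c * qintm f.
Proof.
move=> hf; have [[[h0 h1] h2] h3] := (hf 0, hf 1, hf 2, hf 3).
case: c => [a b c e]; apply: quatP => /=.
- rewrite -2!addrA -!mulNr !addrA -RintegralM4//.
  by apply: eq_Rintegral => u _; rewrite /=; ring.
- transitivity (\int[m]_u (b * qco 0 (f u) + a * qco 1 (f u) + (- e) * qco 2 (f u) + c * qco 3 (f u))).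
    by apply: eq_Rintegral => u _; rewrite /=; ring.
  by rewrite RintegralM4//=; ring.
- transitivity (\int[m]_u (c * qco 0 (f u) + e * qco 1 (f u) + a * qco 2 (f u) + (- b) * qco 3 (f u))).
    by apply: eq_Rintegral => u _; rewrite /=; ring.
  by rewrite RintegralM4//=; ring.
- transitivity (\int[m]_u (e * qco 0 (f u) + (- c) * qco 1 (f u) + b * qco 2 (f u) + a * qco 3 (f u))).
    by apply: eq_Rintegral => u _; rewrite /=; ring.
  by rewrite RintegralM4//=; ring.
Qed.

Lemma qintMr (c : H) f : qintg f -> qintm (fun x => f x * c) = qintm f * c.
Proof.
move=> hf; have [[[h0 h1] h2] h3] := (hf 0, hf 1, hf 2, hf 3).
case: c => [a b c e]; apply: quatP => /=.
- transitivity (\int[m]_u (a * qco 0 (f u) + (- b) * qco 1 (f u) + (- c) * qco 2 (f u) + (- e) * qco 3 (f u))).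
    by apply: eq_Rintegral => u _; rewrite /=; ring.
  by rewrite RintegralM4//=; ring.
- transitivity (\int[m]_u (b * qco 0 (f u) + a * qco 1 (f u) + e * qco 2 (f u) + (- c) * qco 3 (f u))).
    by apply: eq_Rintegral => u _; rewrite /=; ring.
  by rewrite RintegralM4//=; ring.
- transitivity (\int[m]_u (c * qco 0 (f u) + (- e) * qco 1 (f u) + a * qco 2 (f u) + b * qco 3 (f u))).
    by apply: eq_Rintegral => u _; rewrite /=; ring.
  by rewrite RintegralM4//=; ring.
- transitivity (\int[m]_u (e * qco 0 (f u) + c * qco 1 (f u) + (- b) * qco 2 (f u) + a * qco 3 (f u))).
    by apply: eq_Rintegral => u _; rewrite /=; ring.
  by rewrite RintegralM4//=; ring.
Qed.

End Measurability.

End QuaternionIntegrals.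

(** * Injectivity of the real transform on constants plus L_1 *)

Section FourierUniqueness.
Variable R : realType.
Notation mu := (@lebesgue_measure R).
Notation intR f := (mu.-integrable setT (EFin \o f)).

Lemma Rintegral_itv_indic (f : R -> R) (p q : R) :
  \int[mu]_(x in `[p, q]) f x = \int[mu]_x (f x * \1_(`[p, q]) x).
Proof.
rewrite Rintegral_mkcond; apply: eq_Rintegral => x _.
by rewrite patchE indicE; case: ifP; rewrite ?mulr1 ?mulr0.
Qed.

(** By Lebesgue differentiation f is almost everywhere the derivative of its integral from p, which
    vanishes identically near u. *)
Lemma ae_zero_itv (f : R -> R) (p b : R) : intR f ->
  (forall q, p < q -> q < b -> \int[mu]_x (f x * \1_(`[p, q]) x) = 0) ->
  {ae mu, forall u, p < u -> u < b -> f u = 0}.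
Proof.
move=> iff f0.
have i1 y : mu.-integrable [set` Interval (BLeft p) (BRight y)] (EFin \o f).
  by apply: integrableS iff.
have lf : locally_integrable [set: R] f by apply: open_integrable_locally => //; exact: openT.
have := FTC1 i1 lf; apply: ae_imp => u H pu ub.
have [|_ <-] := H; first by rewrite /= lte_fin.
rewrite derive1E (@near_eq_derive _ _ _ _ (cst 0)) ?derive_cst//.
near=> x; rewrite -[LHS]/(\int[mu]_(x in `[p, x]) f x) Rintegral_itv_indic f0//; near: x.
  exact: lt_nbhsr.
exact: lt_nbhsl.
Unshelve. all: by end_near. Qed.

Lemma ae_zero_pos (f : R -> R) : intR f ->
  (forall p q, 0 < p -> p < q -> \int[mu]_x (f x * \1_(`[p, q]) x) = 0) ->
  {ae mu, forall u, 0 < u -> f u = 0}.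
Proof.
move=> iff f0.
have h n : {ae mu, forall u, n.+1%:R^-1 < u -> u < n%:R -> f u = 0}.
  by apply: ae_zero_itv => // q pq _; apply: f0.
have := ae_foralln h; apply: ae_imp => u hu u0.
have [n Hn] : exists n : nat, n.+1%:R^-1 < u /\ u < n%:R.
  (* The first summand ensures u < n, the second 1/(n+1) < u. *)
  exists (Num.bound u + Num.bound u^-1)%N; split.
    rewrite invf_plt ?posrE//; have := archi_boundP (ltW (_ : 0 < u^-1)).
    rewrite invr_gt0 => /(_ u0) /lt_trans; apply.
    by rewrite ltr_nat ltnS leq_addl.
  by rewrite (lt_le_trans (archi_boundP (ltW u0)))// ler_nat leq_addr.
by case: Hn; exact: hu.
Qed.

Lemma ae_zero_neg (f : R -> R) : intR f ->
  (forall p q, p < q -> q < 0 -> \int[mu]_x (f x * \1_(`[p, q]) x) = 0) ->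
  {ae mu, forall u, u < 0 -> f u = 0}.
Proof.
move=> iff f0.
have h (n : nat) : {ae mu, forall u, - n%:R < u -> u < 0 -> f u = 0}.
  by apply: ae_zero_itv => // q pq q0; apply: f0.
have := ae_foralln h; apply: ae_imp => u hu u0.
apply: (hu (Num.bound (- u))) => //.
by rewrite ltrNl archi_boundP// oppr_ge0 ltW.
Qed.

Let pois_far n (m u : R) : 0 < m -> m <= `|u| -> pois n u <= 2 / m ^+ 2 / n.+1%:R.
Proof.
move=> m0 mu_; rewrite /pois /poisson.
have k0 : 0 < n.+1%:R :> R by [].
have u2 : m ^+ 2 <= u ^+ 2.
  by rewrite -(real_normK (num_real u)) lerXn2r// nnegrE ltW.
have m2 : 0 < m ^+ 2 by rewrite exprn_gt0.
move: (n.+1%:R) k0 => k k0.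
have D : k ^+ 2 * m ^+ 2 <= 1 + (k * u) ^+ 2.
  by rewrite exprMn (le_trans (ler_wpM2l (sqr_ge0 k) u2))// lerDr.
have -> : 2 / m ^+ 2 / k = k * (2 / (k ^+ 2 * m ^+ 2)).
  by field; rewrite (gt_eqF m0) (gt_eqF k0).
rewrite ler_wpM2l ?(ltW k0)// ler_wpM2l// lef_pV2 ?posrE//.
  by rewrite ltr_pwDl// sqr_ge0.
by rewrite mulr_gt0// exprn_gt0.
Qed.

(** The hypotheses say that f has the transform of -c times the unit mass at 0. Tested against the
    smoothed indicator of an interval at distance m from 0, damped Parseval gives -c times the
    Poisson mass of the interval, which is O(1/n), while the limit is 2 pi times the integral of
    f. *)
Let zero_far (f : R -> R) (c p q m : R) : intR f -> (forall y, fcos f y = - c) ->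
  (forall y, fsin f y = 0) -> 0 < m -> p < q ->
  (forall u, p <= u -> u <= q -> m <= `|u|) ->
  \int[mu]_x (f x * \1_(`[p, q]) x) = 0.
Proof.
move=> iff fc fs m0 pq far; pose I : R -> R := \1_(`[p, q]).
have I1 u : `|I u| <= 1.
  by rewrite /I indicE; case: (_ \in _); rewrite ?normr1// normr0.
have iI : intR I by exact: (integrable_indic_itv p q true false).
have cI : {ae mu, forall u, {for u, continuous I}}.
  apply: ae_imp2 (ae_neq p) (ae_neq q) => u; exact: continuous_indic_itv.
have L := cvg_smooth iff iI I1 cI.
have E n : \int[mu]_u (f u * smooth n I u) = - c * \int[mu]_u (I u * pois n u).
  rewrite -(parseval_damp n iff iI).
  transitivity (\int[mu]_y (- c * (damp n y * fcos I y))).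
    by apply: eq_Rintegral => y _; rewrite fc fs; ring.
  rewrite RintegralZl//; last first.
    exact: (intR_damp_bounded n (measurable_fcos iI) (fun y => fcos_bounded y iI)).
  congr (_ * _).
  have := Rfubini_bounded (@measurable_cosp R) (fun p => cos_max _) (intR_damp R n) iI.
  rewrite /= => ->; apply: eq_Rintegral => u _; rewrite -damp_cos.
  by congr (_ * _); apply: eq_Rintegral => y _; rewrite (mulrC y).
have Z : \int[mu]_u (f u * smooth n I u) @[n --> \oo] --> (0 : R).
  rewrite (_ : (fun n => _) = (fun n => - c * \int[mu]_u (I u * pois n u))); last exact/funext.
  rewrite -[X in _ --> X](mulr0 (- c)); apply: cvgM; first exact: cvg_cst.
  have ip n : intR (fun u => I u * pois n u).
    by exact: (intR_bounded (intR_measurable iI) I1 (intR_pois R n)).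
  apply: (@squeeze_cvgr _ _ _ _ (cst 0) (fun n => 2 / m ^+ 2 * \int[mu]_u I u * n.+1%:R^-1)).
  - apply: nearW => n; apply/andP; split.
      apply: Rintegral_ge0 => u _; rewrite mulr_ge0 ?pois_ge0// /I indicE.

    rewrite mulrAC -RintegralZl//; apply: le_Rintegral => //; first exact: intRZl.
    move=> u _; rewrite /I indicE; have [uI|uI] := boolP (u \in _); last by rewrite mul0r mulr0.
    rewrite mul1r mulr1; apply: pois_far => //.
    by move: uI; rewrite inE/= in_itv/= => /andP[]; exact: far.
  - exact: cvg_cst.
  - rewrite -[X in _ --> X](mulr0 (2 / m ^+ 2 * \int[mu]_u I u)); apply: cvgM; first exact: cvg_cst.
    exact: cvg_harmonic.
have pi2 : 2 * pi != 0 :> R by rewrite mulf_neq0// gt_eqF// pi_gt0.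
by apply: (mulfI pi2); rewrite mulr0; exact: (cvg_unique (@Rhausdorff R) L Z).
Qed.

(** Intervals avoiding 0 already determine f up to a null set, which gives f = 0; evaluating the
    transform at y = 0 then gives c = 0. *)
Theorem real_fourier_unique (f : R -> R) (c : R) : intR f ->
  (forall y, fcos f y = - c) -> (forall y, fsin f y = 0) ->
  {ae mu, forall u, f u = 0} /\ c = 0.
Proof.
move=> iff fc fs.
have P : {ae mu, forall u, 0 < u -> f u = 0}.
  apply: ae_zero_pos => // p q p0 pq; apply: (zero_far iff fc fs p0 pq) => u pu _.
  by rewrite (le_trans pu)// ler_norm.
have N : {ae mu, forall u, u < 0 -> f u = 0}.
  apply: ae_zero_neg => // p q pq q0.
  apply: (zero_far iff fc fs (m := - q) _ pq); first by rewrite oppr_gt0.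
  by move=> u _ uq; rewrite ler_normr lerN2 uq orbT.
have Z : {ae mu, forall u, f u = 0}.
  apply: ae_imp2 (ae_imp2 _ P N) (ae_neq 0); last first.
    by move=> u hp hn; exact: (conj hp hn).
  move=> u [hp hn] /eqP; rewrite neq_lt => /orP[/hn//|/hp//].
split => //; apply/eqP; rewrite -oppr_eq0 -(fc 0) /fcos /Rintegral.
rewrite (ae_eq_integral (cst 0)%E)//.
- by rewrite integral0.
- exact: measurable_int (intR_cosM 0 iff).
- by move: Z; apply: ae_imp => u fu _ /=; rewrite fu mulr0.
Qed.

End FourierUniqueness.

(** * Square-integrable quaternion-valued functions *)

Section QuaternionL2.
Variable R : realType.
Notation H := (quat R).
Notation mu := (@lebesgue_measure R).
Notation intR f := (mu.-integrable setT (EFin \o f)).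
Implicit Types f g F G : R -> H.

(** The squared norm in place of the norm: no roots occur, and |x + y|^2 <= 2 |x|^2 + 2 |y|^2
    replaces the triangle inequality. *)
Definition N2 f : \bar R := (\int[mu]_u (qn2 (f u))%:E)%E.
Definition L2 f := qmeas f /\ (N2 f < +oo)%E.

Lemma N2_ge0 f : (0 <= N2 f)%E.
Proof. by apply: integral_ge0 => u _; rewrite lee_fin qn2_ge0. Qed.

Lemma L2_fin f : L2 f -> N2 f \is a fin_num.
Proof. by move=> [_ h]; rewrite ge0_fin_numE// N2_ge0. Qed.

Lemma emeas_qn2 f : qmeas f -> measurable_fun setT (fun u => (qn2 (f u))%:E).
Proof. by move=> mf; apply/measurable_EFinP; exact: measurable_qn2. Qed.

Lemma qLnorm2E f : qLnorm 2%:E f = (N2 f `^ 2^-1)%E.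
Proof.
rewrite /qLnorm unlock; congr (_ `^ _)%E; apply: eq_integral => u _.
rewrite /= ger0_norm ?qnorm_ge0// -qnorm_sqr.
by rewrite powR_mulrn ?qnorm_ge0.
Qed.

Lemma qLp2P f : qLp 2%:E f <-> L2 f.
Proof.
rewrite /qLp /L2 /= qLnorm2E qmeasurableP; split=> -[mf h]; split => //.
  by move: h; have := N2_ge0 f; case: (N2 f) => [r _ _|_|]//; rewrite ?ltry// poweRyr// invr_eq0 pnatr_eq0.
by rewrite poweR_lty.
Qed.

Lemma qLp1P f : qLp 1%:E f <-> qintg mu f.
Proof.
rewrite /qLp /= qmeasurableP /qLnorm Lnorm1; split => [[mf h]|h].
  apply: qintgP => //; apply: le_lt_trans h; apply: ge0_le_integral => //.
  - by move=> x _; rewrite lee_fin qnorm_ge0.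
  - by apply/measurable_EFinP; exact: measurable_qnorm.
  - apply: measurableT_comp => //; apply/measurable_EFinP; exact: measurable_qnorm.
  - by move=> x _; rewrite lee_fin ler_norm.
split; first exact: qintg_meas h.
by have /integrableP[] := qintg_norm h.
Qed.

Lemma N2D_le f g : qmeas f -> qmeas g ->
  (N2 (fun u => f u + g u)%R <= 2%:E * N2 f + 2%:E * N2 g)%E.
Proof.
move=> mf mg; rewrite /N2 -!ge0_integralZl//; last 4 first.
- exact: emeas_qn2.
- by move=> u _; rewrite lee_fin qn2_ge0.
- exact: emeas_qn2.
- by move=> u _; rewrite lee_fin qn2_ge0.
rewrite -ge0_integralD//; last 4 first.
- by move=> u _; rewrite mule_ge0// lee_fin qn2_ge0.
- by apply: measurable_funeM; exact: emeas_qn2.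
- by move=> u _; rewrite mule_ge0// lee_fin qn2_ge0.
- by apply: measurable_funeM; exact: emeas_qn2.
apply: ge0_le_integral => //.
- by move=> u _; rewrite lee_fin qn2_ge0.
- by apply: emeas_qn2; exact: qmeasD.
- by apply: emeasurable_funD; apply: measurable_funeM; exact: emeas_qn2.
- by move=> u _; rewrite -!EFinM -EFinD lee_fin qn2D_le.
Qed.

Lemma N2N f : N2 (fun u => - f u) = N2 f.
Proof. by apply: eq_integral => u _; rewrite qn2N. Qed.

Lemma L2D f g : L2 f -> L2 g -> L2 (fun u => f u + g u).
Proof.
move=> [mf hf] [mg hg]; split; first exact: qmeasD.
by apply: (le_lt_trans (N2D_le mf mg)); rewrite lte_add_pinfty// lte_mul_pinfty.
Qed.

Lemma L2N f : L2 f -> L2 (fun u => - f u).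
Proof. by move=> [mf hf]; split; [exact: qmeasN|rewrite N2N]. Qed.

Lemma L2B f g : L2 f -> L2 g -> L2 (fun u => f u - g u).
Proof. by move=> hf hg; exact: (L2D hf (L2N hg)). Qed.

Lemma N2B_le f g : qmeas f -> qmeas g ->
  (N2 (fun u => f u - g u)%R <= 2%:E * N2 f + 2%:E * N2 g)%E.
Proof. by move=> mf mg; rewrite -(N2N g); apply: N2D_le => //; exact: qmeasN. Qed.

Lemma N2Ml (c : H) f : qmeas f -> N2 (fun u => c * f u) = ((qn2 c)%:E * N2 f)%E.
Proof.
move=> mf; rewrite /N2 -ge0_integralZl//.
- by apply: eq_integral => u _; rewrite qn2M EFinM.
- exact: emeas_qn2.
- by move=> u _; rewrite lee_fin qn2_ge0.
- by rewrite lee_fin qn2_ge0.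
Qed.

Lemma N2Mr (c : H) f : qmeas f -> N2 (fun u => f u * c) = ((qn2 c)%:E * N2 f)%E.
Proof.
move=> mf; rewrite -N2Ml//; apply: eq_integral => u _.
by rewrite !qn2M mulrC.
Qed.

Lemma L2Ml (c : H) f : L2 f -> L2 (fun u => c * f u).
Proof.
move=> [mf hf]; split; first by apply: qmeasM => //; exact: qmeas_cst.
by rewrite N2Ml// lte_mul_pinfty// lee_fin qn2_ge0.
Qed.

Lemma L2Mr (c : H) f : L2 f -> L2 (fun u => f u * c).
Proof.
move=> [mf hf]; split; first by apply: qmeasM => //; exact: qmeas_cst.
by rewrite N2Mr// lte_mul_pinfty// lee_fin qn2_ge0.
Qed.

Lemma N2_le f g : qmeas f -> qmeas g -> (forall u, qn2 (f u) <= qn2 (g u)) ->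
  (N2 f <= N2 g)%E.
Proof.
move=> mf mg fg; apply: ge0_le_integral => //.
- by move=> u _; rewrite lee_fin qn2_ge0.
- exact: emeas_qn2.
- exact: emeas_qn2.
- by move=> u _; rewrite lee_fin.
Qed.

Lemma N2_ae f g : qmeas f -> qmeas g -> {ae mu, forall u, f u = g u} -> N2 f = N2 g.
Proof.
move=> mf mg fg; apply: ge0_ae_eq_integral => //.
- exact: emeas_qn2.
- exact: emeas_qn2.
- by move=> u _; rewrite lee_fin qn2_ge0.
- by move=> u _; rewrite lee_fin qn2_ge0.
- by move: fg; apply: ae_imp => u -> _.
Qed.

Lemma N2_eq0 f : qmeas f -> N2 f = 0%E -> {ae mu, forall u, f u = 0}.
Proof.
move=> mf f0.
have : (\int[mu]_u `|(qn2 (f u))%:E| = 0)%E.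
  by rewrite -[RHS]f0; apply: eq_integral => u _; rewrite gee0_abs ?lee_fin ?qn2_ge0.
move/(ae_eq_integral_abs mu measurableT (emeas_qn2 mf)); apply: ae_imp => u /(_ I) [].
exact: qn2_eq0.
Qed.

Lemma ae_N2_eq0 f : qmeas f -> {ae mu, forall u, f u = 0} -> N2 f = 0%E.
Proof.
move=> mf f0; rewrite (N2_ae mf (qmeas_cst 0) f0) /N2.
by under eq_integral do rewrite qn20; rewrite integral0.
Qed.

Lemma intR_qco_sqr k f : L2 f -> intR (fun u => qco k (f u) ^+ 2).
Proof.
move=> [mf hf]; apply/integrableP; split.
  by apply/measurable_EFinP; apply: measurable_funX; exact: mf.
apply: le_lt_trans hf; apply: ge0_le_integral => //.
- apply: measurableT_comp => //; apply/measurable_EFinP; apply: measurable_funX; exact: mf.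
- exact: emeas_qn2.
- by move=> u _; rewrite /= ger0_norm ?sqr_ge0// lee_fin qco_sqr_le.
Qed.

Lemma N2E f : L2 f -> N2 f = (\int[mu]_u qco 0 (f u) ^+ 2 + \int[mu]_u qco 1 (f u) ^+ 2
  + \int[mu]_u qco 2 (f u) ^+ 2 + \int[mu]_u qco 3 (f u) ^+ 2)%:E.
Proof.
move=> hf; have i k := intR_qco_sqr k hf.
have i01 := intRD (i 0) (i 1); have i2 := intRD i01 (i 2); have i3 := intRD i2 (i 3).
rewrite -RintegralD// -RintegralD// -RintegralD// /Rintegral fineK//.
exact: (integrable_fin_num _ i3).
Qed.

Lemma N2_cvg F (F_ : nat -> R -> H) : L2 F -> (forall n, L2 (F_ n)) ->
  N2 (fun u => F u - F_ n u) @[n --> \oo] --> 0%E ->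
  N2 (F_ n) @[n --> \oo] --> N2 F.
Proof.
move=> hF hF_ d0.
have mF := hF.1; have mF_ n := (hF_ n).1.
have split_le f g (t : R) : 0 < t -> L2 f -> L2 g ->
    fine (N2 g) <= (1 + t) * fine (N2 f) + (1 + t^-1) * fine (N2 (fun u => f u - g u)).
  move=> t0 hf hg; have hfg := L2B hf hg.
  rewrite -lee_fin EFinD !EFinM !fineK ?L2_fin// /N2 -!ge0_integralZl//; last 6 first.
  - exact: emeas_qn2 hfg.1.
  - by move=> u _; rewrite lee_fin qn2_ge0.
  - by rewrite lee_fin addr_ge0 ?invr_ge0 ?ltW.
  - exact: emeas_qn2 hf.1.
  - by move=> u _; rewrite lee_fin qn2_ge0.
  - by rewrite lee_fin addr_ge0 ?ltW.
  rewrite -ge0_integralD//; last 4 first.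
  - by move=> u _; rewrite mule_ge0// lee_fin ?qn2_ge0 ?addr_ge0 ?ltW.
  - by apply: measurable_funeM; exact: emeas_qn2 hf.1.
  - by move=> u _; rewrite mule_ge0// lee_fin ?qn2_ge0 ?addr_ge0 ?invr_ge0 ?ltW.
  - by apply: measurable_funeM; exact: emeas_qn2 hfg.1.
  apply: ge0_le_integral => //.
  - by move=> u _; rewrite lee_fin qn2_ge0.
  - exact: emeas_qn2 hg.1.
  - by apply: emeasurable_funD; apply: measurable_funeM; [exact: emeas_qn2 hf.1|exact: emeas_qn2 hfg.1].
  move=> u _; rewrite -!EFinM -EFinD lee_fin -subr_ge0.
  rewrite (_ : _ - _ = t^-1 * qn2 ((1 + t) *: f u - g u)).
    by rewrite mulr_ge0 ?qn2_ge0 ?invr_ge0 ?ltW.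
  case: (f u) (g u) => [a b c e] [a' b' c' e']; rewrite /qn2 /=.
  by field; rewrite gt_eqF.
rewrite -(fineK (L2_fin hF)); apply: cvg_EFin.
  by apply: nearW => n; exact: L2_fin.
apply/cvgrPdist_le => e e0.
have [A A0] : exists A, A = fine (N2 F) by exists (fine (N2 F)).
have A_ge0 : 0 <= A by rewrite A0 fine_ge0 ?N2_ge0.
(* Chosen so that t A <= e/2; the summand e in the denominator covers A = 0. *)
pose t := e / (2 * (A + e)).
have t0 : 0 < t by rewrite divr_gt0// mulr_gt0// ltr_wpDl.
have tA : t * A <= e / 2.
  rewrite /t mulrAC ler_pdivrMr ?mulr_gt0// ?ltr_wpDl//.
  rewrite (_ : e / 2 * _ = e * (A + e)); last by field.
  by rewrite (ler_wpM2l (ltW e0))// lerDl ltW.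
have c0 : 0 < e / 2 / (1 + t^-1) by rewrite !divr_gt0// addr_gt0// invr_gt0.
have /fine_cvgP[_ /cvgr_lt /(_ _ c0) dn] := d0.
near=> n; have Dn : fine (N2 (fun u => F u - F_ n u)) < e / 2 / (1 + t^-1) by near: n; exact: dn.
have D0 : 0 <= fine (N2 (fun u => F u - F_ n u)) by rewrite fine_ge0 ?N2_ge0.
move: Dn; rewrite ltr_pdivlMr ?addr_gt0 ?invr_gt0// mulrC => Dn.
have h1 := split_le F (F_ n) t t0 hF (hF_ n).
have h2 := split_le (F_ n) F t t0 (hF_ n) hF.
have E : N2 (fun u => F_ n u - F u) = N2 (fun u => F u - F_ n u).
  by rewrite -N2N; apply: eq_integral => u _; rewrite opprB.
rewrite E in h2; rewrite -A0 in h1 h2 *.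
set a := fine (N2 (F_ n)) in h1 h2 *; set d := fine _ in Dn D0 h1 h2.
rewrite ler_distlC /= -/a; apply/andP; split; last first.
  move: h1 Dn tA; rewrite (mulrDl 1 t A) mul1r.
  by move: ((1 + t^-1) * d) (t * A) => x y; lra.
have t1 : 0 < 1 + t by rewrite addr_gt0.
(* Multiplying by 1 + t and using (1 + t)(1 - t) <= 1 reduces this to [h2]. *)
have h3 : A * (1 - t) <= a + t^-1 * d.
  rewrite -(ler_pM2l t1); apply: (@le_trans _ _ A).
    rewrite [leLHS](_ : _ = A - t ^+ 2 * A); last by ring.
    by rewrite gerBl mulr_ge0// sqr_ge0.
  apply: (le_trans h2); rewrite mulrDr; apply: lerD => //.
  by rewrite le_eqVlt; apply/orP; left; apply/eqP; field; rewrite gt_eqF.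
have : t^-1 * d <= (1 + t^-1) * d by rewrite ler_wpM2r// lerDr.
move: h3 Dn tA; rewrite (mulrBr A) mulr1 (mulrC A).
by move: ((1 + t^-1) * d) (t * A) (t^-1 * d) => x y z; lra.
Unshelve. all: by end_near. Qed.

End QuaternionL2.

(** * Completeness of L_2 *)

Section RieszFischer.
Variable R : realType.
Notation H := (quat R).
Notation mu := (@lebesgue_measure R).

Lemma limn_einf_le_cvg (u v : nat -> \bar R) (c : \bar R) :
  (forall m, u m <= v m)%E -> v @ \oo --> c -> (limn_einf u <= c)%E.
Proof.
move=> uv vc; rewrite limn_einf_lim; apply: lime_le; first exact: is_cvg_einfs.
apply: nearW => n; apply: (cvge_ge _ vc); near=> m.
apply: le_trans (uv m); apply: ereal_inf_lbound; exists m => //=.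
by near: m; exists n.
Unshelve. all: by end_near. Qed.

(** From |x| <= 2^-k + 2^k x^2: the weights 2^k turn summability of squares into absolute
    summability of the differences. *)
Lemma cvg_summable_sqr_diff (c : nat -> R) (d : nat -> R) :
  (forall k, (c k.+1 - c k) ^+ 2 <= d k) ->
  (\sum_(k <oo) (2 ^+ k * d k)%:E < +oo)%E -> cvgn c.
Proof.
move=> cd Sd.
have d0 k : 0 <= d k by rewrite (le_trans _ (cd k))// sqr_ge0.
have p0 k : 0 <= 2 ^+ k * d k by rewrite mulr_ge0// exprn_ge0.
pose M := fine (\sum_(k <oo) (2 ^+ k * d k)%:E)%E.
have ME : (M%:E = \sum_(k <oo) (2 ^+ k * d k)%:E)%E.
  rewrite fineK// ge0_fin_numE//; apply: nneseries_ge0 => k _ _.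
  by rewrite lee_fin.
have half n : \sum_(0 <= k < n) (2^-1 : R) ^+ k <= 2.
  suff -> : \sum_(0 <= k < n) (2^-1 : R) ^+ k = 2 - 2 * 2^-1 ^+ n.
    by rewrite gerBl mulr_ge0// exprn_ge0.
  elim: n => [|n IH]; first by rewrite big_nil expr0 mulr1 subrr.
  by rewrite big_nat_recr//= IH exprS; field.
have t_le k : `|telescope c k| <= 2^-1 ^+ k + 2 ^+ k * d k.
  have := cd k; rewrite /telescope /=; set t := c k.+1 - c k => td.
  have x0 : 0 < (2 : R) ^+ k by rewrite exprn_gt0.
  rewrite exprVn; move: (2 ^+ k) x0 => x x0.
  apply: (@le_trans _ _ (x^-1 + x * t ^+ 2)); last by rewrite lerD2l (ler_wpM2l (ltW x0)).
  rewrite -(real_normK (num_real t)); set a := `|t|.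
  have a0 : 0 <= a by rewrite /a normr_ge0.
  rewrite -(ler_pM2l x0) mulrDr mulfV ?gt_eqF//.
  have : 0 <= (x * a - 2^-1) ^+ 2 by rewrite sqr_ge0.
  rewrite (_ : x * (x * a ^+ 2) = (x * a) ^+ 2); last by ring.
  move: (x * a) => y; nra.
have cs : cvgn (series (telescope c)).
  apply: normed_cvg; apply: nondecreasing_is_cvgn.
    by apply: nondecreasing_series => n _ _ /=.
  exists (2 + M) => _ [n _ <-].
  rewrite /series /=; apply: (@le_trans _ _ (\sum_(0 <= k < n) (2^-1 ^+ k + 2 ^+ k * d k))).
    by apply: ler_sum => k _.
  rewrite big_split /= lerD// -lee_fin ME -sumEFin.
  by apply: nneseries_lim_ge => k _ _; rewrite lee_fin.
have -> : c = (fun n => c 0 + series (telescope c) n).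
  by apply/funext => n; exact: eq_sum_telescope.
by apply: is_cvgD => //; exact: is_cvg_cst.
Qed.

(** Along a fast sequence [s] the differences are summable with weights, so the functions converge
    almost everywhere; Fatou then bounds the squared distance from the limit to every [F_ n] by
    [e n], which gives convergence of the whole sequence. *)
Lemma riesz_fischer (F_ : nat -> R -> H) (e : nat -> R) :
  (forall n, L2 (F_ n)) -> e @ \oo --> 0 ->
  (forall n m, N2 (fun u => F_ n u - F_ m u)%R <= (e n + e m)%:E)%E ->
  exists F, L2 F /\ N2 (fun u => F u - F_ n u) @[n --> \oo] --> 0%E.
Proof.
move=> hF e0 cF; have mF n := (hF n).1.
(* The rate 8^-k beats the weight 2^k, leaving terms of order 4^-k. Only [e (s k)] enters the
   bounds, so [s] is chosen freely, without monotonicity. *)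
have /choice [s Hs] : forall k, exists n, e n < 8^-1 ^+ k.
  move=> k; have k0 : 0 < (8^-1 : R) ^+ k by rewrite exprn_gt0.
  have [N _ HN] := cvgr_lt _ e0 _ k0.
  by exists N; exact: (HN N (leqnn N)).
pose D k x := qn2 (F_ (s k.+1) x - F_ (s k) x).
have mD k : measurable_fun setT (fun x => (2 ^+ k * D k x)%:E).
  apply/measurable_EFinP; apply: measurable_funM => //.
  by apply: measurable_qn2; exact: qmeasB.
have D0 k x : 0 <= 2 ^+ k * D k x by rewrite mulr_ge0 ?qn2_ge0// exprn_ge0.
pose S x := (\sum_(k <oo) (2 ^+ k * D k x)%:E)%E.
have S0 x : (0 <= S x)%E by apply: nneseries_ge0 => k _ _; rewrite lee_fin.
have mS : measurable_fun setT S.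
  by apply: ge0_emeasurable_sum => // k x _ _; rewrite lee_fin.
have intS : (\int[mu]_x S x < +oo)%E.
  rewrite integral_nneseries//; last by move=> k x _; rewrite lee_fin.
  apply: (@le_lt_trans _ _ (\sum_(k <oo) (4 / (2 ^ (k + 1))%:R)%:E)%E).
    apply: lee_nneseries => k _.
      by move=> _; apply: integral_ge0 => x _; rewrite lee_fin.
    have := cF (s k.+1) (s k); rewrite /N2 => h.
    have mDk : measurable_fun setT (fun x => (D k x)%:E).
      by apply: emeas_qn2; exact: qmeasB.
    have Dk0 x : [set: R] x -> (0 <= (D k x)%:E)%E by move=> _; rewrite lee_fin qn2_ge0.
    have -> : (\int[mu]_x (2 ^+ k * D k x)%:E = (2 ^+ k)%:E * \int[mu]_x (D k x)%:E)%E.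
      by rewrite -ge0_integralZl// lee_fin exprn_ge0.
    apply: (@le_trans _ _ ((2 ^+ k)%:E * (e (s k.+1) + e (s k))%:E)%E).
      by apply: lee_wpmul2l => //; rewrite lee_fin exprn_ge0.
    rewrite -EFinM lee_fin addn1 natrX exprS.
    have h1 := ltW (Hs k.+1); have h2 := ltW (Hs k).
    have x0 : 0 < (2 : R) ^+ k by rewrite exprn_gt0.
    have -> : 4 / (2 * 2 ^+ k) = 2 * (2 ^+ k)^-1 :> R by field; rewrite gt_eqF.
    have e8 : (8^-1 : R) ^+ k = (2 ^+ k)^-1 ^+ 3.
      by rewrite -exprVn -exprM mulnC exprM; congr (_ ^+ _); field.
    rewrite exprS in h1; rewrite e8 in h1 h2.
    have x1 : 1 <= (2 : R) ^+ k by rewrite exprn_ege1// ler1n.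
    have i1 : (2 ^+ k : R)^-1 <= 1 by rewrite invf_le1.
    have i0 : 0 < (2 ^+ k : R)^-1 by rewrite invr_gt0.
    apply: (@le_trans _ _ (2 ^+ k * (8^-1 * (2 ^+ k)^-1 ^+ 3 + (2 ^+ k)^-1 ^+ 3))).
      by rewrite (ler_wpM2l (ltW x0))// lerD.
    rewrite [leLHS](_ : _ = 9 / 8 * (2 ^+ k)^-1 ^+ 2); last by field; rewrite gt_eqF.
    move: ((2 ^+ k : R)^-1) i0 i1 => y; nra.
  have := @cvg_geometric_eseries_half R 4 0; rewrite expr0 divr1 => h.
  by rewrite (cvg_lim _ h)// ltry.
have Sfin : {ae mu, forall x, (S x < +oo)%E}.
  have : mu.-integrable setT S.
    by apply/integrableP; split => //; under eq_integral do rewrite gee0_abs//.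
  move/integrable_ae => /(_ measurableT); apply: ae_imp => x /(_ I).
  by rewrite ge0_fin_numE.
(* The upper limit is measurable and defined at every point, so no exceptional set is removed;
   [fine] sends infinite values to 0. *)
pose L k x := fine (limn_esup (fun n => (qco k (F_ (s n) x))%:E)).
pose F x := Quat (L 0 x) (L 1 x) (L 2 x) (L 3 x).
have mL k : measurable_fun setT (L k).
  apply: (measurableT_comp (fine_measurable measurableT)).
  by apply: measurable_fun_limn_esup => n; apply/measurable_EFinP; exact: mF.
have mFF : qmeas F by case=> [|[|[|k]]]; exact: mL.
have cv : {ae mu, forall x, forall k, qco k (F_ (s n) x) @[n --> \oo] --> qco k (F x)}.
  apply: ae_imp Sfin => x Sx k.
  have cvk : cvgn (fun n => qco k (F_ (s n) x)).
    apply: (@cvg_summable_sqr_diff _ (D ^~ x)) => // n.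
    by rewrite -qcoB; exact: qco_sqr_le.
  have LE j : cvgn (fun n => qco j (F_ (s n) x)) ->
      qco j (F_ (s n) x) @[n --> \oo] --> L j x.
    move=> /cvg_ex[/= l cl]; suff -> : L j x = l by [].
    have cl' : (qco j (F_ (s n) x))%:E @[n --> \oo] --> l%:E.
      by apply: cvg_EFin => //; exact: nearW.
    by rewrite /L (cvg_limn_einf_sup cl').2.
  by case: k cvk => [|[|[|k]]]; [exact: (LE 0)|exact: (LE 1)|exact: (LE 2)|exact: (LE 3)].
have key n : (N2 (fun u => F u - F_ n u)%R <= (e n)%:E)%E.
  rewrite /N2.
  rewrite (@ge0_ae_eq_integral _ _ _ mu setT _
      (fun x => limn_einf (fun m => (qn2 (F_ (s m) x - F_ n x))%:E)))//.
  - apply: le_trans; first apply: fatou => //.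
    + by move=> m; apply: emeas_qn2; exact: qmeasB.
    + by move=> m x _; rewrite lee_fin qn2_ge0.
    apply: (@limn_einf_le_cvg _ (fun m => (8^-1 ^+ m + e n)%:E)).
      move=> m; apply: le_trans (cF (s m) n) _; rewrite lee_fin lerD2r.
      exact: ltW.
    apply: cvg_EFin; first exact: nearW.
    rewrite -[X in _ --> X]add0r; apply: cvgD; last exact: cvg_cst.
    by apply: cvg_expr; rewrite ger0_norm// invf_lt1// ltr1n.
  - by apply: emeas_qn2; exact: qmeasB.
  - apply: (measurableT_comp (f := oppe)) => //.
    apply: measurable_fun_limn_esup => m; apply: measurableT_comp => //.
    by apply: emeas_qn2; exact: qmeasB.
  - by move=> x _; rewrite lee_fin qn2_ge0.
  - move=> x _; rewrite limn_einf_lim; apply: lime_ge; first exact: is_cvg_einfs.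
    by apply: nearW => k; apply: le_ereal_inf_tmp => _ [m /= _ <-]; rewrite lee_fin qn2_ge0.
  move: cv; apply: ae_imp => x cx _; apply/esym.
  have c k : qco k (F_ (s m) x - F_ n x) ^+ 2 @[m --> \oo] --> qco k (F x - F_ n x) ^+ 2.
    under eq_fun do rewrite qcoB; rewrite qcoB.
    have c1 : qco k (F_ (s m) x) - qco k (F_ n x) @[m --> \oo] --> qco k (F x) - qco k (F_ n x).
      by apply: cvgB; [exact: cx|exact: cvg_cst].
    exact: (cvgM c1 c1).
  have c4 : qn2 (F_ (s m) x - F_ n x) @[m --> \oo] --> qn2 (F x - F_ n x).
    by apply: cvgD; [apply: cvgD; [apply: cvgD; [exact: (c 0)|exact: (c 1)]|exact: (c 2)]|exact: (c 3)].
  have c5 : (qn2 (F_ (s m) x - F_ n x))%:E @[m --> \oo] --> (qn2 (F x - F_ n x))%:E.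
    by apply: cvg_EFin => //; exact: nearW.
  by rewrite (cvg_limn_einf_sup c5).1.
exists F; split.
  split=> //; have -> : F = (fun u => (F u - F_ 0 u) + F_ 0 u).
    by apply/funext => u; rewrite subrK.
  apply: le_lt_trans; first by apply: N2D_le => //; exact: qmeasB.
  rewrite lte_add_pinfty// lte_mul_pinfty//; first by rewrite (le_lt_trans (key 0))// ltry.
  exact: (hF 0).2.
apply: (@squeeze_cvge _ _ _ _ (cst 0%E) _ (fun n => (e n)%:E)).
- by apply: nearW => n; rewrite N2_ge0/= key.
- exact: cvg_cst.
- by apply: cvg_EFin; [exact: nearW|exact: e0].
Qed.

End RieszFischer.

(** * The quaternionic Fourier transform on L_1 and L_2 *)

Section QuaternionFourier.
Variable R : realType.
Notation H := (quat R).
Notation mu := (@lebesgue_measure R).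
Notation intR f := (mu.-integrable setT (EFin \o f)).
Implicit Types f g F G : R -> H.
Variable i : H.
Hypothesis hi : qsphere i.

Lemma qn2_qsphere : qn2 i = 1.
Proof. by have [i0 i1] := qsphereP hi; rewrite /qn2 i0 expr0n add0r. Qed.

Lemma qcoA k (a : R) : qco k (a%:A : H) = a * qco k 1.
Proof. by rewrite qcoZ. Qed.

Lemma qexp_kernel (u y : R) (q : H) : qexp (u *: (y *: i)) * q =
  cos (y * u) *: q + i * (sin (y * u) *: q).
Proof.
by rewrite (qexp_cis _ _ hi) mulrDl -scalerAl mul1r -scalerAl -scalerAr.
Qed.

Lemma qnorm_kernel (u y : R) : qnorm (qexp (u *: (y *: i))) = 1.
Proof.
rewrite (qexp_cis _ _ hi); have [i0 i1] := qsphereP hi.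
rewrite /qnorm -[RHS]sqrtr1 -(cos2Dsin2 (y * u)) -[sin _ ^+ 2]mulr1 -i1 /= i0.
by congr Num.sqrt; ring.
Qed.

Lemma qmeas_kernel (y : R) : qmeas (fun u : R => qexp (u *: (y *: i))).
Proof.
move=> k; under eq_fun do rewrite (qexp_cis _ _ hi) qcoD qcoA qcoZ.
apply: measurable_funD; apply: measurable_funM => //.
  exact: measurable_cosM.
exact: measurable_sinM.
Qed.

Lemma qintg_kernel (y : R) f : qintg mu f -> qintg mu (fun u => qexp (u *: (y *: i)) * f u).
Proof.
move=> hf; have mk : @qmeas R _ (measurableTypeR R) (fun u => qexp (u *: (y *: i))).
  exact: qmeas_kernel.
by apply: (qintgM_bounded (M := 1) mk _ hf) => u; rewrite qnorm_kernel.
Qed.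

Definition qft f (y : R) : H := qintm mu (fun u => qexp (u *: (y *: i)) * f u).

Definition qcosT f (y : R) : H := Quat (fcos (qco 0 \o f) y) (fcos (qco 1 \o f) y)
  (fcos (qco 2 \o f) y) (fcos (qco 3 \o f) y).
Definition qsinT f (y : R) : H := Quat (fsin (qco 0 \o f) y) (fsin (qco 1 \o f) y)
  (fsin (qco 2 \o f) y) (fsin (qco 3 \o f) y).

Lemma qftE f y : qintg mu f -> qft f y = qcosT f y + i * qsinT f y.
Proof.
move=> hf; rewrite /qft.
rewrite (_ : (fun u => _) = (fun u => cos (y * u) *: f u + i * (sin (y * u) *: f u))); last first.
  by apply/funext => u; rewrite qexp_kernel.
have ic : qintg mu (fun u => cos (y * u) *: f u).
  move=> k; have := intR_cosM y (hf k); congr (integrable _ _ _).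
  by apply/funext => u; rewrite /= qcoZ.
have is_ : qintg mu (fun u => sin (y * u) *: f u).
  move=> k; have := intR_sinM y (hf k); congr (integrable _ _ _).
  by apply/funext => u; rewrite /= qcoZ.
rewrite qintD//; last exact: qintgMl.
by rewrite qintMl.
Qed.

Lemma qftD f g y : qintg mu f -> qintg mu g ->
  qft (fun u => f u + g u) y = qft f y + qft g y.
Proof.
move=> hf hg; rewrite /qft -qintD; [|exact: qintg_kernel|exact: qintg_kernel].
by congr qintm; apply/funext => u; rewrite mulrDr.
Qed.

Lemma qftN f y : qintg mu f -> qft (fun u => - f u) y = - qft f y.
Proof.
move=> hf; rewrite /qft -qintN; last exact: qintg_kernel.
by congr qintm; apply/funext => u; rewrite mulrN.
Qed.

(** Right multiplication only: a left factor would have to pass the kernel, with which it need not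
    commute. *)
Lemma qftMr (c : H) f y : qintg mu f -> qft (fun u => f u * c) y = qft f y * c.
Proof.
move=> hf; rewrite /qft -qintMr; last exact: qintg_kernel.
by congr qintm; apply/funext => u; rewrite mulrA.
Qed.

Lemma qmeas_qcosT f : qintg mu f -> qmeas (qcosT f).
Proof.
by move=> hf; case=> [|[|[|k]]]; apply: measurable_fcos;
  [exact: (hf 0)|exact: (hf 1)|exact: (hf 2)|exact: (hf 3)].
Qed.

Lemma qmeas_qsinT f : qintg mu f -> qmeas (qsinT f).
Proof.
by move=> hf; case=> [|[|[|k]]]; apply: measurable_fsin;
  [exact: (hf 0)|exact: (hf 1)|exact: (hf 2)|exact: (hf 3)].
Qed.

Lemma qmeas_qft f : qintg mu f -> qmeas (qft f).
Proof.
move=> hf; rewrite (_ : qft f = (fun y => qcosT f y + i * qsinT f y)); last first.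
  by apply/funext => y; exact: qftE.
apply: qmeasD; first exact: qmeas_qcosT.
by apply: qmeasM; [exact: qmeas_cst|exact: qmeas_qsinT].
Qed.

Lemma fcos_opp (h : R -> R) y : fcos h (- y) = fcos h y.
Proof. by apply: eq_Rintegral => u _; rewrite mulNr cosN. Qed.

Lemma fsin_opp (h : R -> R) y : intR h -> fsin h (- y) = - fsin h y.
Proof.
move=> ih; rewrite -[RHS]mulN1r /fsin -RintegralZl//; last exact: intR_sinM.
by apply: eq_Rintegral => u _; rewrite mulNr sinN mulN1r mulNr.
Qed.

Lemma qft_opp f y : qintg mu f -> qft f (- y) = qcosT f y - i * qsinT f y.
Proof.
move=> hf; have s k := fsin_opp y (hf k).
have s' k : fsin (qco k \o f) (- y) = - fsin (qco k \o f) y := s k.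
rewrite qftE// -mulrN; congr (_ + _ * _); apply: quatP => /=;
  by rewrite ?fcos_opp// s'.
Qed.

(* |F(y)|^2 + |F(-y)|^2 = 2 (|C(y)|^2 + |S(y)|^2) for F = C + i S with C even
   and S odd, which reduces the isometry to real cosine and sine transforms. *)
Theorem qft_plancherel f : qintg mu f -> L2 f ->
  N2 (qft f) = ((2 * pi)%:E * N2 f)%E.
Proof.
move=> hf h2.
have i2 k := intR_qco_sqr k h2.
have en k : energy (qco k \o f) = (2 * pi * \int[mu]_u qco k (f u) ^+ 2)%:E.
  exact: (real_plancherel (hf k) (i2 k)).
pose e k y := fcos (qco k \o f) y ^+ 2 + fsin (qco k \o f) y ^+ 2.
have me k : measurable_fun setT (fun y => (e k y)%:E).
  apply/measurable_EFinP; apply: measurable_funD; apply: measurable_funX.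
    by apply: measurable_fcos; exact: (hf k).
  by apply: measurable_fsin; exact: (hf k).
have e0 k y : (0 <= (e k y)%:E)%E by rewrite lee_fin addr_ge0 ?sqr_ge0.
have mF := emeas_qn2 (qmeas_qft hf).
have me1 : measurable_fun setT (fun y => (e 0 y)%:E + (e 1 y)%:E)%E by exact: emeasurable_funD.
have me2 : measurable_fun setT (fun y => (e 0 y)%:E + (e 1 y)%:E + (e 2 y)%:E)%E.
  exact: emeasurable_funD.
have me3 : measurable_fun setT
    (fun y => (e 0 y)%:E + (e 1 y)%:E + (e 2 y)%:E + (e 3 y)%:E)%E.
  exact: emeasurable_funD.
have e01 y : (0 <= (e 0 y)%:E + (e 1 y)%:E)%E by rewrite adde_ge0.
have e02 y : (0 <= (e 0 y)%:E + (e 1 y)%:E + (e 2 y)%:E)%E by rewrite adde_ge0.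
have e03 y : (0 <= (e 0 y)%:E + (e 1 y)%:E + (e 2 y)%:E + (e 3 y)%:E)%E by rewrite adde_ge0.
have F0 y : (0 <= (qn2 (qft f y))%:E)%E by rewrite lee_fin qn2_ge0.
have mFN : measurable_fun setT (fun y : R => (qn2 (qft f (0 - y)))%:E).
  by apply: (measurableT_comp mF); exact: measurable_funB.
have Q : (N2 (qft f) + N2 (qft f) = 2%:E * ((2 * pi)%:E * N2 f))%E.
  have -> : ((2 * pi)%:E * N2 f = \int[mu]_y ((e 0 y)%:E + (e 1 y)%:E + (e 2 y)%:E + (e 3 y)%:E))%E.
    have I3 : (\int[mu]_y ((e 0 y)%:E + (e 1 y)%:E + (e 2 y)%:E + (e 3 y)%:E) =
      \int[mu]_y ((e 0 y)%:E + (e 1 y)%:E + (e 2 y)%:E) + \int[mu]_y (e 3 y)%:E)%E.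
      by apply: ge0_integralD => //; (exact: me2 || exact: (me 3)).
    have I2 : (\int[mu]_y ((e 0 y)%:E + (e 1 y)%:E + (e 2 y)%:E) =
      \int[mu]_y ((e 0 y)%:E + (e 1 y)%:E) + \int[mu]_y (e 2 y)%:E)%E.
      by apply: ge0_integralD => //; (exact: me1 || exact: (me 2)).
    have I1 : (\int[mu]_y ((e 0 y)%:E + (e 1 y)%:E) =
      \int[mu]_y (e 0 y)%:E + \int[mu]_y (e 1 y)%:E)%E.
      by apply: ge0_integralD => //; (exact: (me 0) || exact: (me 1)).
    have eE k : (\int[mu]_y (e k y)%:E)%E = energy (qco k \o f) by [].
    by rewrite I3 I2 I1 !eE !en N2E// -EFinM !mulrDr.
  rewrite -ge0_integralZl//.
  rewrite {2}/N2 -(integral_reflect 0 mF) -ge0_integralD//.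
  apply: eq_integral => y _; rewrite sub0r qft_opp// qftE// -!EFinD -EFinM; congr EFin.
  rewrite qn2_parallelogram qn2M qn2_qsphere mul1r -mulrDr; congr (_ * _).
  by rewrite /e /qn2 /=; ring.
have f2 : ((2 * pi)%:E * N2 f)%E \is a fin_num by rewrite fin_numM// L2_fin.
rewrite -(fineK f2) in Q *; move: Q; have := N2_ge0 (qft f).
case: (N2 (qft f)) => [r _|_|]//.
move: (fine _) => t; rewrite -EFinD -EFinM => -[] Q; congr EFin; lra.
Qed.

Lemma qft_L2 f : qintg mu f -> L2 f -> L2 (qft f).
Proof.
move=> hf h2; split; first exact: qmeas_qft.
by rewrite qft_plancherel// lte_mul_pinfty ?h2.2// lee_fin mulr_ge0// pi_ge0.
Qed.

(** Truncations of an L_2 function lie in both L_1 and L_2, where [qft] is an integral and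
    multiplies the squared norm by 2 pi. *)
Definition trunc (n : nat) f (u : R) : H := \1_(`[- n%:R, n%:R]) u *: f u.

Lemma qmeas_trunc n f : qmeas f -> qmeas (trunc n f).
Proof. by move=> mf; apply: qmeasZ => //; exact: measurable_indic. Qed.

Lemma qn2Z (a : R) (x : H) : qn2 (a *: x) = a ^+ 2 * qn2 x.
Proof. by rewrite /qn2 /=; ring. Qed.

Lemma indic01 (A : set R) (u : R) : (\1_A u = 0 :> R) \/ (\1_A u = 1 :> R).
Proof. by rewrite indicE; case: (u \in A); [right|left]. Qed.

Lemma qn2_trunc_le n f u : qn2 (trunc n f u) <= qn2 (f u).
Proof.
rewrite /trunc qn2Z; case: (indic01 `[- n%:R, n%:R] u) => ->.
  by rewrite expr0n mul0r qn2_ge0.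
by rewrite expr1n mul1r.
Qed.

Lemma L2_trunc n f : L2 f -> L2 (trunc n f).
Proof.
move=> [mf f2]; split; first exact: qmeas_trunc.
apply: le_lt_trans f2; apply: N2_le => //; first exact: qmeas_trunc.
exact: qn2_trunc_le.
Qed.

(** Gives absolute convergence from square integrability wherever 1 is integrable: on bounded
    intervals and against an L_1 kernel. *)
Lemma qnorm_le_qn2 (x : H) : qnorm x <= 1 + qn2 x.
Proof.
rewrite -qnorm_sqr; have := sqr_ge0 (qnorm x - 2^-1); nra.
Qed.

Lemma intR_qn2 f : L2 f -> intR (fun u => qn2 (f u)).
Proof.
move=> [mf f2]; apply/integrableP; split; first exact: emeas_qn2.
by under eq_integral do rewrite /= ger0_norm ?qn2_ge0//.
Qed.

Lemma qintg_trunc n f : L2 f -> qintg mu (trunc n f).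
Proof.
move=> h2; have mf := h2.1; apply: qintgP; first exact: qmeas_trunc.
have iI : intR (\1_(`[(- n%:R : R), n%:R]) : R -> R).
  exact: (integrable_indic_itv _ _ true false).
have /integrableP[_] := intRD iI (intR_qn2 h2).
apply: le_lt_trans; apply: ge0_le_integral => //.
- by move=> u _; rewrite lee_fin qnorm_ge0.
- by apply/measurable_EFinP; apply: measurable_qnorm; exact: qmeas_trunc.
- apply: measurableT_comp => //; apply/measurable_EFinP; apply: measurable_funD.
    exact: measurable_indic.
  exact: measurable_qn2.
move=> u _; rewrite /= lee_fin; apply: le_trans (ler_norm _).
rewrite /trunc; case: (indic01 `[- n%:R, n%:R] u) => ->.
  rewrite scale0r add0r (_ : qnorm 0 = 0) ?qn2_ge0//.
  by rewrite /qnorm /= !expr0n !addr0 sqrtr0.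
by rewrite scale1r qnorm_le_qn2.
Qed.

Lemma qint_trunc n f y : qint `[- n%:R, n%:R] (fun u => qexp (u *: (y *: i)) * f u) =
  qft (trunc n f) y.
Proof.
have E u : qexp (u *: (y *: i)) * trunc n f u =
    \1_(`[- n%:R, n%:R]) u *: (qexp (u *: (y *: i)) * f u) by rewrite -scalerAr.
apply: qcoP => k; rewrite qco_qint.
have -> g : qco k (qint `[- n%:R, n%:R] g) = \int[mu]_(u in `[- n%:R, n%:R]) qco k (g u).
  by case: k => [|[|[|k]]].
rewrite Rintegral_mkcond; apply: eq_Rintegral => u _.
by rewrite E patchE qcoZ indicE; case: ifP => _ /=; rewrite ?mul1r ?mul0r.
Qed.

(** Stated through strict upper bounds, convergence to 0 passes easily through the square root that
    separates [qLnorm] from [N2]. *)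
Lemma cvge0_nneg (u : nat -> \bar R) : (forall n, 0 <= u n)%E ->
  (u @ \oo --> 0%E) <-> (forall e : R, 0 < e -> \forall n \near \oo, (u n < e%:E)%E).
Proof.
move=> u0; split.
  move=> /fine_cvgP[fu cu] e e0; near=> n.
  have fn : u n \is a fin_num by near: n.
  by rewrite -(fineK fn) lte_fin; near: n; exact: (cvgr_lt _ cu).
move=> h; apply/fine_cvgP; split.
  have := h 1 ltr01; apply: filterS => n un.
  by rewrite ge0_fin_numE// (lt_trans un)// ltry.
apply/cvgrPdist_lt => e e0; near=> n.
have un : (u n < e%:E)%E by near: n; exact: h.
have fn : u n \is a fin_num by rewrite ge0_fin_numE// (lt_trans un)// ltry.
rewrite sub0r normrN ger0_norm ?fine_ge0//.
by rewrite -lte_fin fineK.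
Unshelve. all: by end_near. Qed.

Lemma poweR_half_lt (x : \bar R) (e : R) : (0 <= x)%E -> 0 < e ->
  (x `^ 2^-1 < e%:E)%E = (x < (e ^+ 2)%:E)%E.
Proof.
move=> x0 e0; rewrite poweR12_sqrt//; case: x x0 => [r| |]//.
rewrite lee_fin /= => r0; rewrite !lte_fin -[in LHS](ger0_norm (ltW e0)) -sqrtr_sqr.
by rewrite ltr_sqrt// exprn_gt0.
Qed.

Lemma is_fourier2P f F : is_fourier2 i f F <->
  L2 F /\ N2 (fun y => F y - qft (trunc n f) y) @[n --> \oo] --> 0%E.
Proof.
rewrite /is_fourier2 qLp2P.
have E n : (fun y => F y - qint `[- n%:R, n%:R] (fun u => qexp (u *: (y *: i)) * f u)) =
     (fun y => F y - qft (trunc n f) y).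
  by apply/funext => y; congr (_ - _); exact: qint_trunc.
have -> : (fun n : nat => qLnorm 2%:E (fun y => F y -
     qint `[- n%:R, n%:R] (fun u => qexp (u *: (y *: i)) * f u))) =
   (fun n => N2 (fun y => F y - qft (trunc n f) y)%R `^ 2^-1)%E.
  by apply/funext => n; rewrite E qLnorm2E.
split=> -[hF c]; split => //.
  apply/cvge0_nneg => [n|e e0]; first exact: N2_ge0.
  move/cvge0_nneg : c => /(_ (fun n => poweR_ge0 _ _)) /(_ (Num.sqrt e)).
  rewrite sqrtr_gt0 => /(_ e0); apply: filterS => n.
  by rewrite poweR_half_lt ?N2_ge0 ?sqrtr_gt0// sqr_sqrtr// ltW.
apply/cvge0_nneg => [n|e e0]; first exact: poweR_ge0.
move/cvge0_nneg : c => /(_ (fun n => N2_ge0 _)) /(_ (e ^+ 2)).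
by rewrite exprn_gt0// => /(_ isT); apply: filterS => n; rewrite poweR_half_lt ?N2_ge0.
Qed.

Lemma N2_trunc_cvg f : L2 f -> N2 (fun u => f u - trunc n f u) @[n --> \oo] --> 0%E.
Proof.
move=> h2; have mf := h2.1.
have [] // := @dominated_convergence _ _ _ mu setT measurableT
  (fun n u => (qn2 (f u - trunc n f u))%:E) (cst 0%E) (fun u => (qn2 (f u))%:E).
- by move=> n; apply: emeas_qn2; apply: qmeasB => //; exact: qmeas_trunc.
- apply: ae_all => u _; apply: cvg_near_cst; near=> n.
  rewrite /trunc indicE mem_set ?scale1r ?subrr ?qn20//=.
  by rewrite in_itv/= -ler_norml; near: n; exact: nbhs_infty_ger.
- exact: intR_qn2.
- apply: ae_all => u n _; rewrite gee0_abs ?lee_fin ?qn2_ge0//.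
  rewrite /trunc; case: (indic01 `[- n%:R, n%:R] u) => ->.
    by rewrite scale0r subr0.
  by rewrite scale1r subrr qn20 qn2_ge0.
by rewrite /N2 integral0.
Unshelve. all: by end_near. Qed.

Theorem fourier2_exists f : L2 f -> exists F, is_fourier2 i f F.
Proof.
move=> h2; have ht n := L2_trunc n h2; have h1 n := qintg_trunc n h2.
have hd n : L2 (fun u => f u - trunc n f u) by exact: L2B.
(* The isometry contributes 2 pi, and |x - y|^2 <= 2 |x|^2 + 2 |y|^2 a further factor 2. *)
pose e n := 4 * pi * fine (N2 (fun u => f u - trunc n f u)).
have [||n m|F [hF cF]] := @riesz_fischer R (fun n => qft (trunc n f)) e.
- by move=> n; exact: qft_L2.
- rewrite -(mulr0 (4 * pi)); apply: cvgM; first exact: cvg_cst.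
  by have /fine_cvgP[] := N2_trunc_cvg h2.
- have -> : (fun u => qft (trunc n f) u - qft (trunc m f) u) =
      qft (fun u => trunc n f u - trunc m f u).
    apply/funext => y; rewrite qftD//; last exact: qintgN.
    by rewrite qftN.
  rewrite qft_plancherel; last 2 first.
  - by apply: qintgD => //; exact: qintgN.
  - exact: L2B.
  have -> : (fun u => trunc n f u - trunc m f u) =
      (fun u => (f u - trunc m f u) - (f u - trunc n f u)).
    by apply/funext => u; rewrite opprB [RHS]addrC addrA subrK.
  apply: (@le_trans _ _ ((2 * pi)%:E * (2%:E * N2 (fun u => f u - trunc m f u)%R
     + 2%:E * N2 (fun u => f u - trunc n f u)%R))%E).
    apply: lee_wpmul2l; first by rewrite lee_fin mulr_ge0// pi_ge0.
    by apply: N2B_le; [exact: (hd m).1|exact: (hd n).1].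
  rewrite -(fineK (L2_fin (hd m))) -(fineK (L2_fin (hd n))) /e.
  set a := fine _; set b := fine _.
  rewrite [leLHS](_ : _ = (2 * pi * (2 * a + 2 * b))%:E)// lee_fin.
  by rewrite le_eqVlt; apply/orP; left; apply/eqP; ring.
by exists F; apply/is_fourier2P; split.
Qed.

(** Passes to the limit in the isometry for truncations, both squared norms being continuous under
    L_2 convergence. *)
Theorem fourier2_isometry f F : L2 f -> is_fourier2 i f F ->
  N2 F = ((2 * pi)%:E * N2 f)%E.
Proof.
move=> h2 /is_fourier2P[hF cF].
have ht n := L2_trunc n h2; have h1 n := qintg_trunc n h2.
have c1 := N2_cvg hF (fun n => qft_L2 (h1 n) (ht n)) cF.
have c2 := N2_cvg h2 ht (N2_trunc_cvg h2).
have E : (fun n => N2 (qft (trunc n f))) = (fun n => (2 * pi)%:E * N2 (trunc n f))%E.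
  by apply/funext => n; rewrite qft_plancherel.
have c3 : N2 (qft (trunc n f)) @[n --> \oo] --> ((2 * pi)%:E * N2 f)%E.
  by rewrite E; exact: cvgeZl.
exact: (cvg_unique _ c1 c3).
Qed.

Lemma fourier2_fun f : L2 f -> is_fourier2 i f (fourier2 i f).
Proof.
move=> h2; have [F hF] := fourier2_exists h2.
exact: (getPex (ex_intro (is_fourier2 i f) F hF)).
Qed.

Lemma fourier2D f g F G : L2 f -> L2 g -> is_fourier2 i f F -> is_fourier2 i g G ->
  is_fourier2 i (fun u => f u + g u) (fun y => F y + G y).
Proof.
move=> hf hg /is_fourier2P[hF cF] /is_fourier2P[hG cG]; apply/is_fourier2P.
split; first exact: L2D.
have h1 n := qintg_trunc n hf; have h1' n := qintg_trunc n hg.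
have E n : (fun y => F y + G y - qft (trunc n (fun u => f u + g u)) y) =
    (fun y => (F y - qft (trunc n f) y) + (G y - qft (trunc n g) y)).
  have T : trunc n (fun u => f u + g u) = (fun u => trunc n f u + trunc n g u).
    by apply/funext => u; rewrite /trunc scalerDr.
  by apply/funext => y; rewrite T (qftD y (h1 n) (h1' n)) opprD addrACA.
under eq_fun do rewrite E.
apply: (@squeeze_cvge _ _ _ _ (cst 0%E) _ (fun n =>
   2%:E * N2 (fun y => F y - qft (trunc n f) y)%R + 2%:E * N2 (fun y => G y - qft (trunc n g) y)%R)%E).
- apply: nearW => n; rewrite N2_ge0/= N2D_le//.
    by apply: qmeasB; [exact: hF.1|exact: qmeas_qft].
  by apply: qmeasB; [exact: hG.1|exact: qmeas_qft].
- exact: cvg_cst.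
- have z (u : nat -> \bar R) : u @ \oo --> 0%E -> (fun n => 2%:E * u n)%E @ \oo --> 0%E.
    by move=> cu; rewrite -(mule0 2%:E); exact: cvgeZl.
  by have := cvgeD _ (z _ cF) (z _ cG); rewrite adde0; apply.
Qed.

Lemma fourier2Mr (c : H) f F : L2 f -> is_fourier2 i f F ->
  is_fourier2 i (fun u => f u * c) (fun y => F y * c).
Proof.
move=> hf /is_fourier2P[hF cF]; apply/is_fourier2P; split; first exact: L2Mr.
have h1 n := qintg_trunc n hf.
have E n : N2 (fun y => F y * c - qft (trunc n (fun u => f u * c)) y) =
    ((qn2 c)%:E * N2 (fun y => F y - qft (trunc n f) y)%R)%E.
  rewrite -N2Mr; last by apply: qmeasB; [exact: hF.1|exact: qmeas_qft].
  have T : trunc n (fun u => f u * c) = (fun u => trunc n f u * c).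
    by apply/funext => u; rewrite /trunc scalerAl.
  by congr N2; apply/funext => y; rewrite T (qftMr c y (h1 n)) mulrBl.
have cZ : ((qn2 c)%:E * N2 (fun y => F y - qft (trunc n f) y)%R)%E @[n --> \oo] -->
    ((qn2 c)%:E * 0)%E by exact: cvgeZl.
by under eq_fun do rewrite E; rewrite mule0 in cZ.
Qed.

Lemma fourier2N f F : L2 f -> is_fourier2 i f F ->
  is_fourier2 i (fun u => - f u) (fun y => - F y).
Proof.
move=> hf /(fourier2Mr (-1) hf).
by under eq_fun do rewrite mulrN1; under [X in is_fourier2 _ _ X]eq_fun do rewrite mulrN1.
Qed.

Lemma fourier2B f g F G : L2 f -> L2 g -> is_fourier2 i f F -> is_fourier2 i g G ->
  is_fourier2 i (fun u => f u - g u) (fun y => F y - G y).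
Proof. by move=> hf hg hF hG; exact: (fourier2D hf (L2N hg) hF (fourier2N hg hG)). Qed.

Lemma fourier2_L2 f F : is_fourier2 i f F -> L2 F.
Proof. by move=> /is_fourier2P[]. Qed.

(** The isometry applied to the difference; [fourier2_unique] reads it in the other direction. *)
Lemma fourier2_inj f g F G : L2 f -> L2 g -> is_fourier2 i f F -> is_fourier2 i g G ->
  {ae mu, forall y, F y = G y} -> {ae mu, forall u, f u = g u}.
Proof.
move=> hf hg hF hG FG.
have hd := L2B hf hg; have hD := fourier2B hf hg hF hG.
have N0 : N2 (fun y => F y - G y) = 0%E.
  apply: ae_N2_eq0; first exact: (fourier2_L2 hD).1.
  by move: FG; apply: ae_imp => y ->; rewrite subrr.
have := fourier2_isometry hd hD; rewrite N0 => /esym/eqP.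
rewrite mule_eq0 eqe mulf_eq0 pnatr_eq0/= gt_eqF ?pi_gt0//= => /eqP d0.
by have := N2_eq0 hd.1 d0; apply: ae_imp => u /eqP; rewrite subr_eq0 => /eqP.
Qed.

Lemma fourier2_unique f g F G : L2 f -> L2 g -> is_fourier2 i f F -> is_fourier2 i g G ->
  {ae mu, forall u, f u = g u} -> {ae mu, forall y, F y = G y}.
Proof.
move=> hf hg hF hG fg.
have hd := L2B hf hg; have hD := fourier2B hf hg hF hG.
have N0 : N2 (fun u => f u - g u) = 0%E.
  by apply: ae_N2_eq0; [exact: hd.1|move: fg; apply: ae_imp => y ->; rewrite subrr].
have := fourier2_isometry hd hD; rewrite N0 mule0 => d0.
by have := N2_eq0 (fourier2_L2 hD).1 d0; apply: ae_imp => u /eqP; rewrite subr_eq0 => /eqP.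
Qed.

Lemma fourier2_aer f F G : qmeas G -> is_fourier2 i f F ->
  {ae mu, forall y, F y = G y} -> L2 f -> is_fourier2 i f G.
Proof.
move=> mG /is_fourier2P[hF cF] FG hf; apply/is_fourier2P; split.
  by split => //; rewrite -(N2_ae hF.1 mG FG); exact: hF.2.
rewrite (_ : (fun n => _) = (fun n => N2 (fun y => F y - qft (trunc n f) y)))//.
apply/funext => n; have mt := qmeas_qft (qintg_trunc n hf).
apply: N2_ae; [exact: qmeasB|exact: qmeasB hF.1 mt|].
by move: FG; apply: ae_imp => y ->.
Qed.

Lemma fourier2_ael f g F : L2 f -> L2 g -> is_fourier2 i f F ->
  {ae mu, forall u, f u = g u} -> is_fourier2 i g F.
Proof.
move=> hf hg hF fg; have hG := fourier2_fun hg.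
apply: (fourier2_aer (fourier2_L2 hF).1 hG _ hg).
apply: (fourier2_unique hg hf hG hF).
by move: fg; apply: ae_imp => u ->.
Qed.

End QuaternionFourier.

(** * Convolution of L_1 functions with L_1 and L_2 functions *)

Section Convolution.
Variable R : realType.
Notation H := (quat R).
Notation mu := (@lebesgue_measure R).
Notation intR f := (mu.-integrable setT (EFin \o f)).
Implicit Types f g phi psi : R -> H.

Lemma ae_affine (a b : R) (P : R -> Prop) : a != 0 ->
  {ae mu, forall x, P x} -> {ae mu, forall x, P (a * x + b)}.
Proof.
move=> a0 [N [mN N0 PN]]; exists ((fun x => a * x + b) @^-1` N); split.
- by rewrite -[X in measurable X]setTI; apply: measurable_affine.
- have := lebesgue_measure_affine b a0 mN.
  rewrite N0 => /esym/eqP; rewrite mule_eq0 eqe normr_eq0 (negbTE a0)/= => /eqP.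
  by [].
- by move=> x /= nP; apply: PN.
Qed.

Lemma ae_reflect (b : R) (P : R -> Prop) :
  {ae mu, forall x, P x} -> {ae mu, forall x, P (b - x)}.
Proof.
have a0 : (-1 : R) != 0 by rewrite oppr_eq0 oner_eq0.
by move=> /(ae_affine b a0); apply: ae_imp => x; rewrite mulN1r addrC.
Qed.

Lemma ae_shift (b : R) (P : R -> Prop) :
  {ae mu, forall x, P x} -> {ae mu, forall x, P (x + b)}.
Proof. by move=> /(ae_affine b (oner_neq0 R)); apply: ae_imp => x; rewrite mul1r. Qed.

Lemma qint_ae f g : qmeas f -> qmeas g -> {ae mu, forall u, f u = g u} ->
  qintm mu f = qintm mu g.
Proof.
move=> mf mg fg; apply: qcoP => k; rewrite !qco_qint /Rintegral; congr fine.
apply: ae_eq_integral => //.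
- by apply/measurable_EFinP; exact: mf.
- by apply/measurable_EFinP; exact: mg.
- by move: fg; apply: ae_imp => u -> _.
Qed.

(** The crude factor 4, one per coordinate, is harmless: the estimate serves finiteness and
    boundedness only. *)
Lemma qnorm_qint f : qintg mu f -> qnorm (qintm mu f) <= 4 * \int[mu]_u qnorm (f u).
Proof.
move=> hf; apply: (le_trans (qnorm_le _)).
have h k : `|qco k (qintm mu f)| <= \int[mu]_u qnorm (f u).
  rewrite qco_qint; apply: (le_trans (le_normr_Rintegral _ (hf k))) => //.
  apply: le_Rintegral => //; first exact: (integrable_norm (hf k)).
    exact: qintg_norm.
  by move=> u _; exact: qco_le.
have := (h 0, h 1, h 2, h 3) => -[[[]]]; lra.
Qed.

(** The inner integrals converge absolutely for almost every value; elsewhere [fine] may replace an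
    infinite value by 0, on a null set that the outer integral ignores. *)
Lemma qFubini (g : R * R -> H) : qintg (mu \x mu)%E g ->
  qintm mu (fun w => qintm mu (fun v => g (w, v))) =
  qintm mu (fun v => qintm mu (fun w => g (w, v))).
Proof.
move=> hg; apply: qcoP => k; rewrite !qco_qint /Rintegral; congr fine.
have hk : (mu \x mu)%E.-integrable setT (fun p => (qco k (g p))%:E) by exact: (hg k).
have F := Fubini hk.
transitivity (\int[mu]_w \int[mu]_v (qco k (g (w, v)))%:E)%E.
  apply: ae_eq_integral => //.
  - apply/measurable_EFinP; under eq_fun do rewrite qco_qint.
    exact: (measurable_Rintegral2 (k := fun p => qco k (g p))) (qintg_meas hg k).
  - apply: (measurable_integral2 (k := fun p => (qco k (g p))%:E)).
    exact: measurable_int hk.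
  have := ae_integrable1 hk; apply: ae_imp => w iw _.
  by rewrite qco_qint /Rintegral fineK//; exact: integrable_fin_num.
rewrite F; apply: ae_eq_integral => //.
- apply: (measurable_integral2 (k := fun p => (qco k (g (p.2, p.1)))%:E)).
  apply: (measurableT_comp (f := fun p => (qco k (g p))%:E)); first exact: measurable_int hk.
  by apply/measurable_fun_pair; [exact: measurable_snd|exact: measurable_fst].
- apply/measurable_EFinP; under eq_fun do rewrite qco_qint.
  apply: (measurable_Rintegral2 (k := fun p => qco k (g (p.2, p.1)))).
  exact: measurable_swap_fun (qintg_meas hg k).
have := ae_integrable2 hk; apply: ae_imp => v iv _.
by rewrite qco_qint /Rintegral fineK//; exact: integrable_fin_num.
Qed.

Lemma qmeas_subp phi : qmeas phi -> qmeas (fun p : R * R => phi (p.1 - p.2)).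
Proof. by move=> h k; exact: measurableT_comp (h k) (measurable_funB _ _). Qed.

Lemma qmeas_sub (u : R) phi : qmeas phi -> qmeas (fun v : R => phi (u - v)).
Proof. by move=> h; apply: (qmeas_comp _ h); exact: measurable_funB. Qed.

Lemma qmeas_conv_kernel phi f : qmeas phi -> qmeas f ->
  qmeas (fun p : R * R => phi (p.1 - p.2) * f p.2).
Proof.
move=> hp hf; apply: qmeasM; first exact: qmeas_subp.
exact: (qmeas_comp measurable_snd hf).
Qed.

Lemma qconvE phi f u : qconv phi f u = qintm mu (fun v => phi (u - v) * f v).
Proof. by []. Qed.

Lemma qmeas_conv_fun phi f u : qmeas phi -> qmeas f ->
  qmeas (fun v : R => phi (u - v) * f v).
Proof. by move=> hp hf; apply: qmeasM => //; exact: qmeas_sub. Qed.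

Lemma qmeas_conv phi f : qmeas phi -> qmeas f -> qmeas (qconv phi f).
Proof.
move=> hp hf k; have := qmeas_conv_kernel hp hf k.
move=> /(measurable_Rintegral2 (k := fun p => qco k (phi (p.1 - p.2) * f p.2))).
by under [X in _ -> measurable_fun _ X]eq_fun do rewrite qconvE qco_qint.
Qed.

Lemma qconv_ael phi phi' f u : qmeas phi -> qmeas phi' -> qmeas f ->
  {ae mu, forall v, phi v = phi' v} -> qconv phi f u = qconv phi' f u.
Proof.
move=> m1 m2 mf h; apply: qint_ae; [exact: qmeas_conv_fun|exact: qmeas_conv_fun|].
by have := ae_reflect u h; apply: ae_imp => v ->.
Qed.

Lemma qconv_aer phi f f' u : qmeas phi -> qmeas f -> qmeas f' ->
  {ae mu, forall v, f v = f' v} -> qconv phi f u = qconv phi f' u.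
Proof.
move=> m1 m2 mf h; apply: qint_ae; [exact: qmeas_conv_fun|exact: qmeas_conv_fun|].
by move: h; apply: ae_imp => v ->.
Qed.

Lemma qconv_shift phi f (t u : R) : qmeas phi -> qmeas f ->
  qconv phi (fun v => f (v - t)) u = qconv phi f (u - t).
Proof.
move=> hp hf; rewrite !qconvE; apply: qcoP => k; rewrite !qco_qint /Rintegral; congr fine.
have m : measurable_fun setT (fun v : R => (qco k (phi (u - t - v) * f v))%:E).
  by apply/measurable_EFinP; exact: qmeas_conv_fun.
rewrite -(integral_shift (- t) m); apply: eq_integral => v _.
by rewrite (_ : u - t - (v - t) = u - v)//; ring.
Qed.

Definition nconv phi f (u : R) : \bar R :=
  (\int[mu]_v ((qnorm (phi (u - v)))%:E * (qnorm (f v))%:E))%E.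

Lemma qintg_conv phi f u : qmeas phi -> qmeas f -> (nconv phi f u < +oo)%E ->
  qintg mu (fun v => phi (u - v) * f v).
Proof.
move=> hp hf; rewrite /nconv => h; apply: qintgP; first exact: qmeas_conv_fun.
by under eq_integral do rewrite qnormM EFinM.
Qed.

Let emeas_qnorm f : qmeas f -> measurable_fun setT (fun u => (qnorm (f u))%:E).
Proof. by move=> h; apply/measurable_EFinP; exact: measurable_qnorm. Qed.

Let L1norm f : qintg mu f -> (\int[mu]_u (qnorm (f u))%:E < +oo)%E.
Proof.
move=> /qintg_norm/integrableP[_]; rewrite /=.
by under eq_integral do rewrite ger0_norm ?qnorm_ge0//.
Qed.

Lemma ae_fin (h : R -> \bar R) : measurable_fun setT h -> (forall x, 0 <= h x)%E ->
  (\int[mu]_x h x < +oo)%E -> {ae mu, forall x, (h x < +oo)%E}.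
Proof.
move=> mh h0 hoo.
have : mu.-integrable setT h.
  by apply/integrableP; split => //; under eq_integral do rewrite gee0_abs//.
move/integrable_ae => /(_ measurableT); apply: ae_imp => x /(_ I).
by rewrite ge0_fin_numE.
Qed.

(** Applied to nonnegative functions, where it makes sense at every point and its finiteness
    certifies absolute convergence of the quaternionic convolution. *)
Definition econv (a b : R -> \bar R) (u : R) : \bar R := (\int[mu]_v (a (u - v)%R * b v))%E.

Lemma econv_ge0 a b u : (forall x, 0 <= a x)%E -> (forall x, 0 <= b x)%E -> (0 <= econv a b u)%E.
Proof. by move=> a0 b0; apply: integral_ge0 => v _; rewrite mule_ge0. Qed.

Lemma measurable_econv a b : measurable_fun setT a -> measurable_fun setT b ->
  measurable_fun setT (econv a b).
Proof.
move=> ma mb; apply: (measurable_integral2 (k := fun p => a (p.1 - p.2)%R * b p.2)%E).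
apply: emeasurable_funM; first exact: measurable_subp.
exact: (measurableT_comp mb).
Qed.

Let measurable_econv_fun (a b : R -> \bar R) u : measurable_fun setT a -> measurable_fun setT b ->
  measurable_fun setT (fun v : R => a (u - v)%R * b v)%E.
Proof.
move=> ma mb; apply: emeasurable_funM => //; apply: (measurableT_comp ma).
exact: measurable_funB.
Qed.

Lemma integral_econv a b : measurable_fun setT a -> measurable_fun setT b ->
  (forall x, 0 <= a x)%E -> (forall x, 0 <= b x)%E ->
  (\int[mu]_u econv a b u = \int[mu]_u a u * \int[mu]_u b u)%E.
Proof. exact: tonelli_conv. Qed.

Lemma econv_le (a b c : R -> \bar R) u : measurable_fun setT a -> measurable_fun setT b ->
  measurable_fun setT c -> (forall x, 0 <= a x)%E -> (forall x, 0 <= b x)%E ->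
  (forall x, b x <= c x)%E -> (econv a b u <= econv a c u)%E.
Proof.
move=> ma mb mc a0 b0 bc; apply: ge0_le_integral => //.
- by move=> v _; rewrite mule_ge0.
- exact: measurable_econv_fun.
- exact: measurable_econv_fun.
- by move=> v _; rewrite lee_wpmul2l.
Qed.

Lemma econvD (a b c : R -> \bar R) u : measurable_fun setT a -> measurable_fun setT b ->
  measurable_fun setT c -> (forall x, 0 <= a x)%E -> (forall x, 0 <= b x)%E ->
  (forall x, 0 <= c x)%E -> (econv a (fun v => b v + c v) u = econv a b u + econv a c u)%E.
Proof.
move=> ma mb mc a0 b0 c0; rewrite /econv -ge0_integralD//.
- by apply: eq_integral => v _; rewrite ge0_muleDr.
- by move=> v _; rewrite mule_ge0.
- exact: measurable_econv_fun.
- by move=> v _; rewrite mule_ge0.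
- exact: measurable_econv_fun.
Qed.

Lemma econv_cst (a : R -> \bar R) (c : R) u : measurable_fun setT a -> (forall x, 0 <= a x)%E ->
  0 <= c -> (econv a (cst c%:E) u = \int[mu]_v a v * c%:E)%E.
Proof.
move=> ma a0 c0; rewrite /econv ge0_integralZr//.
- by rewrite integral_reflect.
- by apply: (measurableT_comp ma); exact: measurable_funB.
Qed.

Let nn phi u := (qnorm (phi u))%:E.
Let sq f (u : R) := (qn2 (f u))%:E.

Let nn0 phi u : (0 <= nn phi u)%E. Proof. by rewrite lee_fin qnorm_ge0. Qed.
Let sq0 phi u : (0 <= sq phi u)%E. Proof. by rewrite lee_fin qn2_ge0. Qed.

(** From |f| <= 1 + |f|^2, since convolving a with 1 gives its integral. *)
Lemma econv_L2_le (a : R -> \bar R) f u : measurable_fun setT a -> (forall x, 0 <= a x)%E ->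
  qmeas f -> (econv a (nn f) u <= \int[mu]_v a v + econv a (sq f) u)%E.
Proof.
move=> ma a0 mf.
apply: (@le_trans _ _ (econv a (fun v => (cst 1%:E) v + sq f v)%E u)).
  apply: econv_le => //; first exact: emeas_qnorm.
    by apply: emeasurable_funD => //; exact: emeas_qn2.
  by move=> x; rewrite /nn /sq -EFinD lee_fin qnorm_le_qn2.
rewrite econvD//; last exact: emeas_qn2.
by rewrite econv_cst// mule1.
Qed.

Lemma ae_econv_sq phi f : qintg mu phi -> L2 f ->
  {ae mu, forall u, (econv (nn phi) (sq f) u < +oo)%E}.
Proof.
move=> hp h2; have mp := qintg_meas hp.
apply: ae_fin; first by apply: measurable_econv; [exact: emeas_qnorm|exact: emeas_qn2 h2.1].
  by move=> u; exact: econv_ge0.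
rewrite integral_econv//; [|exact: emeas_qnorm|exact: emeas_qn2 h2.1].
rewrite lte_mul_pinfty ?integral_ge0 ?ge0_fin_numE ?integral_ge0 ?L1norm//.
exact: h2.2.
Qed.

Lemma ae_qintg_conv2 phi f : qintg mu phi -> L2 f ->
  {ae mu, forall u, qintg mu (fun v => phi (u - v) * f v)}.
Proof.
move=> hp h2; have mp := qintg_meas hp; have := ae_econv_sq hp h2.
apply: ae_imp => u hu; apply: qintg_conv => //; first exact: h2.1.
apply: le_lt_trans (econv_L2_le u (emeas_qnorm mp) (nn0 phi) h2.1) _.
by rewrite lte_add_pinfty// L1norm.
Qed.

Lemma ae_qintg_conv1 phi f : qintg mu phi -> qintg mu f ->
  {ae mu, forall u, qintg mu (fun v => phi (u - v) * f v)}.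
Proof.
move=> hp hf; have mp := qintg_meas hp; have mf := qintg_meas hf.
have : {ae mu, forall u, (econv (nn phi) (nn f) u < +oo)%E}.
  apply: ae_fin; first by apply: measurable_econv; exact: emeas_qnorm.
    by move=> u; exact: econv_ge0.
  rewrite integral_econv//; [|exact: emeas_qnorm|exact: emeas_qnorm].
  by rewrite lte_mul_pinfty ?integral_ge0 ?ge0_fin_numE ?integral_ge0 ?L1norm.
by apply: ae_imp => u hu; exact: qintg_conv.
Qed.

Lemma qintg_qconv phi f : qintg mu phi -> qintg mu f -> qintg mu (qconv phi f).
Proof.
move=> hp hf; have mp := qintg_meas hp; have mf := qintg_meas hf.
apply: qintgP; first exact: qmeas_conv.
apply: (@le_lt_trans _ _ (\int[mu]_u (4%:E * econv (nn phi) (nn f) u))%E).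
  have mq := emeas_qnorm (qmeas_conv mp mf).
  have me := measurable_econv (emeas_qnorm mp) (emeas_qnorm mf).
  have me4 := measurable_funeM 4%:E me.
  have e0 x : (0 <= 4%:E * econv (nn phi) (nn f) x)%E by rewrite mule_ge0// econv_ge0.
  have q0 x : (0 <= (qnorm (qconv phi f x))%:E)%E by rewrite lee_fin qnorm_ge0.
  apply: ae_ge0_le_integral => //.
  have := ae_qintg_conv1 hp hf; apply: ae_imp => u hu _.
  have i := qintg_norm hu.
  rewrite (_ : econv _ _ _ = (\int[mu]_v qnorm (phi (u - v) * f v))%:E).
    by rewrite -EFinM lee_fin; exact: qnorm_qint.
  rewrite /Rintegral fineK; last exact: (integrable_fin_num _ i).
  by apply: eq_integral => v _; rewrite qnormM EFinM.
rewrite ge0_integralZl//; last 2 first.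
- by apply: measurable_econv; exact: emeas_qnorm.
- by move=> u _; exact: econv_ge0.
rewrite integral_econv//; [|exact: emeas_qnorm|exact: emeas_qnorm].
rewrite lte_mul_pinfty ?mule_ge0 ?integral_ge0//.
by rewrite lte_mul_pinfty ?integral_ge0 ?ge0_fin_numE ?integral_ge0 ?L1norm.
Qed.

(** A quadratic polynomial in t that is nonnegative has nonpositive discriminant. If [al = 0] and Y
    is nonzero, its value at t = (X + 1)/(2Y) is -1, a contradiction. *)
Let cauchy_schwarz (al X Y : R) : 0 <= al ->
  (forall t, 0 <= t ^+ 2 * al - 2 * t * Y + X) -> Y ^+ 2 <= al * X.
Proof.
move=> al0 h; have := h 0; rewrite expr0n /= !(mul0r, mulr0) subr0 add0r => X0.
have [al1|al1] := ltP 0 al.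
  have := h (Y / al).
  rewrite (_ : _ + X = X - Y ^+ 2 / al); last by field; rewrite gt_eqF.
  by rewrite subr_ge0 ler_pdivrMr// mulrC.
have alz : al = 0 by apply/eqP; rewrite eq_le al1 al0.
have [->|Y0] := eqVneq Y 0; first by rewrite expr0n mulr_ge0.
have := h ((X + 1) / (2 * Y)).
rewrite alz mulr0 sub0r (_ : _ + X = - 1) ?oppr_ge0 ?ler10//.
by field.
Qed.

(** Cauchy-Schwarz for the measure |phi(u - v)| dv gives |phi o f|^2 <= 16 |phi|_1 (|phi| o |f|^2)
    almost everywhere, with 16 the square of the factor in [qnorm_qint]; Tonelli integrates the
    bound in u. *)
Lemma L2_qconv phi f : qintg mu phi -> L2 f -> L2 (qconv phi f).
Proof.
move=> hp h2; have mp := qintg_meas hp; have mf := h2.1.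
split; first exact: qmeas_conv.
pose al := \int[mu]_v qnorm (phi v).
have al0 : 0 <= al by apply: Rintegral_ge0 => v _; exact: qnorm_ge0.
have ip := qintg_norm hp.
apply: (@le_lt_trans _ _ (\int[mu]_u ((16 * al)%:E * econv (nn phi) (sq f) u))%E).
  apply: ae_ge0_le_integral => //.
  - by move=> u _; rewrite lee_fin qn2_ge0.
  - by apply: emeas_qn2; exact: qmeas_conv.
  - by move=> u _; rewrite mule_ge0 ?econv_ge0// lee_fin mulr_ge0.
  - by apply: measurable_funeM; apply: measurable_econv; [exact: emeas_qnorm|exact: emeas_qn2].
  apply: ae_imp2 (ae_econv_sq hp h2) (ae_qintg_conv2 hp h2) => u hu iu _.
  have mpu : measurable_fun setT (fun v : R => qnorm (phi (u - v))).
    by apply: measurable_qnorm; exact: qmeas_sub.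
  have ipu : intR (fun v : R => qnorm (phi (u - v))) by exact: (intR_reflect u ip).
  have inorm := qintg_norm iu.
  have i1 : intR (fun v => qnorm (phi (u - v)) * qnorm (f v)).
    by move: inorm; congr (integrable _ _ _); apply/funext => v; rewrite /= qnormM.
  have i2 : intR (fun v => qnorm (phi (u - v)) * qn2 (f v)).
    apply/integrableP; split.
      by apply/measurable_EFinP; apply: measurable_funM => //; exact: measurable_qn2.
    apply: le_lt_trans hu; rewrite le_eqVlt; apply/orP; left; apply/eqP.
    apply: eq_integral => v _.
    by rewrite /= ger0_norm ?mulr_ge0 ?qnorm_ge0 ?qn2_ge0// EFinM.
  have XE : econv (nn phi) (sq f) u = (\int[mu]_v (qnorm (phi (u - v)) * qn2 (f v)))%:E.
    rewrite /Rintegral fineK; last exact: (integrable_fin_num _ i2).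
    by apply: eq_integral => v _; rewrite EFinM.
  rewrite XE -EFinM lee_fin.
  set X := Rintegral _ _ _.
  pose Y := \int[mu]_v (qnorm (phi (u - v)) * qnorm (f v)).
  have Y0 : 0 <= Y by apply: Rintegral_ge0 => v _; rewrite mulr_ge0 ?qnorm_ge0.
  have CS : Y ^+ 2 <= al * X.
    apply: cauchy_schwarz => // t.
    have -> : al = \int[mu]_v qnorm (phi (u - v)).
      rewrite /al /Rintegral; congr fine.
      by rewrite -(integral_reflect u (emeas_qnorm mp)).
    rewrite /X /Y -RintegralZl// -RintegralZl// -RintegralB//; [|exact: intRZl|exact: intRZl].
    rewrite -RintegralD//; last by apply: intRB; exact: intRZl.
    apply: Rintegral_ge0 => v _; rewrite -qnorm_sqr.
    rewrite (_ : _ + _ = qnorm (phi (u - v)) * (t - qnorm (f v)) ^+ 2); last by ring.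
    by rewrite mulr_ge0 ?qnorm_ge0 ?sqr_ge0.
  have b : qnorm (qconv phi f u) <= 4 * Y.
    apply: (le_trans (qnorm_qint iu)); rewrite ler_wpM2l//.
    by rewrite le_eqVlt; apply/orP; left; apply/eqP; apply: eq_Rintegral => v _; rewrite qnormM.
  rewrite -qnorm_sqr; apply: (@le_trans _ _ ((4 * Y) ^+ 2)).
    by rewrite lerXn2r// ?nnegrE ?qnorm_ge0 ?mulr_ge0.
  by rewrite exprMn -mulrA (_ : 4 ^+ 2 = 16) ?ler_wpM2l//; ring.
rewrite ge0_integralZl//; last 3 first.
- by apply: measurable_econv; [exact: emeas_qnorm|exact: emeas_qn2].
- by move=> u _; exact: econv_ge0.
- by rewrite lee_fin mulr_ge0.
rewrite integral_econv//; [|exact: emeas_qnorm|exact: emeas_qn2].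
rewrite lte_mul_pinfty ?mule_ge0 ?integral_ge0//; first by rewrite lee_fin mulr_ge0.
rewrite lte_mul_pinfty ?integral_ge0 ?ge0_fin_numE ?integral_ge0 ?L1norm//.
exact: h2.2.
Qed.

(** Fubini requires |phi| o |psi| o |f| to be finite at u. With |f|^2 in place of |f| this holds
    almost everywhere by Tonelli, and |f| <= 1 + |f|^2 adds only the constant |phi|_1 |psi|_1. *)
Lemma qconvA phi psi f : qintg mu phi -> qintg mu psi -> L2 f ->
  {ae mu, forall u, qconv phi (qconv psi f) u = qconv (qconv phi psi) f u}.
Proof.
move=> hp hs h2; have mp := qintg_meas hp; have ms := qintg_meas hs; have mf := h2.1.
have mnp := emeas_qnorm mp; have mns := emeas_qnorm ms; have msf := emeas_qn2 mf.
have mnf := emeas_qnorm mf.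
have mpf := measurable_econv mns msf; have mpn := measurable_econv mns mnf.
have e1 x : (0 <= econv (nn psi) (sq f) x)%E by exact: econv_ge0.
have e2 x : (0 <= econv (nn psi) (nn f) x)%E by exact: econv_ge0.
pose be := fine (\int[mu]_v nn psi v)%E.
have beE : (\int[mu]_v nn psi v = be%:E)%E.
  by rewrite fineK// ge0_fin_numE ?integral_ge0// L1norm.
have be0 : 0 <= be by rewrite fine_ge0// integral_ge0.
have aeT3 : {ae mu, forall u, (econv (nn phi) (econv (nn psi) (nn f)) u < +oo)%E}.
  have : {ae mu, forall u, (econv (nn phi) (econv (nn psi) (sq f)) u < +oo)%E}.
    apply: ae_fin; first exact: measurable_econv.
      by move=> u; exact: econv_ge0.
    rewrite integral_econv// integral_econv//.
    rewrite lte_mul_pinfty ?integral_ge0 ?ge0_fin_numE ?integral_ge0 ?L1norm//.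
    rewrite lte_mul_pinfty ?integral_ge0 ?ge0_fin_numE ?integral_ge0 ?L1norm//.
    exact: h2.2.
  apply: ae_imp => u hu.
  apply: (@le_lt_trans _ _ (econv (nn phi) (fun w => (cst be%:E) w + econv (nn psi) (sq f) w)%E u)).
    apply: econv_le => //; first exact: emeasurable_funD.
    by move=> w; rewrite /= -beE; exact: econv_L2_le.
  rewrite econvD// econv_cst// lte_add_pinfty//.
  by rewrite lte_mul_pinfty ?integral_ge0 ?ge0_fin_numE ?integral_ge0 ?L1norm// ltry.
move: aeT3; apply: ae_imp => u Tu.
pose g (p : R * R) := phi (u - p.1) * psi (p.1 - p.2) * f p.2.
have mg : qmeas g.
  apply: qmeasM; last exact: (qmeas_comp measurable_snd mf).
  apply: qmeasM; last exact: qmeas_subp.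
  by apply: (qmeas_comp _ mp); exact: measurable_funB.
have ig : qintg (mu \x mu)%E g.
  apply: qintgP => //.
  rewrite fubini_tonelli1; last 2 first.
  - by apply/measurable_EFinP; exact: measurable_qnorm.
  - by move=> p; rewrite lee_fin qnorm_ge0.
  apply: le_lt_trans Tu; rewrite le_eqVlt; apply/orP; left; apply/eqP.
  apply: eq_integral => w _; rewrite /econv -ge0_integralZl//.
  - by apply: eq_integral => v _; rewrite /g/= !qnormM !EFinM muleA.
  - apply: emeasurable_funM => //; apply: (measurableT_comp mns).
    exact: measurable_funB.
  - by move=> v _; rewrite mule_ge0.
have L : qconv phi (qconv psi f) u = qintm mu (fun w => qintm mu (fun v => g (w, v))).
  rewrite qconvE; apply: qint_ae.
  - by apply: qmeas_conv_fun => //; exact: qmeas_conv.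
  - move=> k; under eq_fun do rewrite qco_qint.
    exact: (measurable_Rintegral2 (k := fun p => qco k (g p))) (mg k).
  have := ae_qintg_conv2 hs h2; apply: ae_imp => x ix.
  rewrite qconvE -qintMl//; congr qintm; apply/funext => v'.
  by rewrite /g /= mulrA.
have Rr : qconv (qconv phi psi) f u = qintm mu (fun v => qintm mu (fun w => g (w, v))).
  rewrite qconvE; apply: qint_ae.
  - by apply: qmeas_conv_fun => //; exact: qmeas_conv.
  - move=> k; under eq_fun do rewrite qco_qint.
    apply: (measurable_Rintegral2 (k := fun p => qco k (g (p.2, p.1)))).
    exact: measurable_swap_fun (mg k).
  have := ae_reflect u (ae_qintg_conv1 hp hs); apply: ae_imp => v iv.
  rewrite qconvE -qintMr//; apply: qcoP => k; rewrite !qco_qint /Rintegral; congr fine.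
  have m : measurable_fun setT (fun w : R => (qco k (phi (u - v - w) * psi w * f v))%:E).
    apply/measurable_EFinP; apply: qmeasM; last exact: qmeas_cst.
    exact: qmeas_conv_fun.
  rewrite -(integral_shift (- v) m); apply: eq_integral => x _.
  by rewrite /g /= (_ : u - v - (x - v) = u - x)//; ring.
by rewrite L Rr; exact: qFubini.
Qed.

End Convolution.

(** * Wiener-Hopf operators *)

Section HardySpace.
Variable R : realType.
Notation H := (quat R).
Notation mu := (@lebesgue_measure R).
Implicit Types f g F G phi psi : R -> H.
Implicit Types Phi Psi : H -> H.
Variable i : H.
Hypothesis hi : qsphere i.

(** The point 0 goes to [pos], matching the strict condition u < 0 in [hardy_rep]. *)
Definition pos f (u : R) : H := if 0 <= u then f u else 0.
Definition neg f (u : R) : H := if 0 <= u then 0 else f u.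

Lemma posDneg f u : pos f u + neg f u = f u.
Proof. by rewrite /pos /neg; case: ifP => _; rewrite ?addr0 ?add0r. Qed.

Lemma posE f : pos f = fun u => \1_(`[0, +oo[) u *: f u.
Proof.
apply/funext => u; rewrite /pos indicE.
case: ifPn => u0; first by rewrite mem_set ?scale1r//= in_itv/= andbT.
by rewrite memNset ?scale0r//= in_itv/= andbT; exact/negP.
Qed.

Lemma negE f : neg f = fun u => f u - pos f u.
Proof. by apply/funext => u; rewrite -[X in X - _](posDneg f u) addrAC subrr add0r. Qed.

Lemma L2_pos f : L2 f -> L2 (pos f).
Proof.
move=> [mf hf]; have mp : qmeas (pos f).
  by rewrite posE; apply: qmeasZ => //; exact: measurable_indic.
split => //; apply: le_lt_trans hf; apply: N2_le => // u.
by rewrite /pos; case: ifP => // _; rewrite qn20 qn2_ge0.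
Qed.

Lemma L2_neg f : L2 f -> L2 (neg f).
Proof. by move=> hf; rewrite negE; apply: L2B => //; exact: L2_pos. Qed.

Lemma pos_ge0 f u : 0 <= u -> pos f u = f u.
Proof. by rewrite /pos => ->. Qed.

Lemma pos_lt0 f u : u < 0 -> pos f u = 0.
Proof. by move=> u0; rewrite /pos leNgt u0. Qed.

Lemma neg_ge0 f u : 0 <= u -> neg f u = 0.
Proof. by move=> u0; rewrite /neg u0. Qed.

Lemma mulqI (x : H) : i * x = 0 -> x = 0.
Proof.
move=> /(congr1 (fun z => i * z)); rewrite mulr0 mulrA -expr2.
by move: hi; rewrite /qsphere /= => ->; rewrite mulN1r => /eqP; rewrite oppr_eq0 => /eqP.
Qed.

Lemma wfun_qft (c : H) f (y : R) : wfun c f (y *: i) = c + qft i f y.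
Proof. by []. Qed.

Lemma ae_qco (P : R -> Prop) f :
  (forall k, {ae mu, forall u, P u -> qco k (f u) = 0}) ->
  {ae mu, forall u, P u -> f u = 0}.
Proof.
move=> U; apply: ae_imp2 (ae_and (U 0) (U 1)) (ae_and (U 2) (U 3)).
by move=> u [a b] [c e] Pu; apply: quatP; [exact: a|exact: b|exact: c|exact: e].
Qed.

(** In F = C + i S the part C is even and S is odd in y, so the equations at y and -y separate them,
    and the coordinates fall under the real case. Only values on one line are compared, as in
    [wiener_plus] and [wiener_minus]. *)
Lemma wfun_unique (c c' : H) f f' : qintg mu f -> qintg mu f' ->
  (forall y, wfun c f (y *: i) = wfun c' f' (y *: i)) ->
  c = c' /\ {ae mu, forall u, f u = f' u}.
Proof.
move=> hf hf' e.
pose g u := f u - f' u.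
have hg : qintg mu g by apply: qintgD => //; exact: qintgN.
have e1 y : (c - c') + qft i g y = 0.
  have := e y; rewrite !wfun_qft qftD//; last exact: qintgN.
  rewrite qftN// => ee; rewrite addrACA ee -opprD; exact: subrr.
have e2 y : (c - c') + qcosT g y + i * qsinT g y = 0.
  by rewrite -(e1 y) (qftE hi)// addrA.
have e3 y : (c - c') + qcosT g y - i * qsinT g y = 0.
  by rewrite -(e1 (- y)) (qft_opp hi)// addrA.
have S0 y : qsinT g y = 0.
  apply: mulqI; apply: qcoP => k.
  have := congr1 (qco k) (e2 y); have := congr1 (qco k) (e3 y).
  rewrite !qcoB qco0 !qcoD; lra.
have C0 y : qcosT g y = - (c - c').
  by apply/eqP; rewrite -addr_eq0 addrC; apply/eqP; have := e2 y; rewrite S0 mulr0 addr0.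
have U k : {ae mu, forall u, qco k (g u) = 0} /\ qco k (c - c') = 0.
  apply: real_fourier_unique; first exact: (hg k).
    move=> y; rewrite -qcoN -(C0 y).
    by move: k => [|[|[|k]]].
  move=> y; rewrite -[RHS](qco0 _ k) -(S0 y).
  by move: k => [|[|[|k]]].
split.
  by apply/eqP; rewrite -subr_eq0; apply/eqP; apply: qcoP => k; rewrite (U k).2 qco0.
have U' k : {ae mu, forall u, True -> qco k (g u) = 0}.
  by apply: ae_imp (U k).1.
by apply: ae_imp (ae_qco U') => u /(_ I)/eqP; rewrite subr_eq0 => /eqP.
Qed.

Lemma wiener_coefP Phi : wiener Phi ->
  wiener_rep (wiener_coef Phi).1 (wiener_coef Phi).2 Phi.
Proof.
move=> [c [f h]].
by have /= := getPex (ex_intro (fun cf : H * (R -> H) => wiener_rep cf.1 cf.2 Phi) (c, f) h).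
Qed.

Lemma wiener_rep_unique c f c' f' Phi : wiener_rep c f Phi ->
  wiener_rep c' f' Phi -> c = c' /\ {ae mu, forall u, f u = f' u}.
Proof.
move=> [/qLp1P h1 e1] [/qLp1P h2 e2]; apply: wfun_unique => // y.
by rewrite -e1// -e2.
Qed.

Lemma qintg_inner F G : L2 F -> L2 G -> qintg mu (fun y => qconj (G y) * F y).
Proof.
move=> hF hG; apply: qintgP; first by apply: qmeasM; [exact: qmeas_conj hG.1|exact: hF.1].
have /integrableP[_] := intRD (intR_qn2 hG) (intR_qn2 hF).
have m1 : measurable_fun setT (EFin \o (fun y => qnorm (qconj (G y) * F y))).
  apply/measurable_EFinP; apply: measurable_qnorm.
  by apply: qmeasM; [exact: qmeas_conj hG.1|exact: hF.1].
have m2 : measurable_fun setT (fun y => `|(qn2 (G y) + qn2 (F y))%:E|%E).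
  apply: measurableT_comp => //; apply/measurable_EFinP.
  by apply: measurable_funD; apply: measurable_qn2; [exact: hG.1|exact: hF.1].
have p y : (0 <= (qnorm (qconj (G y) * F y))%:E)%E by rewrite lee_fin qnorm_ge0.
apply: le_lt_trans; apply: ge0_le_integral => //.
move=> y _; rewrite [X in (_ <= X)%E]/= lee_fin.
rewrite qnormM ger0_norm; last by rewrite addr_ge0 ?qn2_ge0.
have -> : qnorm (qconj (G y)) = qnorm (G y) by rewrite /qnorm /= !sqrrN.
rewrite -!qnorm_sqr; have := sqr_ge0 (qnorm (G y) - qnorm (F y)).
have := sqr_ge0 (qnorm (G y) + qnorm (F y)); nra.
Qed.

Lemma qinnerB F G K : L2 F -> L2 G -> L2 K ->
  qinner (fun y => F y - G y) K = qinner F K - qinner G K.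
Proof.
move=> hF hG hK.
transitivity (qintm mu (fun y => qconj (K y) * F y - qconj (K y) * G y)).
  by congr qintm; apply/funext => y; rewrite mulrBr.
by rewrite qintB//; exact: qintg_inner.
Qed.

Lemma N2_Rint F : L2 F -> N2 F = (\int[mu]_y qn2 (F y))%:E.
Proof.
move=> hF; rewrite /Rintegral fineK//.
exact: (integrable_fin_num _ (intR_qn2 hF)).
Qed.

Lemma qn2_cross (x y q : H) :
  qn2 (x + y * q) = qn2 x + qn2 (y * q) + 2 * qre (qconj q * (qconj y * x)).
Proof.
by case: x y q => [a b c e] [a' b' c' e'] [s t v w]; rewrite /qn2 /=; ring.
Qed.

(** Pythagoras for all right multiples of G forces orthogonality: for q equal to the inner product m
    itself, the cross term is 2 |m|^2. *)
Lemma qinner_polar F G : L2 F -> L2 G ->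
  (forall q, N2 (fun y => F y + G y * q) = (N2 F + N2 (fun y => G y * q)%R)%E) ->
  qinner F G = 0.
Proof.
move=> hF hG h; have hI := qintg_inner hF hG.
set m := qinner F G; have hGm := L2Mr m hG.
have hI' : qintg mu (fun y => qconj m * (qconj (G y) * F y)) by exact: qintgMl.
have := h m; rewrite !N2_Rint//; last exact: L2D.
rewrite -EFinD => -[].
under eq_Rintegral do rewrite qn2_cross.
rewrite RintegralD//; last 2 first.
- exact: (intRD (intR_qn2 hF) (intR_qn2 hGm)).
- exact: (intRZl 2 (hI' 0)).
rewrite RintegralD//; [|exact: (intR_qn2 hF)|exact: (intR_qn2 hGm)].
rewrite RintegralZl//; last exact: (hI' 0).
have -> : \int[mu]_y qre (qconj m * (qconj (G y) * F y)) = qn2 m.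
  transitivity (qco 0 (qintm mu (fun y => qconj m * (qconj (G y) * F y)))).
    by rewrite qco_qint.
  rewrite qintMl//.
  have -> : qintm mu (fun y => qconj (G y) * F y) = m by [].
  by rewrite /qn2; case: (m) => [a b c e] /=; ring.
move=> e; apply: qn2_eq0; lra.
Qed.

(** Functions with disjoint supports satisfy Pythagoras, and the isometry carries it over to their
    transforms; no bilinear Parseval formula is involved. *)
Lemma qinner_fourier_disjoint f g F G : L2 f -> L2 g ->
  is_fourier2 i f F -> is_fourier2 i g G -> (forall u, f u = 0 \/ g u = 0) ->
  qinner F G = 0.
Proof.
move=> hf hg fF gG fg; apply: qinner_polar; [exact: fourier2_L2 fF|exact: fourier2_L2 gG|].
move=> q; have hgq := L2Mr q hg; have gqG := fourier2Mr hi q hg gG.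
have := fourier2_isometry hi (L2D hf hgq) (fourier2D hi hf hgq fF gqG).
rewrite (fourier2_isometry hi hf fF) (fourier2_isometry hi hgq gqG) => ->.
rewrite -muleDr//; last by rewrite ge0_adde_def ?inE ?N2_ge0.
congr (_ * _)%E; rewrite !N2_Rint//; last exact: L2D.
rewrite -EFinD -RintegralD//; [|exact: intR_qn2|exact: intR_qn2].
congr (_%:E); apply: eq_Rintegral => u _.
by have [->|->] := fg u; rewrite ?mul0r ?addr0 ?add0r qn20 ?addr0 ?add0r.
Qed.

Lemma hardy_repP f F : hardy_rep i f F <->
  [/\ L2 f, forall u, u < 0 -> f u = 0 & is_fourier2 i f F].
Proof. by rewrite /hardy_rep; split=> -[/qLp2P]. Qed.

Lemma hardy_repB f g F G : hardy_rep i f F -> hardy_rep i g G ->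
  hardy_rep i (fun u => f u - g u) (fun y => F y - G y).
Proof.
move=> /hardy_repP[hf f0 fF] /hardy_repP[hg g0 gG]; apply/hardy_repP; split.
- exact: L2B.
- by move=> u u0; rewrite f0// g0// subr0.
- exact: fourier2B.
Qed.

Lemma hardy_rep_L2 f F : hardy_rep i f F -> L2 F.
Proof. by move=> /hardy_repP[_ _ /fourier2_L2]. Qed.

(** The decomposition F = G + K exhibits G as a projection, so the property behind [get] is
    satisfiable. Two projections differ by an element of the Hardy space orthogonal to itself, so
    the chosen one equals G almost everywhere and keeps the coefficient function g. *)
Lemma hardy_proj_rep F g G r K : hardy_rep i g G -> L2 r ->
  (forall u, 0 <= u -> r u = 0) -> is_fourier2 i r K -> L2 F ->
  {ae mu, forall y, F y = G y + K y} -> hardy_rep i g (hardy_proj i F).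
Proof.
move=> gG hr r0 rK hF FE.
have hG := hardy_rep_L2 gG.
have hFG := L2B hF hG.
have rFG : is_fourier2 i r (fun y => F y - G y).
  apply: (fourier2_aer hi hFG.1 rK _ hr).
  by apply: ae_imp FE => y ->; rewrite addrAC subrr add0r.
have orth h : hardy i h -> qinner (fun y => F y - G y) h = 0.
  move=> [k /hardy_repP[hk k0 kh]]; apply: qinner_fourier_disjoint rFG kh _ => // u.
  by case: (leP 0 u) => u0; [left; exact: r0|right; exact: k0].
have [[k kP] orthP] : hardy i (hardy_proj i F) /\
    forall h, hardy i h -> qinner (fun y => F y - hardy_proj i F y) h = 0.
  by apply: (getPex (ex_intro (fun G => hardy i G /\
    forall h, hardy i h -> qinner (fun y => F y - G y) h = 0) G _)); split => //; exists g.
set P := hardy_proj i F in kP orthP *; clearbody P.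
have hP := hardy_rep_L2 kP.
pose D y := P y - G y.
have hD : hardy i D by eexists; exact: hardy_repB kP gG.
have D2 : L2 D by exact: L2B.
have D0 : qinner D D = 0.
  transitivity (qinner (fun y => (F y - G y) - (F y - P y)) D).
    have -> // : D = fun y => (F y - G y) - (F y - P y).
    by apply/funext => y; rewrite /D opprB [RHS]addrC addrA subrK.
  by rewrite (qinnerB hFG (L2B hF hP) D2) orth// orthP// subr0.
have : N2 D = 0%E.
  rewrite N2_Rint//; congr (_%:E).
  transitivity (qre (qinner D D)); last by rewrite D0.
  apply: eq_Rintegral => y _; rewrite /qn2 /=; ring.
move=> /(N2_eq0 D2.1) D0'.
have /hardy_repP[hg g0 gG'] := gG.
apply/hardy_repP; split; [exact: hg|exact: g0|].
apply: (fourier2_aer hi hP.1 gG' _ hg).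
by apply: ae_imp D0' => y /eqP; rewrite subr_eq0 => /eqP.
Qed.

Lemma hardy_coefP F : hardy i F -> hardy_rep i (hardy_coef i F) F.
Proof. by move=> [f h]; exact: (getPex (ex_intro (fun f => hardy_rep i f F) f h)). Qed.

(** The bridge from operators to functions of u. Any coefficients of Phi and F may be used, because
    those chosen by [get] agree with them up to null sets. *)
Lemma wiener_hopf_rep c phi Phi f F : wiener_rep c phi Phi -> hardy_rep i f F ->
  hardy_rep i (pos (fun u => c * f u + qconv phi f u)) (wiener_hopf i Phi F).
Proof.
move=> hPhi hF.
have W : wiener Phi by exists c, phi.
have hPhi' := wiener_coefP W.
have hF' : hardy_rep i (hardy_coef i F) F by apply: hardy_coefP; exists f.
rewrite /wiener_hopf /wmul; case: (wiener_coef Phi) hPhi' => c' phi' /= hPhi'.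
set f' := hardy_coef i F in hF' *.
have [cc pp] := wiener_rep_unique hPhi' hPhi.
have [/qLp1P ip _] := hPhi; have [/qLp1P ip' _] := hPhi'.
have /hardy_repP[hf _ fF] := hF; have /hardy_repP[hf' _ fF'] := hF'.
have ff := fourier2_inj hi hf' hf fF' fF (ae_all (fun y => erefl (F y))).
pose h u := c * f u + qconv phi f u.
have h2 : L2 h by apply: L2D; [exact: L2Ml|exact: L2_qconv].
have h1' : L2 (fun u => c' * f' u) by exact: L2Ml.
have h2' : L2 (qconv phi' f') by exact: L2_qconv.
(* [wmul] transforms the two summands separately; the sum is a transform of [h]. *)
set Fm := (fun y : R => fourier2 i _ y + _).
have hm : is_fourier2 i h Fm.
  apply: (fourier2_ael hi (L2D h1' h2') h2).
    exact: (fourier2D hi h1' h2' (fourier2_fun hi h1') (fourier2_fun hi h2')).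
  apply: ae_imp ff => u fu; rewrite /h cc fu; congr (_ + _).
  rewrite (qconv_ael u (qintg_meas ip') (qintg_meas ip) hf'.1 pp).
  apply: qconv_aer; [exact: (qintg_meas ip)|exact: hf'.1|exact: hf.1|].
  exact: (fourier2_inj hi hf' hf fF' fF (ae_all (fun y => erefl (F y)))).
have hp := L2_pos h2; have hn := L2_neg h2.
have pF := fourier2_fun hi hp; have nF := fourier2_fun hi hn.
have r1 : hardy_rep i (pos h) (fourier2 i (pos h)).
  by apply/hardy_repP; split; [exact: hp|exact: pos_lt0|exact: pF].
have r2 : {ae mu, forall y, Fm y = fourier2 i (pos h) y + fourier2 i (neg h) y}.
  apply: (fourier2_unique hi h2 (L2D hp hn) hm (fourier2D hi hp hn pF nF)).
  by apply: ae_all => u; rewrite posDneg.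
exact: (hardy_proj_rep r1 hn (@neg_ge0 h) nF (fourier2_L2 hm) r2).
Qed.

End HardySpace.

(** * Coefficients of products, and sufficiency *)

Section Symbols.
Variable R : realType.
Notation H := (quat R).
Notation mu := (@lebesgue_measure R).
Implicit Types f g h phi psi : R -> H.

Lemma qint0 : qintm mu (fun _ => 0 : H) = 0.
Proof. 
apply: qcoP => k; rewrite qco_qint.
by rewrite qco0 /Rintegral integral0.
 Qed.

Lemma qconvDr phi f g (u : R) : qintg mu (fun v : R => phi (u - v) * f v) ->
  qintg mu (fun v : R => phi (u - v) * g v) ->
  qconv phi (fun v => f v + g v) u = qconv phi f u + qconv phi g u.
Proof.
move=> i1 i2; rewrite !qconvE -qintD//.
by congr qintm; apply/funext => v; rewrite mulrDr.
Qed.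

Lemma qconvBr phi f g (u : R) : qintg mu (fun v : R => phi (u - v) * f v) ->
  qintg mu (fun v : R => phi (u - v) * g v) ->
  qconv phi (fun v => f v - g v) u = qconv phi f u - qconv phi g u.
Proof.
move=> i1 i2; rewrite !qconvE -qintB//.
by congr qintm; apply/funext => v; rewrite mulrBr.
Qed.

Lemma qconvDl phi psi f (u : R) : qintg mu (fun v : R => phi (u - v) * f v) ->
  qintg mu (fun v : R => psi (u - v) * f v) ->
  qconv (fun v => phi v + psi v) f u = qconv phi f u + qconv psi f u.
Proof.
move=> i1 i2; rewrite !qconvE -qintD//.
by congr qintm; apply/funext => v; rewrite mulrDl.
Qed.

Lemma qconvMl (c : H) phi f (u : R) : qintg mu (fun v : R => phi (u - v) * f v) ->
  qconv (fun v => c * phi v) f u = c * qconv phi f u.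
Proof.
move=> i1; rewrite !qconvE -qintMl//.
by congr qintm; apply/funext => v; rewrite mulrA.
Qed.

(** Associativity moves the constant to the right of phi, where [symbol] has [c2]. *)
Lemma qconvMm (c : H) phi f (u : R) :
  qconv phi (fun v => c * f v) u = qconv (fun v => phi v * c) f u.
Proof. by rewrite !qconvE; congr qintm; apply/funext => v; rewrite mulrA. Qed.

(** The L_1 coefficient of the star product. *)
Definition symbol (c1 c2 : H) phi psi (u : R) : H := c1 * psi u + phi u * c2 + qconv phi psi u.

Lemma qintg_symbol c1 c2 phi psi : qintg mu phi -> qintg mu psi ->
  qintg mu (symbol c1 c2 phi psi).
Proof.
move=> hp hs; apply: qintgD; last exact: qintg_qconv.
by apply: qintgD; [exact: qintgMl|exact: qintgMr].
Qed.

(** On the whole line, before any projection, the multipliers compose exactly. Each splitting of a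
    convolution holds where its pieces converge absolutely, hence the list of a.e. conditions. *)
Lemma ae_compose c1 c2 phi psi f : qintg mu phi -> qintg mu psi -> L2 f ->
  {ae mu, forall u, c1 * (c2 * f u + qconv psi f u) +
     qconv phi (fun v => c2 * f v + qconv psi f v) u =
   c1 * c2 * f u + qconv (symbol c1 c2 phi psi) f u}.
Proof.
move=> hp hs hf.
have h1 := qintgMl c1 hs; have h2 := qintgMr c2 hp; have h3 := qintg_qconv hp hs.
have g1 := L2Ml c2 hf; have g2 := L2_qconv hs hf.
apply: ae_imp2 (ae_and (qconvA hp hs hf) (ae_qintg_conv2 hp g1))
  (ae_and (ae_qintg_conv2 hp g2)
    (ae_and (ae_qintg_conv2 hs hf)
      (ae_and (ae_qintg_conv2 h1 hf)
        (ae_and (ae_qintg_conv2 h2 hf) (ae_qintg_conv2 h3 hf))))).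
move=> u [A i1] [i2 [i3 [i4 [i5 i6]]]].
have i45 : qintg mu (fun v : R => (c1 * psi (u - v) + phi (u - v) * c2) * f v).
  have := qintgD i4 i5; congr (qintg mu _).
  by apply/funext => v; rewrite -mulrDl.
rewrite (qconvDr i1 i2) A qconvMm /symbol (qconvDl i45 i6) (qconvDl i4 i5) (qconvMl _ i3).
by rewrite mulrDr -!addrA !mulrA.
Qed.

Lemma ae_conv_split phi h : qintg mu phi -> L2 h ->
  {ae mu, forall u, qconv phi h u = qconv phi (pos h) u + qconv phi (neg h) u}.
Proof.
move=> hp hh; apply: ae_imp2 (ae_qintg_conv2 hp (L2_pos hh)) (ae_qintg_conv2 hp (L2_neg hh)).
move=> u i1 i2; transitivity (qconv phi (fun v => pos h v + neg h v) u).
  by congr (qconv phi _ u); apply/funext => v; rewrite posDneg.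
exact: qconvDr.
Qed.

(** The supports do not meet: for u < 0 <= v the argument u - v is negative. [qconv_anticausal] is
    the mirror image. *)
Lemma qconv_causal psi f (u : R) : qmeas psi -> {ae mu, forall v, v < 0 -> psi v = 0} ->
  qmeas f -> (forall v, v < 0 -> f v = 0) -> u < 0 -> qconv psi f u = 0.
Proof.
move=> mp p0 mf f0 u0; rewrite qconvE -[RHS]qint0; apply: qint_ae.
- exact: qmeas_conv_fun.
- exact: qmeas_cst.
have := ae_reflect u p0; apply: ae_imp => v hv.
have [v0|v0] := ltP v 0; first by rewrite f0// mulr0.
by rewrite hv ?mul0r// subr_lt0 (lt_le_trans u0).
Qed.

Lemma qconv_anticausal phi f (u : R) : qmeas phi -> {ae mu, forall v, 0 < v -> phi v = 0} ->
  qmeas f -> (forall v, 0 <= v -> f v = 0) -> 0 <= u -> qconv phi f u = 0.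
Proof.
move=> mp p0 mf f0 u0; rewrite qconvE -[RHS]qint0; apply: qint_ae.
- exact: qmeas_conv_fun.
- exact: qmeas_cst.
have := ae_reflect u p0; apply: ae_imp => v hv.
have [v0|v0] := ltP v 0; last by rewrite f0// mulr0.
by rewrite hv ?mul0r// subr_gt0 (lt_le_trans v0).
Qed.

(** In the first case the discarded part [neg h] contributes nothing on u >= 0; in the second
    nothing is discarded, as [pos h = h]. *)
Lemma ae_pos_compose c1 c2 phi psi f : qintg mu phi -> qintg mu psi -> L2 f ->
  (forall v, v < 0 -> f v = 0) ->
  {ae mu, forall v, 0 < v -> phi v = 0} \/ {ae mu, forall v, v < 0 -> psi v = 0} ->
  let h v := c2 * f v + qconv psi f v in
  {ae mu, forall u, pos (fun v => c1 * pos h v + qconv phi (pos h) v) u =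
    pos (fun v => c1 * c2 * f v + qconv (symbol c1 c2 phi psi) f v) u}.
Proof.
move=> hp hs hf f0 c h.
have hh : L2 h by apply: L2D; [exact: L2Ml|exact: L2_qconv].
case: c => [p0|s0].
  apply: ae_imp2 (ae_compose c1 c2 hp hs hf) (ae_conv_split hp hh) => u e1 e2.
  have [u0|u0] := leP 0 u; last by rewrite !pos_lt0.
  rewrite !(pos_ge0 _ u0) -e1 -/h [qconv phi h u]e2.
  by rewrite (qconv_anticausal (qintg_meas hp) p0 (L2_neg hh).1 (@neg_ge0 _ h) u0) addr0.
have -> : pos h = h.
  apply/funext => u; rewrite /pos; case: ifPn => //; rewrite -ltNge => u0.
  by rewrite /h f0// mulr0 add0r (qconv_causal (qintg_meas hs) s0 hf.1 f0 u0).
by apply: ae_imp (ae_compose c1 c2 hp hs hf) => u; rewrite /pos; case: ifP => // _ ->.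
Qed.

End Symbols.

(** * Test functions and integrals over sliding intervals *)

Section TestFunctions.
Variable R : realType.
Notation H := (quat R).
Notation mu := (@lebesgue_measure R).
Notation intR f := (mu.-integrable setT (EFin \o f)).
Implicit Types f g h phi psi : R -> H.

Lemma L2_shift (t : R) f : L2 f -> L2 (fun v : R => f (v + t)).
Proof.
move=> [mf hf]; split.
  by apply: (qmeas_comp _ mf); exact: measurable_funD.
by rewrite /N2 (integral_shift t (emeas_qn2 mf)).
Qed.

(** Extracts points from an a.e. statement: an interval of positive length is not contained in a
    null set. *)
Lemma ae_in_itv (P : R -> Prop) (a b : R) : a < b -> {ae mu, forall w, P w} ->
  exists w, [/\ a < w, w < b & P w].
Proof.
move=> ab [N [mN N0 PN]]; apply: contrapT => nex.
have s : `]a, b[%classic `<=` N.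
  move=> w /=; rewrite in_itv/= => /andP[aw wb]; apply: PN => /= Pw.
  by apply: nex; exists w.
have : (mu `]a, b[%classic <= mu N)%E by apply: le_measure => //; rewrite inE.
by rewrite N0 lebesgue_measure_itv/= lte_fin ab -EFinB lee_fin leNgt subr_gt0 ab.
Qed.

Lemma qn2_cvg (x_ : nat -> H) (x : H) :
  (forall k, qco k (x_ n) @[n --> \oo] --> qco k x) ->
  qn2 (x_ n) @[n --> \oo] --> qn2 x.
Proof.
move=> h; rewrite /qn2.
by apply: cvgD; [apply: cvgD; [apply: cvgD|]|]; rewrite ?expr2; under eq_cvg do rewrite ?expr2;
  apply: cvgM; [exact: (h 0)|exact: (h 0)|exact: (h 1)|exact: (h 1)|
    exact: (h 2)|exact: (h 2)|exact: (h 3)|exact: (h 3)].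
Qed.

(** The indicator moves and h stays fixed, so that dominated convergence applies with majorant
    |h|. *)
Definition winint (h : R -> R) (p q w : R) := \int[mu]_x (h x * \1_(`[p, q]) (x + w)).

Lemma winint_cvg (h : R -> R) (p q : R) (w_ : nat -> R) : intR h ->
  w_ n @[n --> \oo] --> 0 ->
  winint h p q (w_ n) @[n --> \oo] --> \int[mu]_x (h x * \1_(`[p, q]) x).
Proof.
move=> ih w0; have mh := intR_measurable ih.
have mi : measurable_fun setT (\1_(`[p, q]) : R -> R) by exact: measurable_indic.
have mo n : measurable_fun setT (fun x => h x * \1_(`[p, q]) (x + w_ n)).
  apply: measurable_funM => //; apply: (measurableT_comp mi).
  exact: measurable_funD.
have m1 : measurable_fun setT (fun x => h x * \1_(`[p, q]) x) by exact: measurable_funM.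
have [] // := @Rdominated_cvg R (fun n x => h x * \1_(`[p, q]) (x + w_ n)) _ (fun x => `|h x|) mo m1.
- apply: ae_imp2 (ae_neq p) (ae_neq q) => x xp xq.
  apply: cvgM; first exact: cvg_cst.
  have c := @continuous_indic_itv R p q x xp xq.
  have xw : x + w_ n @[n --> \oo] --> x.
    by rewrite -[X in _ --> X]addr0; apply: cvgD => //; exact: cvg_cst.
  exact: (cvg_comp _ _ xw c).
- exact: (integrable_norm ih).
move=> n x; rewrite normrM ler_piMr//.
by case: (indic01 `[p, q] (x + w_ n)) => ->; rewrite ?normr0 ?normr1.
Qed.

Definition box (a b u : R) : H := \1_(`[a, b]) u *: 1.

Lemma qn2_1 : qn2 (1 : H) = 1.
Proof. by rewrite /qn2 /= expr0n expr1n !addr0. Qed.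

Lemma qmeas_box a b : qmeas (box a b).
Proof. by apply: qmeasZ; [exact: measurable_indic|exact: qmeas_cst]. Qed.

Lemma intR_indic (a b : R) : intR (\1_(`[a, b]) : R -> R).
Proof. exact: (integrable_indic_itv a b true false). Qed.

Lemma L2_box a b : L2 (box a b).
Proof.
split; first exact: qmeas_box.
have /integrableP[_] := intR_indic a b.
rewrite /N2; congr (_ < _)%E; apply: eq_integral => u _.
rewrite /box qn2Z qn2_1 mulr1 /=.
by case: (indic01 `[a, b] u) => ->; rewrite ?normr0 ?normr1 ?expr0n ?expr1n.
Qed.

Lemma qintg_box a b : qintg mu (box a b).
Proof.
move=> k; have := intRZr (qco k 1) (intR_indic a b).
by congr (integrable _ _ _); apply/funext => u; rewrite /= /box qcoZ.
Qed.

Lemma box_lt0 a b u : 0 <= a -> u < 0 -> box a b u = 0.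
Proof.
move=> a0 u0; rewrite /box indicE memNset ?scale0r//= in_itv/=.
by move=> /andP[au _]; have := lt_le_trans u0 (le_trans a0 au); rewrite ltxx.
Qed.

(** With x = w - v the interval [a, b] becomes [w - b, w - a], whence the reversed endpoints and the
    sign of w. *)
Lemma qco_conv_box k psi (a b w : R) : qmeas psi ->
  qco k (qconv psi (box a b) w) = winint (fun x => qco k (psi x)) (- b) (- a) (- w).
Proof.
move=> mp; rewrite qconvE qco_qint /winint.
transitivity (\int[mu]_v (qco k (psi (w - v)) * \1_(`[a, b]) v)).
  apply: eq_Rintegral => v _.
  by rewrite /box -scalerAr mulr1 qcoZ mulrC.
rewrite /Rintegral; congr fine.
have m : measurable_fun setT (fun x : R => (qco k (psi x) * \1_(`[- b, - a]) (x - w))%:E).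
  apply/measurable_EFinP; apply: measurable_funM; first exact: mp.
  apply: (measurableT_comp (f := \1_(`[- b, - a]) : R -> R)) => //.
  exact: measurable_funB.
rewrite -(integral_reflect w m); apply: eq_integral => v _.
congr ((_ * _)%:E); rewrite addrAC subrr add0r !indicE; congr ((_ : bool)%:R).
by apply: asbool_equiv_eq => /=; rewrite !in_itv/= !lerN2 andbC.
Qed.

(* [window phi p q] and [qconv psi (box a b)] are both continuous at 0, being
   integrals of an L_1 function over a sliding interval. *)
Definition window phi (p q w : R) : H := qintm mu (fun u : R => \1_(`[p, q]) u *: phi (u - w)).

Lemma qco_window k phi (p q w : R) : qmeas phi ->
  qco k (window phi p q w) = winint (fun x => qco k (phi x)) p q w.
Proof.
move=> mp; rewrite /window qco_qint /winint.
transitivity (\int[mu]_v (qco k (phi (v - w)) * \1_(`[p, q]) v)).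
  by apply: eq_Rintegral => v _; rewrite qcoZ mulrC.
rewrite /Rintegral; congr fine.
have m : measurable_fun setT (fun x : R => (qco k (phi (x - w)) * \1_(`[p, q]) x)%:E).
  apply/measurable_EFinP; apply: measurable_funM; last exact: measurable_indic.
  by apply: measurableT_comp (mp k) _; exact: measurable_funB.
by rewrite -(integral_shift w m); apply: eq_integral => v _; rewrite addrK.
Qed.

Lemma qnorm1 : qnorm (1 : H) = 1.
Proof.
by apply/eqP; rewrite -(@eqrXn2 _ 2)// ?qnorm_ge0// qnorm_sqr qn2_1 expr1n.
Qed.

Lemma qnormZ_indic (A : set R) (u : R) (x : H) : qnorm (\1_A u *: x) <= qnorm x.
Proof.
case: (indic01 A u) => ->; last by rewrite scale1r.
by rewrite scale0r (_ : qnorm 0 = 0) ?qnorm_ge0// -sqrtr0 /qnorm /= expr0n !addr0.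
Qed.

Lemma qmeas_window phi p q : qmeas phi -> qmeas (window phi p q).
Proof.
move=> mp k; under eq_fun do rewrite /window qco_qint.
apply: (measurable_Rintegral2 (k := fun z : R * R => qco k (\1_(`[p, q]) z.2 *: phi (z.2 - z.1)))).
apply: qmeasZ.
  by apply: (measurableT_comp (f := \1_(`[p, q]) : R -> R)) => //; exact: measurable_snd.
apply: (qmeas_comp (h := fun z : R * R => z.2 - z.1)) => //.
by apply: measurable_funB; [exact: measurable_snd|exact: measurable_fst].
Qed.

Lemma qintg_indic (A : set R) f : measurable A -> qintg mu f ->
  qintg mu (fun u => \1_A u *: f u).
Proof.
move=> mA hf; have mf := qintg_meas hf.
have : qintg mu (fun u => (\1_A u *: 1) * f u).
  apply: (@qintgM_bounded _ _ _ mu _ _ 1) => //.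
    by apply: qmeasZ; [exact: measurable_indic|exact: qmeas_cst].
  by move=> u; rewrite (le_trans (qnormZ_indic _ _ _))// qnorm1.
by congr (qintg mu _); apply/funext => u; rewrite -scalerAl mul1r.
Qed.

Lemma qnorm_window phi p q w : qintg mu phi ->
  qnorm (window phi p q w) <= 4 * \int[mu]_x qnorm (phi x).
Proof.
move=> hp; have mp := qintg_meas hp.
have hs : qintg mu (fun u : R => phi (u - w)).
  by move=> k; have := intR_shift (- w) (hp k).
have hi := qintg_indic (measurable_itv `[p, q]) hs.
apply: (le_trans (qnorm_qint hi)); rewrite ler_pM2l//.
apply: (@le_trans _ _ (\int[mu]_x qnorm (phi (x - w)))).
  apply: le_Rintegral => //; [exact: qintg_norm hi|exact: qintg_norm hs|].
  by move=> u _; exact: qnormZ_indic.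
rewrite le_eqVlt; apply/orP; left; apply/eqP; rewrite /Rintegral; congr fine.
have m : measurable_fun setT (fun x : R => (qnorm (phi x))%:E).
  by apply/measurable_EFinP; exact: measurable_qnorm.
exact: (integral_shift (- w) m).
Qed.

Lemma qintg_conv_kernel phi (k : R -> H) : qintg mu phi -> qintg mu k ->
  qintg (mu \x mu)%E (fun z : R * R => phi (z.1 - z.2) * k z.2).
Proof.
move=> hp hk; have mp := qintg_meas hp; have mk := qintg_meas hk.
have mg := qmeas_conv_kernel mp mk.
apply: qintgP => //.
rewrite fubini_tonelli1; last 2 first.
- by apply/measurable_EFinP; exact: measurable_qnorm.
- by move=> z; rewrite lee_fin qnorm_ge0.
have fin (f : R -> H) : qintg mu f -> (\int[mu]_u (qnorm (f u))%:E < +oo)%E.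
  move=> /qintg_norm/integrableP[_]; rewrite /=.
  by under eq_integral do rewrite ger0_norm ?qnorm_ge0//.
have me f : qmeas f -> measurable_fun setT (fun u => (qnorm (f u))%:E).
  by move=> mf; apply/measurable_EFinP; exact: measurable_qnorm.
have n0 f (u : R) : (0 <= (qnorm (f u))%:E)%E by rewrite lee_fin qnorm_ge0.
have := tonelli_conv (me _ mp) (me _ mk) (n0 phi) (n0 k).
have -> : (\int[mu]_u \int[mu]_v ((qnorm (phi (u - v)))%:E * (qnorm (k v))%:E) =
  \int[mu]_x fubini_F mu (fun z : R * R => (qnorm (phi (z.1 - z.2) * k z.2))%:E) x)%E.
  apply: eq_integral => u _; rewrite /fubini_F; apply: eq_integral => v _.
  by rewrite /= qnormM EFinM.
move=> ->; rewrite lte_mul_pinfty ?integral_ge0 ?ge0_fin_numE ?integral_ge0 ?fin//.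
Qed.

(** Fubini moves the integration over u in [p, q] onto phi, turning information on phi o k for u in
    [p, q] into information on the pointwise product of [window] and k. *)
Lemma qint_window_conv phi (k : R -> H) (p q : R) : qintg mu phi -> qintg mu k ->
  qintm mu (fun w => window phi p q w * k w) =
  qintm mu (fun u => \1_(`[p, q]) u *: qconv phi k u).
Proof.
move=> hp hk; have mp := qintg_meas hp; have mk := qintg_meas hk.
pose G (z : R * R) : H := \1_(`[p, q]) z.1 *: (phi (z.1 - z.2) * k z.2).
have mi : measurable_fun setT (fun z : R * R => \1_(`[p, q]) z.1 : R).
  by apply: (measurableT_comp (f := \1_(`[p, q]) : R -> R)) => //; exact: measurable_fst.
have hG : qintg (mu \x mu)%E G.
  have : qintg (mu \x mu)%E (fun z : R * R => (\1_(`[p, q]) z.1 *: 1) * (phi (z.1 - z.2) * k z.2)).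
    apply: (@qintgM_bounded _ _ _ (mu \x mu)%E _ _ 1).
    - by apply: qmeasZ => //; exact: qmeas_cst.
    - by move=> u; rewrite (le_trans (qnormZ_indic _ _ _))// qnorm1.
    - exact: qintg_conv_kernel.
  by congr (qintg _ _); apply/funext => z; rewrite -scalerAl mul1r.
transitivity (qintm mu (fun w => qintm mu (fun u => G (u, w)))).
  congr qintm; apply/funext => w; rewrite /window.
  have hs : qintg mu (fun u : R => phi (u - w)).
    by move=> l; have := intR_shift (- w) (hp l).
  have hi := qintg_indic (measurable_itv `[p, q]) hs.
  rewrite -qintMr//; congr qintm; apply/funext => u.
  by rewrite /G/= -scalerAl.
rewrite -qFubini//; apply: qint_ae.
- move=> l; under eq_fun do rewrite qco_qint.
  exact: (measurable_Rintegral2 (k := fun z => qco l (G z))) (qintg_meas hG l).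
- by apply: qmeasZ; [exact: measurable_indic|exact: qmeas_conv].
have := ae_qintg_conv1 hp hk; apply: ae_imp => u iu.
rewrite /G /= qconvE -[in RHS](mul1r (qintm _ _)) scalerAl -qintMl//; congr qintm.
by apply/funext => w; rewrite -scalerAl mul1r.
Qed.

End TestFunctions.

(** * The necessary condition *)

Section Necessity.
Variable R : realType.
Notation H := (quat R).
Notation mu := (@lebesgue_measure R).
Implicit Types f g h : R -> H.
Variables (phi psi eta : R -> H) (d : H).
Hypotheses (hp : qintg mu phi) (hs : qintg mu psi) (he : qintg mu eta).
(** What equality of operators yields for coefficient functions. The right-hand side is used only
    through its commuting with translations, so [d] and [eta] stay unspecified. *)
Hypothesis E : forall f, L2 f -> (forall v, v < 0 -> f v = 0) ->
  {ae mu, forall u, 0 <= u -> qconv phi (neg (qconv psi f)) u = d * f u + qconv eta f u}.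

(** Measures how far [neg] is from commuting with translation by t; for t > 0 what remains is g on
    [-t, 0). *)
Definition cut (t : R) g (w : R) : H := neg g w - neg (fun v => g (v - t)) (w + t).

Lemma cutE t g w : 0 < t -> cut t g w = \1_(`[- t, 0[) w *: g w.
Proof.
move=> t0; rewrite /cut /neg indicE addrK -[0 <= w + t]/(0 <= w + t).
have -> : (0 <= w + t) = (- t <= w) by rewrite -[RHS]subr_ge0 opprK.
have -> : (w \in `[- t, 0[%classic) = (- t <= w) && (w < 0).
  by apply/idP/idP; rewrite inE /= in_itv.
case: (leP 0 w) => w0 /=; last first.
  by rewrite andbT; case: (leP (- t) w) => _; rewrite ?subr0 ?scale1r// subrr scale0r.
have -> : - t <= w by rewrite (le_trans _ w0)// oppr_le0 ltW.
by rewrite subr0 scale0r.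
Qed.

(* Hypothesis [E] for f at u and for the translate of f by t at u + t have the
   same right-hand side. *)
Lemma ae_conv_cut t f : 0 < t -> L2 f -> (forall v, v < 0 -> f v = 0) ->
  {ae mu, forall u, 0 <= u -> qconv phi (cut t (qconv psi f)) u = 0}.
Proof.
move=> t0 hf f0; pose g := qconv psi f.
pose f' := fun v : R => f (v - t).
have hf' : L2 f' := L2_shift (- t) hf.
have f0' v : v < 0 -> f' v = 0 by move=> v0; apply: f0; rewrite subr_lt0 (lt_trans v0).
have gE : qconv psi f' = fun v => g (v - t).
  apply/funext => v; exact: (qconv_shift _ _ (qintg_meas hs) hf.1).
have hg : L2 g by exact: L2_qconv.
have hgt : L2 (fun v => g (v - t)) by exact: L2_shift.
pose k w := neg (fun v => g (v - t)) (w + t).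
have hn := L2_neg hg; have hk : L2 k := L2_shift t (L2_neg hgt).
have mphi := qintg_meas hp.
have kE u : qconv phi (neg (fun v => g (v - t))) (u + t) = qconv phi k u.
  have -> : neg (fun v => g (v - t)) = fun w => k (w - t).
    by apply/funext => w; rewrite /k subrK.
  by rewrite (qconv_shift _ _ mphi hk.1) addrK.
have := ae_shift t (E hf' f0'); rewrite gE => E'.
apply: ae_imp2 (ae_and E' (E hf f0)) (ae_and
  (ae_qintg_conv2 hp hn) (ae_qintg_conv2 hp hk)) => u [e1 e2] [i1 i2] u0.
have := e1 (addr_ge0 u0 (ltW t0)).
rewrite kE /f' addrK (qconv_shift _ _ (qintg_meas he) hf.1) addrK -(e2 u0) => e3.
by rewrite /cut -/g (qconvBr (f := neg g) (g := k) i1 i2) e3 subrr.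
Qed.

(** The integral of [K] over [-t, 0) equals that of phi o [cut t g] over [p, q], which vanishes
    since [p, q] lies in u >= 0. Differences in t reach every interval to the left of 0, and such
    integrals determine [K] there. *)
Lemma window_mul_eq0 f (p q : R) : qintg mu f -> L2 f -> (forall v, v < 0 -> f v = 0) ->
  0 <= p -> {ae mu, forall w, w < 0 -> window phi p q w * qconv psi f w = 0}.
Proof.
move=> hf h2 f0 p0; set g := qconv psi f; pose K w := window phi p q w * g w.
have ig : qintg mu g := qintg_qconv hs hf.
have mphi := qintg_meas hp.
have iK : qintg mu K.
  apply: (@qintgM_bounded _ _ _ mu _ _ (4 * \int[mu]_x qnorm (phi x))) => //.
    exact: qmeas_window.
  by move=> w; exact: qnorm_window.
have icut t : qintg mu (fun w => \1_(`[- t, 0[) w *: g w) by exact: qintg_indic.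
have K0 t : 0 < t -> qintm mu (fun w => \1_(`[- t, 0[) w *: K w) = 0.
  move=> t0.
  transitivity (qintm mu (fun w => window phi p q w * cut t g w)).
    by congr qintm; apply/funext => w; rewrite cutE// scalerAr.
  have ict : qintg mu (cut t g).
    have -> // : cut t g = (fun w => \1_(`[- t, 0[) w *: g w).
    by apply/funext => w; exact: cutE.
  rewrite qint_window_conv// -[RHS](qint0 R); apply: qint_ae.
  - by apply: qmeasZ; [exact: measurable_indic|apply: qmeas_conv => //; exact: qintg_meas ict].
  - exact: qmeas_cst.
  apply: ae_imp (ae_conv_cut t0 h2 f0) => u e.
  rewrite indicE; case: (boolP (u \in _)); last by rewrite scale0r.
  by rewrite inE /= in_itv/= => /andP[pu _]; rewrite e ?scaler0// (le_trans p0).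
apply: ae_qco => k; apply: ae_zero_neg; first exact: (iK k).
move=> a b ab b0.
have iA (t : R) : qintg mu (fun w => \1_(`[- t, 0[) w *: K w) by exact: qintg_indic.
have a0 : 0 < - a by rewrite oppr_gt0 (lt_trans ab).
have b0' : 0 < - b by rewrite oppr_gt0.
have := qintB (iA (- a)) (iA (- b)); rewrite !K0// subr0 => e.
transitivity (qco k (qintm mu (fun w => \1_(`[a, b]) w *: K w))).
  by rewrite qco_qint; apply: eq_Rintegral => w _; rewrite qcoZ mulrC.
rewrite -(qco0 R k) -e; congr qco; apply: qint_ae.
- by apply: qmeasZ; [exact: measurable_indic|exact: qintg_meas iK].
- exact: qintg_meas (qintgD (iA _) (qintgN (iA _))).
(* The difference of [a, 0) and [b, 0) is [a, b), which misses only the point b of [a, b]. *)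
apply: ae_imp (ae_neq b) => w wb.
rewrite -scalerBl !opprK; congr (_ *: _); rewrite !indicE.
have -> : (w \in `[a, b]%classic) = (a <= w) && (w <= b) by apply/idP/idP; rewrite inE /= in_itv.
have I0 (t : R) : (w \in `[t, 0[%classic) = (t <= w) && (w < 0) by apply/idP/idP; rewrite inE /= in_itv.
rewrite !I0; case: (ltgtP w b) wb => // wb _.
  rewrite (lt_trans wb b0) !andbT /=; case: (a <= w); rewrite ?subr0//.
have -> : a <= w by rewrite ltW// (lt_trans ab).
by rewrite andbF /= subrr.
Qed.

(** The product vanishes for almost every w < 0, so points where it does are selected tending to 0.
    Both factors converge along them, and multiplicativity of [qn2] splits the vanishing limit. *)
Lemma winint_dichotomy (p q a b : R) : 0 <= p -> 0 <= a ->
  (forall k, \int[mu]_x (qco k (phi x) * \1_(`[p, q]) x) = 0) \/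
  (forall k, \int[mu]_x (qco k (psi x) * \1_(`[- b, - a]) x) = 0).
Proof.
move=> p0 a0.
have mphi := qintg_meas hp; have mpsi := qintg_meas hs.
have Z := window_mul_eq0 q (qintg_box a b) (L2_box a b) (fun v => box_lt0 b a0) p0.
have ex (n : nat) : exists w : R, [/\ - n.+1%:R^-1 < w, w < 0 &
    (w < 0 -> window phi p q w * qconv psi (box a b) w = 0)].
  by apply: ae_in_itv Z; rewrite oppr_lt0 invr_gt0.
have [w_ hw] := choice ex.
have w0 : w_ n @[n --> \oo] --> 0.
  apply: (@squeeze_cvgr _ _ _ _ (fun n => - n.+1%:R^-1) (cst 0)).
  - by near=> n; have [h1 h2 _] := hw n; rewrite !ltW.
  - by rewrite -[X in _ --> X]oppr0; apply: cvgN; exact: cvg_harmonic.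
  - exact: cvg_cst.
have w0N : - w_ n @[n --> \oo] --> 0 by rewrite -[X in _ --> X]oppr0; exact: cvgN.
pose X : H := qintm mu (fun x => \1_(`[p, q]) x *: phi x).
pose Y : H := qintm mu (fun x => \1_(`[- b, - a]) x *: psi x).
have XE k : qco k X = \int[mu]_x (qco k (phi x) * \1_(`[p, q]) x).
  by rewrite qco_qint; apply: eq_Rintegral => x _; rewrite qcoZ mulrC.
have YE k : qco k Y = \int[mu]_x (qco k (psi x) * \1_(`[- b, - a]) x).
  by rewrite qco_qint; apply: eq_Rintegral => x _; rewrite qcoZ mulrC.
have cX : qn2 (window phi p q (w_ n)) @[n --> \oo] --> qn2 X.
  apply: qn2_cvg => k; rewrite XE; under eq_fun do rewrite qco_window//.
  exact: winint_cvg (hp k) w0.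
have cY : qn2 (qconv psi (box a b) (w_ n)) @[n --> \oo] --> qn2 Y.
  apply: qn2_cvg => k; rewrite YE; under eq_fun do rewrite qco_conv_box//.
  exact: winint_cvg (hs k) w0N.
have XY : qn2 X * qn2 Y = 0.
  have c := cvgM cX cY.
  have c0 : qn2 (window phi p q (w_ n)) * qn2 (qconv psi (box a b) (w_ n)) @[n --> \oo] --> (0 : R).
    rewrite (_ : (fun n => _) = cst 0); first exact: cvg_cst.
    apply/funext => n; have [_ h1 h2] := hw n.
    by rewrite /= -qn2M (h2 h1) qn20.
  exact: (cvg_unique (@Rhausdorff R) (c _) c0).
move: XY => /eqP; rewrite mulf_eq0 => /orP[] /eqP /qn2_eq0 e0; [left|right] => k.
  by rewrite -XE e0 qco0.
by rewrite -YE e0 qco0.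
Unshelve. all: by end_near.
Qed.

(** The dichotomy is stated for one pair of intervals. It becomes uniform because a single interval
    to the left of 0 on which psi has nonzero integral forces all integrals of phi over intervals to
    the right of 0 to vanish. *)
Theorem necessity : {ae mu, forall u, 0 < u -> phi u = 0} \/
  {ae mu, forall u, u < 0 -> psi u = 0}.
Proof.
have [h|h] := pselect (forall p q : R, p < q -> q < 0 -> forall k,
  \int[mu]_x (qco k (psi x) * \1_(`[p, q]) x) = 0).
  right; apply: ae_qco => k; apply: ae_zero_neg; first exact: (hs k).
  by move=> p q pq q0; exact: h.
left; apply: ae_qco => k; apply: ae_zero_pos; first exact: (hp k).
move=> p q p0 pq.
apply: contrapT => nz; apply: h => p' q' pq' q0'.
have a0 : 0 <= - q' by rewrite oppr_ge0 ltW.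
case: (winint_dichotomy q (- p') (ltW p0) a0) => [/(_ k)//|].
by rewrite !opprK.
Qed.

End Necessity.

(** * Composition of Wiener-Hopf operators and the equivalence *)

Section Composition.
Variable R : realType.
Notation H := (quat R).
Notation mu := (@lebesgue_measure R).
Implicit Types f F : R -> H.
Implicit Types Phi Psi : H -> H.
Variable i : H.
Hypothesis hi : qsphere i.

Lemma wiener_hopf_comp_rep (c1 c2 : H) (phi psi : R -> H) Phi Psi f F :
  wiener_rep c1 phi Phi -> wiener_rep c2 psi Psi -> hardy_rep i f F ->
  let h v := c2 * f v + qconv psi f v in
  hardy_rep i (pos (fun v => c1 * pos h v + qconv phi (pos h) v))
    ((wiener_hopf i Phi \o wiener_hopf i Psi) F).
Proof.
move=> r1 r2 hF h; apply: (wiener_hopf_rep hi r1).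
exact: (wiener_hopf_rep hi r2).
Qed.

Lemma wstar_rep (c1 c2 : H) (phi psi : R -> H) Phi Psi :
  qintg mu phi -> qintg mu psi ->
  wiener_coef Phi = (c1, phi) -> wiener_coef Psi = (c2, psi) ->
  wiener_rep (c1 * c2) (symbol c1 c2 phi psi) (wstar Phi Psi).
Proof.
move=> h1 h2 e1 e2; split; first by apply/qLp1P; exact: qintg_symbol.
by move=> j y _; rewrite /wstar e1 e2.
Qed.

(** [wiener_minus] asks for the existence of suitable coefficients; by uniqueness the condition can
    be read on any given ones. *)
Lemma wiener_minusP (c : H) (phi : R -> H) Phi : wiener_rep c phi Phi ->
  wiener_minus i Phi <-> {ae mu, forall u, 0 < u -> phi u = 0}.
Proof.
move=> [/qLp1P ip e]; split.
  move=> [c' [f [/qLp1P hf f0 e']]].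
  have [|_ pf] := wfun_unique hi ip hf (c := c) (c' := c') _.
    by move=> y; rewrite -e// e'.
  by apply: ae_imp2 pf f0 => u -> h /h.
move=> h; exists c, phi; split => //; first exact/qLp1P.
by move=> y; exact: e.
Qed.

Lemma wiener_plusP (c : H) (psi : R -> H) Psi : wiener_rep c psi Psi ->
  wiener_plus i Psi <-> {ae mu, forall u, u < 0 -> psi u = 0}.
Proof.
move=> [/qLp1P ip e]; split.
  move=> [c' [f [/qLp1P hf f0 e']]].
  have [|_ pf] := wfun_unique hi ip hf (c := c) (c' := c') _.
    by move=> y; rewrite -e// e'.
  by apply: ae_imp2 pf f0 => u -> h /h.
move=> h; exists c, psi; split => //; first exact/qLp1P.
by move=> y; exact: e.
Qed.

(** Reduces equality of operators to an a.e. identity between coefficient functions. *)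
Lemma hardy_rep_ae f g F G : hardy_rep i f F -> hardy_rep i g G ->
  {ae mu, forall y, F y = G y} <-> {ae mu, forall u, f u = g u}.
Proof.
move=> /hardy_repP[hf _ fF] /hardy_repP[hg _ gG]; split.
  exact: (fourier2_inj hi hf hg fF gG).
exact: (fourier2_unique hi hf hg fF gG).
Qed.

Lemma comp_sufficient (c1 c2 : H) (phi psi : R -> H) Phi Psi G :
  wiener_rep c1 phi Phi -> wiener_rep c2 psi Psi ->
  wiener_rep (c1 * c2) (symbol c1 c2 phi psi) G ->
  {ae mu, forall u, 0 < u -> phi u = 0} \/ {ae mu, forall u, u < 0 -> psi u = 0} ->
  hardy_op_eq i (wiener_hopf i Phi \o wiener_hopf i Psi) (wiener_hopf i G).
Proof.
move=> r1 r2 r3 c F [f hF].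
have /hardy_repP[hf f0 _] := hF.
have [[/qLp1P h1 _] [/qLp1P h2 _]] := (r1, r2).
have a1 := wiener_hopf_comp_rep r1 r2 hF; have a2 := wiener_hopf_rep hi r3 hF.
exact/(hardy_rep_ae a1 a2)/(ae_pos_compose c1 c2 h1 h2 hf f0 c).
Qed.

(** Comparing T_G with the whole-line composition leaves, on u >= 0, phi convolved with the
    discarded part; hence [d = c1 * c2 - c], and [eta] is the difference of the L_1 symbols. *)
Lemma comp_necessary (c1 c2 c : H) (phi psi chi : R -> H) Phi Psi G :
  wiener_rep c1 phi Phi -> wiener_rep c2 psi Psi -> wiener_rep c chi G ->
  hardy_op_eq i (wiener_hopf i Phi \o wiener_hopf i Psi) (wiener_hopf i G) ->
  {ae mu, forall u, 0 < u -> phi u = 0} \/ {ae mu, forall u, u < 0 -> psi u = 0}.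
Proof.
move=> r1 r2 r3 op.
have [[[/qLp1P h1 _] [/qLp1P h2 _]] [/qLp1P h3 _]] := (r1, r2, r3).
have h4 := qintg_symbol c1 c2 h1 h2.
have h5 : qintg mu (fun u => symbol c1 c2 phi psi u - chi u).
  exact: (qintgD h4 (qintgN h3)).
apply: (necessity h1 h2 h5 (d := c1 * c2 - c)) => f hf f0.
have hF : hardy_rep i f (fourier2 i f).
  by apply/hardy_repP; split => //; exact: fourier2_fun.
have a1 := wiener_hopf_comp_rep r1 r2 hF; have a2 := wiener_hopf_rep hi r3 hF.
have /(hardy_rep_ae a1 a2) e := op _ (ex_intro _ f hF).
pose h v := c2 * f v + qconv psi f v.
have hh : L2 h by apply: L2D; [exact: L2Ml|exact: L2_qconv].
(* f vanishes on v < 0, so [c2 * f v] adds nothing to the negative part. *)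
have nE : neg (qconv psi f) = neg h.
  apply/funext => v; rewrite /neg; case: ifPn => //; rewrite -ltNge => v0.
  by rewrite /h f0// mulr0 add0r.
rewrite nE.
apply: ae_imp2 (ae_and e (ae_compose c1 c2 h1 h2 hf))
  (ae_and (ae_conv_split h1 hh)
    (ae_and (ae_qintg_conv2 h4 hf) (ae_qintg_conv2 h3 hf))).
move=> u [e1 e2] [e3 [i4 i3]] u0.
move: e1; rewrite !(pos_ge0 _ u0) => e1.
have e5 : qconv (fun v => symbol c1 c2 phi psi v - chi v) f u =
    qconv (symbol c1 c2 phi psi) f u - qconv chi f u.
  by rewrite !qconvE -qintB//; congr qintm; apply/funext => v; rewrite mulrBl.
rewrite e5 mulrBl.
have {}e2 : c1 * h u + qconv phi h u =
  c1 * c2 * f u + qconv (symbol c1 c2 phi psi) f u by exact: e2.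
have {}e1 : c1 * h u + qconv phi (pos h) u = c * f u + qconv chi f u by exact: e1.
rewrite addrACA -opprD -e2 -e1 e3.
by rewrite addrA [in RHS]addrAC subrr add0r.
Qed.

End Composition.

Theorem theorem5p4 (R : realType) (i : quat R) (Phi Psi : quat R -> quat R)
    (hi : qsphere i)
    (hPhi : wiener Phi) (hPsi : wiener Psi) :
  ((exists2 G, wiener G &
      hardy_op_eq i (wiener_hopf i Phi \o wiener_hopf i Psi)
                    (wiener_hopf i G))
   <-> wiener_minus i Phi \/ wiener_plus i Psi) /\
  (wiener_minus i Phi \/ wiener_plus i Psi ->
   hardy_op_eq i (wiener_hopf i Phi \o wiener_hopf i Psi)
                 (wiener_hopf i (wstar Phi Psi))).
Proof.
(* The coefficients chosen by [wiener_coef] are kept, because [wstar] computes with them. *)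
have := wiener_coefP hPhi; have := wiener_coefP hPsi.
case e1 : (wiener_coef Phi) => [c1 phi]; case e2 : (wiener_coef Psi) => [c2 psi] /= r2 r1.
have [[/qLp1P h1 _] [/qLp1P h2 _]] := (r1, r2).
have r3 := wstar_rep h1 h2 e1 e2.
have iff1 := wiener_minusP hi r1; have iff2 := wiener_plusP hi r2.
have suf : wiener_minus i Phi \/ wiener_plus i Psi ->
    hardy_op_eq i (wiener_hopf i Phi \o wiener_hopf i Psi)
      (wiener_hopf i (wstar Phi Psi)).
  move=> c; apply: (comp_sufficient hi r1 r2 r3).
  by case: c => [/iff1|/iff2]; [left|right].
split => //; split.
  move=> [G [c [chi r]] op].
  by case: (comp_necessary hi r1 r2 r op) => [/iff1|/iff2]; [left|right].
move=> c; exists (wstar Phi Psi); last exact: suf.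
by exists (c1 * c2), (symbol c1 c2 phi psi).
Qed.
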